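(* Let $l,T>0$, $\alpha\in(0,1)$, $r\ge1$ fixed, and let $\mu\in C([0,T])$ satisfy $0<\mu_0\le\mu(t)\le\mu_{\max}$ for $t\in[0,T]$. Let $u$ be the exact solution of $$\partial_t^\alpha u-u_{xx}-\mu(t)u_{xxt}=f\ \text{ in }(0,l)\times(0,T),\qquad u(0,t)=u(l,t)=0,$$ with initial state $u_0=u(\cdot,0)$, and assume $$u\in C^1([0,T];H^4(0,l))\cap C^2([0,T];H^3(0,l)),\qquad u(\cdot,t)\in H_0^1(0,l)\ \text{ for all }t\in[0,T],$$ $$\max_{0\le t\le T}\big(\|u(\cdot,t)\|_{H^4(0,l)}+\|u_t(\cdot,t)\|_{H^4(0,l)}+\|u_{tt}(\cdot,t)\|_{H^3(0,l)}\big)\le C_u.$$ Let $\{\mathbf u^k\}_{k=0}^M$ be generated by the fully discrete scheme described in the context on the graded mesh $t_k=T(k/M)^r$, started from the exact nodal initial data, and let $\mathbf e^k=\mathbf U^k-\mathbf u^k$, where $\mathbf U^k=(u(x_1,t_k),\dots,u(x_{N-1},t_k))^\top$. Then there exists a constant $C>0$, independent of $h$ and $M$, such that $$\max_{0\le k\le M}\|\mathbf e^k\|_h+\max_{0\le k\le M}\sqrt{\mu^k}\,\|\nabla_h\mathbf e^k\|_h+\Big(\sum_{k=1}^M\tau_k\|\nabla_h\mathbf e^k\|_h^2\Big)^{1/2}\le C\big(h^2+\tau_{\max}+\tau_{\max}^{2-\alpha}\big).$$ Since $2-\alpha>1$, the estimate simplifies, for sufficiently small $\tau_{\max}$, to $$\max_{0\le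 k\le M}\|\mathbf e^k\|_h+\max_{0\le k\le M}\|\nabla_h\mathbf e^k\|_h+\Big(\sum_{k=1}^M\tau_k\|\nabla_h\mathbf e^k\|_h^2\Big)^{1/2}\le C\big(h^2+\tau_{\max}\big).$$ Moreover, for the graded mesh with fixed $r\ge1$ one has $\tau_{\max}=O(M^{-1})$; therefore the method is second-order convergent in space and first-order convergent in time in the discrete norms above, i.e. the left-hand side of the last estimate is bounded by $C(h^2+M^{-1})$.
   Context: Caputo derivative: $\partial_t^\alpha u(x,t)=\frac{1}{\Gamma(1-\alpha)}\int_0^t(t-s)^{-\alpha}\partial_su(x,s)\,ds$. Space grid: $h=l/N$, $x_i=ih$, $i=0,\dots,N$. For $\mathbf v=(v_1,\dots,v_{N-1})^\top\in\mathbb R^{N-1}$ set $v_0=v_N=0$ and $(L_h\mathbf v)_i=(v_{i-1}-2v_i+v_{i+1})/h^2$, $i=1,\dots,N-1$. Discrete inner product and norms: $(\mathbf v,\mathbf w)_h=h\sum_{i=1}^{N-1}v_iw_i$, $\|\mathbf v\|_h=(\mathbf v,\mathbf v)_h^{1/2}$, and $\|\nabla_h\mathbf v\|_h^2=(-L_h\mathbf v,\mathbf v)_h$. Time grid: $t_k=T(k/M)^r$, $k=0,\dots,M$, $\tau_k=t_k-t_{k-1}$, $\tau_{\max}=\max_{1\le k\le M}\tau_k$, $\mu^k=\mu(t_k)$. Weights: $$d_{k,j}=\frac{(t_k-t_{j-1})^{1-\alpha}-(t_k-t_j)^{1-\alpha}}{t_j-t_{j-1}},\qquad 1\le j\le k.$$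 Fully discrete scheme: $\mathbf u^0=(u_0(x_1),\dots,u_0(x_{N-1}))^\top$ and, for $k=1,\dots,M$, with $\mathbf f^k=(f(x_1,t_k),\dots,f(x_{N-1},t_k))^\top$, $$\Big(\frac{d_{k,k}}{\Gamma(2-\alpha)}I-\Big(1+\frac{\mu^k}{\tau_k}\Big)L_h\Big)\mathbf u^k=\mathbf r^k+\mathbf f^k-\frac{\mu^k}{\tau_k}L_h\mathbf u^{k-1},$$ $$\mathbf r^k=\frac{d_{k,1}}{\Gamma(2-\alpha)}\mathbf u^0+\frac{1}{\Gamma(2-\alpha)}\sum_{j=1}^{k-1}(d_{k,j+1}-d_{k,j})\mathbf u^j.$$ The differential equation is understood to hold at all grid points $(x_i,t_k)$, $1\le i\le N-1$, $1\le k\le M$ (including $t_M=T$), with the nodal values of $f$ used in the scheme. *)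

(* Defs.v *)
From HB Require Import structures.
From mathcomp Require Import all_boot all_order all_algebra.
From mathcomp Require Import all_classical all_reals all_analysis.
Set Implicit Arguments.
Unset Strict Implicit.
Unset Printing Implicit Defensive.
Import Order.TTheory GRing.Theory Num.Theory.
Import numFieldNormedType.Exports.
Local Open Scope classical_set_scope.
Local Open Scope ring_scope.

Section Sobolev.
Variables (R : realType) (l : R).
Implicit Types (v g phi : R -> R) (k m : nat).

Local Notation leb := (@lebesgue_measure R).
Local Notation Omega := `]0, l[%classic.

Definition test_function phi : Prop :=
  [/\ forall k x, derivable (derive1n k phi) x 1,
      compact (closure [set x | phi x != 0])
    & closure [set x | phi x != 0] `<=` Omega].

Definition is_weak_derive k v g : Prop :=
  [/\ locally_integrable Omega v, locally_integrable Omega g &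
      forall phi, test_function phi ->
        \int[leb]_(x in Omega) (v x * derive1n k phi x) =
        (-1) ^+ k * \int[leb]_(x in Omega) (g x * phi x)].

(* A version of the k-th weak derivative, which is unique only up to null
   sets; the constant 0 if there is none. *)
Definition weak_derive k v : R -> R := xget (cst 0) [set g | is_weak_derive k v g].

Definition inL2 g : Prop := (g \_ Omega) \in Lfun leb 2%:E.

Definition L2norm g : R := fine ('N[leb]_2%:E[EFin \o (g \_ Omega)])%E.

Definition inH m v : Prop :=
  forall k, (k <= m)%N -> exists2 g, is_weak_derive k v g & inL2 g.

(* Only meaningful if [inH m v]. *)
Definition Hnorm m v : R :=
  Num.sqrt (\sum_(0 <= k < m.+1) L2norm (weak_derive k v) ^+ 2).

(* Closure of the test functions for the H^1 norm. *)
Definition inH01 v : Prop :=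
  inH 1 v /\
  forall eps : R, 0 < eps ->
    exists2 phi, test_function phi & Hnorm 1 (fun x => v x - phi x) < eps.

(* Functions of (x, t), seen as curves t |-> w(., t) in H^m(0, l), 0 <= t <= T. *)
Variable T : R.
Implicit Types w : R -> R -> R.

Definition H_continuous m w : Prop :=
  forall t : R, 0 <= t <= T ->
    inH m (w ^~ t) /\
    (fun s => Hnorm m (fun x => w x s - w x t)) @ within `[0, T] (nbhs t) --> 0.

(* [w'] is the derivative in H^m of the curve [w] (one-sided at 0 and T). *)
Definition H_derivative m w w' : Prop :=
  forall t : R, 0 <= t <= T ->
    (fun s => Hnorm m (fun x => (s - t)^-1 * (w x s - w x t) - w' x t))
      @ within `[0, T] (t^') --> 0.

Definition H_C1 m w w' : Prop :=
  [/\ H_continuous m w, H_continuous m w' & H_derivative m w w'].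

Definition H_C2 m w w' w'' : Prop := H_C1 m w w' /\ H_C1 m w' w''.

End Sobolev.

Section Equation.
Variable R : realType.
Implicit Types (alpha T t x z : R) (u f : R -> R -> R) (mu : R -> R).

Definition Gamma z : R :=
  \int[@lebesgue_measure R]_(s in `]0, +oo[) (s `^ (z - 1) * expR (- s)).

Definition caputo alpha u x t : R :=
  (Gamma (1 - alpha))^-1 *
  \int[@lebesgue_measure R]_(s in `]0, t[) ((t - s) `^ (- alpha) * derive1 (u x) s).

(* Derivative at t of a function on [0, T]: the usual one if 0 < t < T,
   one-sided at the endpoints. *)
Definition time_derive T (g : R -> R) t : R :=
  lim ((fun s => (s - t)^-1 * (g s - g t)) @ within `[0, T] (t^')).

Definition dxx u x t : R := derive1n 2 (u ^~ t) x.

Definition equation_at alpha T mu u f x t : Prop :=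
  caputo alpha u x t - dxx u x t - mu t * time_derive T (dxx u x) t = f x t.

End Equation.

Section Grids.
Variable R : realType.

Section Space.
Variables (l : R) (N : nat).

Definition hstep : R := l / N%:R.
Definition xnode (i : nat) : R := i%:R * hstep.

(* A grid vector (v_1, ..., v_{N-1}) is stored with indices shifted by one;
   [vext v i] is v_i, with v_0 = v_N = 0. *)
Definition vext (v : 'cV[R]_N.-1) (i : nat) : R :=
  if i is j.+1 then oapp (fun j' : 'I_N.-1 => v j' 0) 0 (insub j) else 0.

Definition nodal (g : R -> R) : 'cV[R]_N.-1 := \col_(i < N.-1) g (xnode i.+1).

Definition Lh (v : 'cV[R]_N.-1) : 'cV[R]_N.-1 :=
  \col_(i < N.-1) ((vext v i - 2 * vext v i.+1 + vext v i.+2) / hstep ^+ 2).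

Definition ipr (v w : 'cV[R]_N.-1) : R := hstep * \sum_(i < N.-1) v i 0 * w i 0.
Definition hnorm v : R := Num.sqrt (ipr v v).
Definition gradnorm v : R := Num.sqrt (ipr (- Lh v) v).

End Space.

Section Time.
Variables (T r : R) (M : nat).

Definition tnode (k : nat) : R := T * (k%:R / M%:R) `^ r.
Definition tau (k : nat) : R := tnode k - tnode k.-1.
Definition taumax : R := \big[Num.max/0]_(1 <= k < M.+1) tau k.

Definition dcoef (alpha : R) (k j : nat) : R :=
  ((tnode k - tnode j.-1) `^ (1 - alpha) - (tnode k - tnode j) `^ (1 - alpha))
  / (tnode j - tnode j.-1).

End Time.

Definition scheme (l T alpha r : R) (mu : R -> R) (f : R -> R -> R)
    (u0 : R -> R) (N M : nat) (uh : nat -> 'cV[R]_N.-1) : Prop :=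
  let t := tnode T r M in
  let d := dcoef T r M alpha in
  let G := Gamma (2 - alpha) in
  let muk k := mu (t k) in
  let tauk := tau T r M in
  let rhs k := (d k 1%N / G) *: uh 0%N
               + G^-1 *: \sum_(1 <= j < k) (d k j.+1 - d k j) *: uh j in
  uh 0%N = nodal l N u0 /\
  forall k, (1 <= k <= M)%N ->
    (d k k / G) *: uh k - (1 + muk k / tauk k) *: Lh l (uh k)
    = rhs k + nodal l N (f ^~ (t k)) - (muk k / tauk k) *: Lh l (uh k.-1).

Section Errors.
Variables (l T r : R) (N M : nat) (e : nat -> 'cV[R]_N.-1).

Definition max_hnorm : R := \big[Num.max/0]_(0 <= k < M.+1) hnorm l (e k).

Definition max_gradnorm : R := \big[Num.max/0]_(0 <= k < M.+1) gradnorm l (e k).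

Definition max_mu_gradnorm (mu : R -> R) : R :=
  \big[Num.max/0]_(0 <= k < M.+1)
    (Num.sqrt (mu (tnode T r M k)) * gradnorm l (e k)).

Definition l2_gradnorm : R :=
  Num.sqrt (\sum_(1 <= k < M.+1) tau T r M k * gradnorm l (e k) ^+ 2).

End Errors.

Definition nodal_error (l T r : R) (u : R -> R -> R) (N M : nat)
    (uh : nat -> 'cV[R]_N.-1) (k : nat) : 'cV[R]_N.-1 :=
  nodal l N (u ^~ (tnode T r M k)) - uh k.

End Grids.

(* Main.v *)
Require Import Defs.
From mathcomp Require Import all_boot all_order all_algebra.
From mathcomp Require Import all_classical all_reals all_analysis.
From mathcomp Require Import measurable_realfun.
From mathcomp Require Import ring lra.
Set Implicit Arguments.
Unset Strict Implicit.
Unset Printing Implicit Defensive.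
Import Order.TTheory GRing.Theory Num.Theory.
Import numFieldNormedType.Exports.
Local Open Scope classical_set_scope.
Local Open Scope ring_scope.

(** Everything follows from one estimate, a bound of the discrete gradient norm of
the nodal error by a multiple of h^2 + taumax: the discrete Poincare inequality
[hnorm_gradnorm], the upper bound of mu and the identity sum tau_k = T turn it
into bounds for the other norms, and [taumax_le] compares taumax with 1/M.
The gradient bound is proved as consistency plus stability.

Regularity.  The hypotheses speak of weak derivatives and of H^m norms, while
the scheme evaluates u at points.  In dimension one a weak derivative is a
derivative: testing against mollified indicator functions of intervals gives the
du Bois-Reymond lemma, hence every function of H^m has representatives G 0, ...,
G m of its weak derivatives such that G k is a primitive of G k.+1
([sobrep_exists]).  The Sobolev inequality [sobrep_bound] controls G 0, ...,
G m.-1 uniformly and G m in L^1 by the H^m norm.  Convergence of difference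
quotients in H^m therefore becomes pointwise differentiability in time of the
representatives ([tder_sobrep]).

Consistency.  The residual of the exact nodal values splits into the error of
the L1 formula for the Caputo derivative, of first order since u_t is Lipschitz
in time; the error of L_h for u_xx; and the error of the difference quotient of
L_h u for u_xxt.  Because u_xxxx is controlled only in the mean, the second one
need not be pointwise of order h^2: at x_i it is at most 2 h times the integral of
|u_xxxx| from x_(i-1) to x_(i+1).  Multiplied by h and summed over i this is of
order h^2, so the residual is measured in the discrete L^1 norm.  The third one
is treated in the same way, with u_t in place of u ([sum_tder_lipschitz]).

Stability.  Write e^k as the sum of its increments E^j = e^j - e^(j-1) and pair
the error equation with E^k.  The coercive term mu/tau_k |grad E^k|^2 is kept,
the history terms are bounded by Cauchy-Schwarz and Poincare, and the residual is
paired in L^1 with the sup norm of E^k, which in dimension one is bounded by its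
gradient norm.  For a_k = |grad E^k| / tau_k this gives a discrete Volterra
inequality whose kernel consists of increments of x^(1-alpha) and of x over the
mesh cells ([energy_step]).  A Gronwall argument with an
exponential weight ([discrete_gronwall]) bounds all a_k, and summing tau_k a_k
bounds the gradient norm of e^k itself ([stability]). *)

(** * A smooth step function *)

Section SmoothStep.
Context {R : realType}.
Implicit Types (f g : R -> R) (x y : R) (n k : nat).

(** Smoothness by explicit derivatives, so that products and compositions are
    handled by induction without computing iterated derivatives. *)
Fixpoint smooth n f : Prop :=
  if n is n'.+1 then
    exists2 f', (forall x, is_derive x 1 f (f' x)) & smooth n' f'
  else True.

Lemma smoothW n f : smooth n.+1 f -> smooth n f.
Proof.
elim: n f => [//|n IH] f [f' df sf']; exists f' => //; exact: IH.
Qed.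

Lemma smooth_derive1 n f : smooth n.+1 f -> smooth n (derive1 f).
Proof.
move=> [f' df sf']; suff -> : derive1 f = f' by [].
by apply/funext => x; rewrite derive1E; have [_ ->] := df x.
Qed.

Lemma smooth_derivable f : (forall n, smooth n f) ->
  forall k x, derivable (derive1n k f) x 1.
Proof.
move=> sf k x.
have : smooth 1 (derive1n k f).
  elim: k f sf => [|k IH] f sf; first exact: (sf 1%N).
  rewrite derive1nS /derive1n -iterS iterSr; apply: IH => n.
  exact/smooth_derive1/sf.
by move=> [f' df _]; case: (df x).
Qed.

Lemma smooth_cst n c : smooth n (fun=> c).
Proof.
elim: n c => [//|n IH] c; exists (fun=> 0); last exact: IH.
by move=> x; exact: is_derive_cst.
Qed.

Lemma smoothD n f g : smooth n f -> smooth n g -> smooth n (fun x => f x + g x).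
Proof.
elim: n f g => [//|n IH] f g [f' df sf] [g' dg sg].
exists (fun x => f' x + g' x); last exact: IH.
by move=> x; exact: is_deriveD.
Qed.

Lemma smoothM n f g : smooth n f -> smooth n g -> smooth n (fun x => f x * g x).
Proof.
elim: n f g => [//|n IH] f g sf sg.
case: (sf) => f' df sf'; case: (sg) => g' dg sg'.
exists (fun x => f x * g' x + g x * f' x); first by move=> x; exact: is_deriveM.
by apply: smoothD; apply: IH => //; exact: smoothW.
Qed.

Lemma smoothN n f : smooth n f -> smooth n (fun x => - f x).
Proof.
move=> /(smoothM (smooth_cst n (-1))).
by under eq_fun do rewrite mulN1r.
Qed.

Lemma smoothV n f : (forall x, f x != 0) -> smooth n f -> smooth n (fun x => (f x)^-1).
Proof.
move=> f0; elim: n => [//|n IH] sf; case: (sf) => f' df sf'.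
exists (fun x => - (f x) ^- 2 *: f' x); first by move=> x; apply: is_deriveV.
have := IH (smoothW sf) => sV.
apply: smoothM => //; apply: smoothN.
have -> : (fun x => f x ^- 2) = (fun x => (f x)^-1 * (f x)^-1).
  by apply/funext => x; rewrite -expr2 exprVn.
exact: smoothM.
Qed.

Lemma smooth_affine n f a b : smooth n f -> smooth n (fun x => f (a * x + b)).
Proof.
elim: n f => [//|n IH] f [f' df sf'].
exists (fun x => f' (a * x + b) * a); last first.
  by apply: smoothM; [exact: IH | exact: smooth_cst].
move=> x.
have da : is_derive x 1 (fun x : R => a * x + b) a.
  have d1 : is_derive x 1 (fun x : R => a * x) a.
    have := @is_deriveZ _ _ _ (@id R) a x 1 1 (is_derive_id _ _).
    by rewrite /GRing.scale /= mulr1.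
  by have := is_deriveD d1 (is_derive_cst b x 1); rewrite addr0.
exact: (is_derive1_comp (df _) da).
Qed.

(** The functions x^-n exp(-1/x), extended by 0 to the left.  All negative powers
    are kept at once because the family is closed under differentiation. *)
Definition flat n x : R := if 0 < x then x ^- n * expR (- x^-1) else 0.

(** The series of exp(1/x) contains the term x^-(n+1) / (n+1)!. *)
Lemma flat_bound n x : 0 < x -> 0 <= flat n x <= (n.+1)`!%:R * x.
Proof.
move=> x0; rewrite /flat x0 mulr_ge0 ?expR_ge0 ?invr_ge0 ?exprn_ge0 ?(ltW x0)//=.
have xV0 : 0 <= x^-1 by rewrite invr_ge0 ltW.
have := expR_ge1Dxn n xV0; rewrite expRN => h.
have h2 : x^-1 ^+ n.+1 / n.+1`!%:R <= expR x^-1 by apply: le_trans h; rewrite lerDr.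
rewrite ler_pdivrMr ?expR_gt0//.
have F0 : 0 < n.+1`!%:R :> R by rewrite ltr0n fact_gt0.
apply: le_trans (ler_wpM2l _ h2); last by rewrite mulr_ge0 // ltW.
rewrite exprVn exprSr invfM.
rewrite [X in _ <= X](_ : _ = x ^- n) //.
have xn0 : x ^+ n != 0 by rewrite expf_neq0 // gt_eqF.
have xn : x != 0 by rewrite gt_eqF.
move: (n.+1`!%:R) F0 => F F0; by field; rewrite xn xn0 /= gt_eqF.
Qed.

Lemma flat_cvg0 n : flat n x @[x --> (0:R)] --> 0.
Proof.
apply/cvgrPdist_le => e e0.
have F0 : 0 < n.+1`!%:R :> R by rewrite ltr0n fact_gt0.
near=> x; rewrite sub0r normrN.
have [x0|x0] := ltP 0 x; last by rewrite /flat ltNge x0 /= normr0 ltW.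
have /andP[a b] := flat_bound n x0.
rewrite ger0_norm// (le_trans b)//.
rewrite -ler_pdivlMl// (le_trans (ler_norm x))//.
near: x; apply: (@cvgr0_norm_le _ _ _ _ _ (@id R)); first exact: cvg_id.
by rewrite mulr_gt0// invr_gt0.
Unshelve. all: by end_near. Qed.

Lemma is_derive_flat n x :
  is_derive x 1 (flat n) (- n%:R * flat n.+1 x + flat n.+2 x).
Proof.
have [x0|x0|x0] := ltgtP x 0.
- have -> : - n%:R * flat n.+1 x + flat n.+2 x = 0.
    by rewrite /flat !ltNge (ltW x0)/= mulr0 addr0.
  apply: (@near_eq_is_derive _ _ _ (cst 0) (flat n) x 1 0).
  near=> y; rewrite /flat ltNge ltW//=.
  by near: y; exact: lt_nbhsl.
- have xn : x != 0 by rewrite gt_eqF.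
  apply: (@near_eq_is_derive _ _ _ (fun y => y ^- n * expR (- y^-1))).
    near=> y; rewrite /flat ifT//.
    near: y; exact: lt_nbhsr.
  have d1 : is_derive x 1 (fun y : R => y ^- n) (- (x ^+ n) ^- 2 *: (n%:R * x ^+ n.-1)).
    apply: is_deriveV; first by rewrite expf_neq0.
    have := @is_deriveX _ _ (@id R) n x 1 1 (is_derive_id _ _).
    by rewrite exprfctE /GRing.scale /= mulr1.
  have d2 : is_derive x 1 (fun y : R => - y^-1) (x ^- 2).
    have := @is_deriveN _ _ _ _ x 1 _ (@is_deriveV _ (@id R) x 1 1 xn (is_derive_id _ _)).
    by rewrite /GRing.scale /= mulr1 opprK.
  have d3 := @is_derive1_comp _ expR (fun y : R => - y^-1) x _ _ (is_derive_expR (- x^-1)) d2.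
  have := is_deriveM d1 d3; move/is_derive_eq; apply.
  rewrite /flat x0 /GRing.scale /=.
  case: n {d1} => [|n] /=.
    by rewrite !mul0r !mulr0 oppr0 mul0r !expr0 addr0 add0r; field.
  have xk : x ^+ n != 0 by rewrite expf_neq0.
  by rewrite !exprS; field; rewrite xn xk.
- have -> : - n%:R * flat n.+1 x + flat n.+2 x = 0.
    by rewrite x0 /flat ltxx mulr0 addr0.
  rewrite x0.
  have h : h^-1 *: (flat n (h *: 1 + 0) - flat n 0) @[h --> (0:R)^'] --> (0:R).
    have : flat n.+1 h @[h --> (0:R)^'] --> (0:R).
      apply: cvg_trans (@flat_cvg0 n.+1); apply: cvg_app; exact: cvg_within.
    apply: cvg_trans; apply: near_eq_cvg; near=> h.
    rewrite addr0 /GRing.scale /= mulr1 /flat ltxx subr0; case: ifPn => h0.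
      by rewrite exprS invfM mulrA.
    by rewrite mulr0.
  by split; [apply/cvg_ex; exists 0 | exact/cvg_lim].
Unshelve. all: by end_near. Qed.

Lemma smooth_flat n k : smooth n (flat k).
Proof.
elim: n k => [//|n IH] k.
exists (fun x => - k%:R * flat k.+1 x + flat k.+2 x); first exact: is_derive_flat.
by apply: smoothD => //; apply: smoothM => //; exact: smooth_cst.
Qed.

Lemma flat_ge0 x : 0 <= flat 0 x.
Proof. by rewrite /flat; case: ifP => // _; rewrite mulr_ge0 ?expR_ge0// expr0 invr1. Qed.

Lemma flat_gt0 x : 0 < x -> 0 < flat 0 x.
Proof. by move=> x0; rewrite /flat x0 expr0 invr1 mul1r expR_gt0. Qed.

(** The denominator does not vanish because one of x and 1 - x is positive. *)
Definition step x : R := flat 0 x / (flat 0 x + flat 0 (1 - x)).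

Lemma step_den x : 0 < flat 0 x + flat 0 (1 - x).
Proof.
have [x0|x0] := ltP 0 x; first by rewrite ltr_pwDl ?flat_gt0 ?flat_ge0.
by rewrite ltr_wpDl ?flat_ge0 ?flat_gt0 //; lra.
Qed.

Lemma smooth_step n : smooth n step.
Proof.
apply: smoothM; first exact: smooth_flat.
apply: smoothV => [x|]; first exact/lt0r_neq0/step_den.
apply: smoothD; first exact: smooth_flat.
have := smooth_affine (-1) 1 (smooth_flat n 0).
by under eq_fun do rewrite mulN1r addrC.
Qed.

Lemma step0 x : x <= 0 -> step x = 0.
Proof. by move=> x0; rewrite /step {1}/flat ltNge x0 /= mul0r. Qed.

Lemma step1 x : 1 <= x -> step x = 1.
Proof.
move=> x1; rewrite /step {3}/flat subr_gt0 ltNge x1 /= addr0 divff//.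
by rewrite gt_eqF// flat_gt0// (lt_le_trans _ x1).
Qed.

Lemma step01 x : 0 <= step x <= 1.
Proof.
have d := step_den x; rewrite /step divr_ge0 ?flat_ge0 ?(ltW d)//=.
by rewrite ler_pdivrMr// mul1r lerDl flat_ge0.
Qed.

Lemma derivable_step x : derivable step x 1.
Proof. by have [f' df _] := smooth_step 1; case: (df x). Qed.

Lemma continuous_dstep : continuous (derive1 step).
Proof.
have [f' df _] := smooth_derive1 (smooth_step 2) => x.
apply: differentiable_continuous; apply/derivable1_diffP.
by case: (df x).
Qed.

Lemma dstep_out (x : R) : x < 0 \/ 1 < x -> derive1 step x = 0.
Proof.
have d0 (k : R) : (\near x, step x = k) -> derive1 step x = 0.
  move=> h; rewrite derive1E (@near_eq_derive _ _ _ _ (cst k)) ?derive_cst//.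
move=> [x0|x1]; [apply: (d0 0)|apply: (d0 1)]; near=> y.
  by apply/step0/ltW; near: y; exact: lt_nbhsl.
by apply/step1/ltW; near: y; exact: lt_nbhsr.
Unshelve. all: by end_near. Qed.

(** The derivative vanishes outside of [0, 1], where it is continuous. *)
Lemma dstep_bound : exists2 C, 0 < C & forall x, `|derive1 step x| <= C.
Proof.
have ac : {within `[(0:R), 1], continuous (fun x => `|derive1 step x|)}.
  apply: continuous_subspaceT => x; apply: continuous_comp.
    exact: continuous_dstep.
  exact: norm_continuous.
have [c _ cmax] := EVT_max ler01 ac.
exists (`|derive1 step c| + 1) => [|x]; first by rewrite ltr_wpDl.
have [x0|x0] := ltP x 0; first by rewrite dstep_out ?normr0 ?addr_ge0//; left.
have [x1|x1] := ltP 1 x; first by rewrite dstep_out ?normr0 ?addr_ge0//; right.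
by rewrite (le_trans (cmax x _)) ?lerDl// in_itv/= x0.
Qed.
End SmoothStep.

(** * Lebesgue integrals of real functions and mollification *)

Section Mollify.
Context {R : realType}.
Local Notation leb := (@lebesgue_measure R).
Implicit Types (f g h W : R -> R) (x y z a b : R) (D : set R).

(** This lemma and the next ones fix the measure and use real-valued functions; they
    are the forms in which integrability is used below. *)
Lemma integrable_mulb D f h C : measurable D ->
  leb.-integrable D (EFin \o f) -> measurable_fun D h ->
  (forall x, D x -> `|h x| <= C) ->
  leb.-integrable D (EFin \o (fun x => f x * h x)).
Proof.
move=> mD fi mh hC; apply: (integrableMl _ fi) => //; exists C; split; first exact: num_real.
by move=> M CM x Dx; apply: le_trans (hC x Dx) (ltW CM).
Qed.

Lemma integrable_bdd D f C : measurable D -> (leb D < +oo)%E ->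
  measurable_fun D f -> (forall x, D x -> `|f x| <= C) ->
  leb.-integrable D (EFin \o f).
Proof.
move=> mD lD mf fC; apply: measurable_bounded_integrable => //.
exists C; split; first exact: num_real.
by move=> M CM x Dx; apply: le_trans (fC x Dx) (ltW CM).
Qed.

Lemma itgS D E f : measurable E -> measurable D -> D `<=` E ->
  leb.-integrable E (EFin \o f) -> leb.-integrable D (EFin \o f).
Proof. by move=> mE mD DE; apply: (@integrableS _ _ _ leb E D). Qed.

Lemma itgB D f g : measurable D -> leb.-integrable D (EFin \o f) ->
  leb.-integrable D (EFin \o g) -> leb.-integrable D (EFin \o (fun x => f x - g x)).
Proof. by move=> mD fi gi; exact: (@integrableB _ _ _ leb D mD _ _ fi gi). Qed.

Lemma itgD D f g : measurable D -> leb.-integrable D (EFin \o f) ->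
  leb.-integrable D (EFin \o g) -> leb.-integrable D (EFin \o (fun x => f x + g x)).
Proof. by move=> mD fi gi; exact: (@integrableD _ _ _ leb D mD _ _ fi gi). Qed.

Lemma itgZl D c f : measurable D -> leb.-integrable D (EFin \o f) ->
  leb.-integrable D (EFin \o (fun x => c * f x)).
Proof. by move=> mD fi; exact: (@integrableZl _ _ _ leb D mD c _ fi). Qed.

Lemma itg_norm D f : leb.-integrable D (EFin \o f) ->
  leb.-integrable D (EFin \o (fun x => `|f x|)).
Proof. exact: integrable_norm. Qed.

Lemma RintZl D f c : measurable D -> leb.-integrable D (EFin \o f) ->
  \int[leb]_(x in D) (c * f x) = c * \int[leb]_(x in D) f x.
Proof. by move=> mD fi; rewrite RintegralZl. Qed.

Lemma RintD D f g : measurable D -> leb.-integrable D (EFin \o f) ->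
  leb.-integrable D (EFin \o g) ->
  \int[leb]_(x in D) (f x + g x) = \int[leb]_(x in D) f x + \int[leb]_(x in D) g x.
Proof. by move=> mD fi gi; rewrite RintegralD. Qed.

Lemma RintB D f g : measurable D -> leb.-integrable D (EFin \o f) ->
  leb.-integrable D (EFin \o g) ->
  \int[leb]_(x in D) (f x - g x) = \int[leb]_(x in D) f x - \int[leb]_(x in D) g x.
Proof. by move=> mD fi gi; rewrite RintegralB. Qed.

Lemma le_normr_Rint D f : measurable D -> leb.-integrable D (EFin \o f) ->
  `|\int[leb]_(x in D) f x| <= \int[leb]_(x in D) `|f x|.
Proof. by move=> mD fi; apply: le_normr_Rintegral. Qed.

Lemma le_Rint D f g : measurable D -> leb.-integrable D (EFin \o f) ->
  leb.-integrable D (EFin \o g) -> (forall x, D x -> f x <= g x) ->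
  \int[leb]_(x in D) f x <= \int[leb]_(x in D) g x.
Proof. by move=> mD fi gi fg; apply: le_Rintegral. Qed.

Lemma itg_restrict D E f : measurable E -> measurable D ->
  leb.-integrable (E `&` D) (EFin \o f) <-> leb.-integrable E (EFin \o (f \_ D)).
Proof.
by move=> mE mD; rewrite -restrict_EFin; apply: (@integrable_restrict _ _ _ leb D mD E mE).
Qed.

Lemma ae_imp (P Q : R -> Prop) : (forall x, P x -> Q x) ->
  {ae leb, forall x, P x} -> {ae leb, forall x, Q x}.
Proof. by move=> PQ; apply: filterS; first exact: (ae_filter_ringOfSetsType leb). Qed.

Lemma measurable_funS_restrict D E f : measurable E -> measurable D ->
  measurable_fun E f -> measurable_fun E (f \_ D).
Proof.
move=> mE mD mf; apply/measurable_restrict => //.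
by apply: measurable_funS mf => //; exact: subIsetl.
Qed.

Lemma EFin_Rint D f : measurable D -> leb.-integrable D (EFin \o f) ->
  (\int[leb]_(x in D) (f x)%:E = (\int[leb]_(x in D) f x)%:E)%E.
Proof.
move=> mD fi; rewrite /Rintegral fineK//.
exact: (@integrable_fin_num _ _ _ leb D mD _ fi).
Qed.

Lemma continuous_measurable D h : continuous h -> measurable_fun D h.
Proof. by move=> ch; apply: measurable_funTS; exact: continuous_measurable_fun. Qed.

Lemma dominated_Rcvg D (f_ : nat -> R -> R) f g : measurable D ->
  (forall n, measurable_fun D (f_ n)) ->
  leb.-integrable D (EFin \o g) ->
  (forall n x, D x -> `|f_ n x| <= g x) ->
  (forall x, D x -> f_ n x @[n --> \oo] --> f x) ->
  measurable_fun D f ->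
  \int[leb]_(x in D) f_ n x @[n --> \oo] --> \int[leb]_(x in D) f x.
Proof.
move=> mD mf_ ig fg cf mf.
have mf_E n : measurable_fun D (EFin \o f_ n) by exact/measurable_EFinP.
have mfE : measurable_fun D (EFin \o f) by exact/measurable_EFinP.
have cE : {ae leb, forall x, D x -> (EFin \o f_ n) x @[n --> \oo] --> (EFin \o f) x}.
  by apply: aeW => x Dx; apply/cvg_EFin; [exact: nearW | exact: cf].
have bE : {ae leb, forall x n, D x -> (`|(EFin \o f_ n) x| <= (EFin \o g) x)%E}.
  by apply: aeW => x n Dx; rewrite lee_fin; exact: fg.
have [fi _ cv] := @dominated_convergence _ _ _ leb D mD _ _ _ mf_E mfE cE ig bE.
apply: fine_cvg; rewrite /= fineK //.
exact: integrable_fin_num.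
Qed.

(** A one-sided approximate identity, supported in [x, x + 1/(n+1)].  It is a
    derivative, so that it can also be produced from the test functions of the
    definition of weak derivatives. *)
Definition moll (n : nat) x z : R := n.+1%:R * derive1 step (n.+1%:R * (z - x)).
Definition bigstep (n : nat) x z : R := step (n.+1%:R * (z - x)).

Lemma smooth_bigstep k n x : smooth k (bigstep n x).
Proof.
have := smooth_affine n.+1%:R (- n.+1%:R * x) (smooth_step (R:=R) k).
rewrite (_ : (fun _ => _) = bigstep n x)//.
by apply/funext => z; rewrite /bigstep mulrBr mulNr.
Qed.

Lemma is_derive_bigstep n x z : is_derive z 1 (bigstep n x) (moll n x z).
Proof.
have dB : is_derive z 1 (fun z => n.+1%:R * (z - x)) n.+1%:R.
  have d1 : is_derive z 1 (fun z : R => z - x) 1.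
    by have := is_deriveB (is_derive_id z 1) (is_derive_cst x z 1); rewrite subr0.
  by have := is_deriveZ n.+1%:R d1; rewrite /GRing.scale /= mulr1.
have dS := derivableP (@derivable_step R (n.+1%:R * (z - x))).
have := @is_derive1_comp _ step (fun z => n.+1%:R * (z - x)) z _ _ dS dB.
by rewrite /moll derive1E mulrC.
Qed.

Lemma derive1_bigstep n x : derive1 (bigstep n x) = moll n x.
Proof. by apply/funext => z; rewrite derive1E; have [_ ->] := is_derive_bigstep n x z. Qed.

Lemma smooth_moll k n x : smooth k (moll n x).
Proof. by rewrite -derive1_bigstep; apply/smooth_derive1/smooth_bigstep. Qed.

Lemma smooth_continuous f : smooth 1 f -> continuous f.
Proof.
move=> [f' df _] x; apply: differentiable_continuous; apply/derivable1_diffP.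
by case: (df x).
Qed.

Lemma moll_out n x z : z < x \/ x + n.+1%:R^-1 < z -> moll n x z = 0.
Proof.
move=> h; rewrite /moll dstep_out ?mulr0//.
case: h => h; [left|right]; first by rewrite pmulr_rlt0// subr_lt0.
by rewrite -ltr_pdivrMl// mulr1 ltrBrDl.
Qed.

Lemma int_moll n x a b : a < b ->
  \int[leb]_(z in `[a, b]) moll n x z = bigstep n x b - bigstep n x a.
Proof.
move=> ab; rewrite /Rintegral (@continuous_FTC2 _ _ (bigstep n x))//.
- apply: continuous_subspaceT; apply: smooth_continuous; exact: (smooth_moll 1).
- have cb : continuous (bigstep n x) by apply: smooth_continuous; exact: (smooth_bigstep 1).
  split.
  + by move=> z _; case: (is_derive_bigstep n x z).
  + exact/cvg_at_right_filter/cb.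
  + exact/cvg_at_left_filter/cb.
- by move=> z _; rewrite derive1_bigstep.
Qed.

Lemma int_moll_ball n x (r : R) : n.+1%:R^-1 <= r ->
  \int[leb]_(z in ball x r) moll n x z = 1.
Proof.
move=> nr; have n0 : 0 < n.+1%:R^-1 :> R by rewrite invr_gt0.
have r0 : 0 < r := lt_le_trans n0 nr.
have icc : leb.-integrable `[x - r, x + r] (EFin \o moll n x).
  apply: continuous_compact_integrable; first exact: segment_compact.
  by apply: continuous_subspaceT; apply: smooth_continuous; exact: (smooth_moll 1).
rewrite ball_itv Rintegral_itv_bndo_bndc; last first.
  by apply: itgS icc => //; apply: subset_itv; rewrite bnd_simp.
rewrite Rintegral_itv_obnd_cbnd; last first.
  by apply: itgS icc => //; apply: subset_itv; rewrite bnd_simp.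
rewrite int_moll; last by lra.
rewrite /bigstep step1; last first.
  by rewrite addrAC subrr add0r -ler_pdivrMl// mulr1.
rewrite step0 ?subr0// addrAC subrr add0r mulrN oppr_le0 mulr_ge0//; exact: ltW.
Qed.

(** The kernel lives in the ball of radius 2/(n+1) and is bounded by C (n+1), so the
    error is at most a constant times the average of |W - W x| over that ball, which
    tends to 0 at a Lebesgue point. *)
Lemma moll_cvg W x : leb.-integrable setT (EFin \o W) -> lebesgue_pt W x ->
  \int[leb]_z (W z * moll n x z) @[n --> \oo] --> W x.
Proof.
move=> iW Wx; have [C C0 dC] := @dstep_bound R.
have mollC n z : `|moll n x z| <= n.+1%:R * C.
  by rewrite /moll normrM ger0_norm// ler_wpM2l.
pose B n := ball x (2 * n.+1%:R^-1).
have mB n : measurable (B n) by exact: measurable_ball.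
have rn n : 0 < 2 * n.+1%:R^-1 :> R by rewrite mulr_gt0// invr_gt0.
have mm n D : measurable_fun D (moll n x).
  by apply: continuous_measurable; apply: smooth_continuous; exact: (smooth_moll 1).
have ifB n (c : R) : leb.-integrable (B n) (EFin \o cst c).
  apply: (@integrable_bdd _ _ `|c|) => //.
  by rewrite [X in (X < _)%E](lebesgue_measure_ball x (ltW (rn n))) ltry.
have iWB n : leb.-integrable (B n) (EFin \o W).
  by apply: (itgS measurableT (mB n) _ iW).
have WB n : \int[leb]_z (W z * moll n x z) = \int[leb]_(z in B n) (W z * moll n x z).
  rewrite [RHS]Rintegral_mkcond; apply: eq_Rintegral => z _; rewrite patchE.
  case: ifPn => // /negP zB; rewrite moll_out ?mulr0//.
  have n0 : 0 < n.+1%:R^-1 :> R by rewrite invr_gt0.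
  have [zx|zx] := ltP z x; [by left|right; rewrite ltNge; apply/negP => zx'].
  apply: zB; rewrite inE /B /ball/= ltr_distlC; apply/andP; split.
    by apply: lt_le_trans zx; rewrite gtrBl; exact: rn.
  by apply: le_lt_trans zx' _; rewrite ltrD2l ltr_pMl// ltr1n.
have ifM n : leb.-integrable (B n) (EFin \o moll n x).
  apply: (@integrable_bdd _ _ (n.+1%:R * C)) => //.
  by rewrite [X in (X < _)%E](lebesgue_measure_ball x (ltW (rn n))) ltry.
have m1 n : \int[leb]_(z in B n) moll n x z = 1.
  by rewrite int_moll_ball// ler_peMl// ?invr_ge0// ler1n.
have bd n : `|\int[leb]_z (W z * moll n x z) - W x| <=
    4 * C * fine (davg W x (2 * n.+1%:R^-1)).
  have -> : \int[leb]_z (W z * moll n x z) - W x =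
      \int[leb]_(z in B n) ((W z - W x) * moll n x z).
    have e : W x = \int[leb]_(z in B n) (W x * moll n x z).
      by rewrite RintZl// m1 mulr1.
    rewrite WB [X in _ - X = _]e -RintB//.
    - by apply: eq_Rintegral => z _; rewrite mulrBl.
    - exact: (integrable_mulb (mB n) (iWB n) (mm n _) (fun z _ => mollC n z)).
    - have := ifB n (W x) => iB.
      exact: (integrable_mulb (mB n) iB (mm n _) (fun z _ => mollC n z)).
  have iK : leb.-integrable (B n) (EFin \o (fun z => W z - W x)).
    exact: (itgB (mB n) (iWB n) (ifB n (W x))).
  apply: le_trans (le_normr_Rint _ _) _ => //.
    exact: (integrable_mulb (mB n) iK (mm n _) (fun z _ => mollC n z)).
  have -> : 4 * C * fine (davg W x (2 * n.+1%:R^-1)) =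
      (n.+1%:R * C) * \int[leb]_(z in B n) `|W z - W x|.
    have iN : (\int[leb]_(z in B n) `|(W z - W x)%:E| = (\int[leb]_(z in B n) `|W z - W x|)%:E)%E.
      exact: (EFin_Rint (mB n) (itg_norm iK)).
    rewrite /davg /iavg iN [X in (X^-1 * _)%E](lebesgue_measure_ball x (ltW (rn n))).
    rewrite inver mulrn_eq0/= gt_eqF// -EFinM/=.
    rewrite -mulr_natr; field.
    by rewrite nat1r pnatr_eq0.
  rewrite -RintZl//; last exact: itg_norm.
  apply: le_Rint => //.
  - apply: itg_norm.
    exact: (integrable_mulb (mB n) iK (mm n _) (fun z _ => mollC n z)).
  - by apply: itgZl => //; exact: itg_norm.
  - by move=> z _; rewrite normrM mulrC ler_wpM2r.
apply/cvgrPdist_le => e e0.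
have [fin /cvgrPdist_le cv] := proj1 (fine_cvgP _ _) Wx.
have e1 : 0 < e / (4 * C) by rewrite divr_gt0// mulr_gt0.
have [d /= d0 dP] := cv _ e1.
near=> n.
rewrite distrC (le_trans (bd n))// -ler_pdivlMl ?mulr_gt0// [leRHS]mulrC.
have := dP (2 / n.+1%:R); rewrite /= !sub0r !normrN (ger0_norm (ltW (rn n))).
move=> /(_ _ (rn n)) h; apply: le_trans (ler_norm _) (h _).
rewrite ltr_pdivrMr// -ltr_pdivrMl//.
rewrite (@lt_le_trans _ _ n%:R)// ?ler_nat//.
by near: n; exact: nbhs_infty_gtr.
Unshelve. all: by end_near. Qed.
End Mollify.

(** * Weak derivatives and test functions *)

Section WeakDerivative.
Context {R : realType}.
Local Notation leb := (@lebesgue_measure R).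
Variable l : R.
Implicit Types (v w f g h phi : R -> R) (x y z a b : R) (D : set R) (k m n : nat).
Local Notation Omega := `]0, l[%classic.

Lemma test_fun phi a b : 0 < a -> b < l -> (forall n, smooth n phi) ->
  (forall z, z < a \/ b < z -> phi z = 0) -> test_function l phi.
Proof.
move=> a0 bl sphi phi0.
have sub : closure [set x | phi x != 0] `<=` `[a, b].
  have -> : `[a, b]%classic = closure `[a, b] by apply/closure_id; exact: interval_closed.
  apply: closureS => z /= /negP phiz; rewrite in_itv/=.
  have [za|az] := ltP z a; first by exfalso; apply: phiz; rewrite phi0//; left.
  have [bz|zb] := ltP b z; first by exfalso; apply: phiz; rewrite phi0//; right.
  by [].
split; first exact: smooth_derivable.
  apply: subclosed_compact sub; first exact: closed_closure.
  exact: segment_compact.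
apply: subset_trans sub _ => z /=; rewrite !in_itv/= => /andP[az zb].
by rewrite (lt_le_trans a0 az) (le_lt_trans zb bl).
Qed.

(** A derivative vanishes off the support. *)
Lemma test_derive1n phi k : test_function l phi -> test_function l (derive1n k phi).
Proof.
elim: k => [//|k IH] /IH; rewrite derive1nS; move: (derive1n k phi) => f.
move=> [df cf sf].
have sub : closure [set x | derive1 f x != 0] `<=` closure [set x | f x != 0].
  rewrite [X in _ `<=` X](proj1 (closure_id _) (@closed_closure _ _)).
  apply: closureS => z /= f'z; apply: contrapT => zS; move/negP: f'z; apply.
  have : nbhs z (~` closure [set x | f x != 0]).
    by apply: open_nbhs_nbhs; split => //; apply: closed_openC; exact: closed_closure.
  move=> nz; rewrite derive1E (@near_eq_derive _ _ _ _ (cst 0)) ?derive_cst//.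
  near=> y; apply: contrapT => fy.
  have : (~` closure [set x | f x != 0]) y by near: y.
  by apply; apply: subset_closure => /=; apply/eqP.
split.
- move=> j x; have := df j.+1 x; rewrite /derive1n iterSr; exact.
- by apply: subclosed_compact cf sub; exact: closed_closure.
- exact: subset_trans sub sf.
Unshelve. all: by end_near. Qed.

Lemma test_continuous phi : test_function l phi -> continuous phi.
Proof.
move=> [/(_ 0%N) d _ _] x; apply: differentiable_continuous.
by apply/derivable1_diffP; exact: d.
Qed.

Lemma test_integrable v phi : locally_integrable Omega v -> test_function l phi ->
  leb.-integrable Omega (EFin \o (fun x => v x * phi x)).
Proof.
move=> [mv _ iv] tphi; have cphi := test_continuous tphi.
have [_ cK KO] := tphi; set K := closure _ in cK KO.
have mK : measurable K by exact: compact_measurable.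
have ivK : leb.-integrable K (EFin \o v).
  apply/integrableP; split; last exact: iv.
  by apply/measurable_EFinP; apply: measurable_funS mv.
have [C phiC] : exists C, forall x, K x -> `|phi x| <= C.
  have : compact (phi @` K).
    by apply: continuous_compact => //; exact: continuous_subspaceT.
  move=> /compact_bounded[M [_ MP]]; exists (M + 1) => x Kx.
  by apply: (MP (M + 1)); [rewrite ltrDl | exists x].
have : leb.-integrable K (EFin \o (fun x => v x * phi x)).
  apply: (integrable_mulb mK ivK _ phiC); exact: continuous_measurable.
rewrite -(setIidr KO) => /(proj1 (itg_restrict _ (measurable_itv _) mK)); have -> : (fun x => v x * phi x) \_ K = fun x => v x * phi x.
  apply/funext => x; rewrite patchE; case: ifPn => //= /negP xK.
  have -> : phi x = 0; last by rewrite mulr0.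
  by apply: contrapT => px; apply: xK; rewrite inE; apply: subset_closure => /=; exact/eqP.
exact.
Qed.

Lemma locally_integrableZ c v : locally_integrable Omega v ->
  locally_integrable Omega (fun x => c * v x).
Proof.
move=> [mv oO iv]; split => //; first exact: measurable_funM.
move=> K KO cK; under eq_integral do rewrite normrM EFinM.
have mK : measurable K by exact: compact_measurable.
rewrite ge0_integralZl//; first by rewrite lte_mul_pinfty// iv.
by apply/measurable_EFinP/measurableT_comp => //; apply: measurable_funS mv.
Qed.

Lemma is_weak_deriveD k v g w h : is_weak_derive l k v g -> is_weak_derive l k w h ->
  is_weak_derive l k (fun x => v x + w x) (fun x => g x + h x).
Proof.
move=> [lv lg vg] [lw lh wh]; split; [exact: locally_integrableD|exact: locally_integrableD|].
move=> phi tphi; have tp := test_derive1n k tphi.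
under eq_Rintegral do rewrite mulrDl.
rewrite RintD//; [|exact: test_integrable|exact: test_integrable].
rewrite vg// wh// -mulrDr -RintD//; [|exact: test_integrable|exact: test_integrable].
by congr (_ * _); apply: eq_Rintegral => z _; rewrite mulrDl.
Qed.

Lemma is_weak_deriveZ k c v g : is_weak_derive l k v g ->
  is_weak_derive l k (fun x => c * v x) (fun x => c * g x).
Proof.
move=> [lv lg vg]; split; [exact: locally_integrableZ|exact: locally_integrableZ|].
move=> phi tphi; have tp := test_derive1n k tphi.
under eq_Rintegral do rewrite -mulrA.
rewrite RintZl//; last exact: test_integrable.
rewrite vg// mulrCA -RintZl//; last exact: test_integrable.
by congr (_ * _); apply: eq_Rintegral => z _; rewrite mulrA.
Qed.

Lemma is_weak_derive_next k v g g' : is_weak_derive l k v g ->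
  is_weak_derive l k.+1 v g' -> is_weak_derive l 1 g g'.
Proof.
move=> [lv lg vg] [_ lg' vg']; split => // phi tphi.
have := vg' _ tphi; rewrite {1}(_ : derive1n k.+1 phi = derive1n k (derive1n 1 phi)); last first.
  by rewrite /derive1n iterSr.
rewrite vg; last exact: (test_derive1n 1).
rewrite exprS -mulrA [X in _ = X]mulrCA expr1 => h.
have : (-1) ^+ k != 0 :> R by rewrite expf_neq0// oppr_eq0.
by move/mulfI; apply.
Qed.

End WeakDerivative.

(** * Uniqueness of weak derivatives and the du Bois-Reymond lemma *)

Section DuBoisReymond.
Context {R : realType}.
Local Notation leb := (@lebesgue_measure R).
Variable l : R.
Implicit Types (v w f g h phi : R -> R) (x y z a b : R) (D : set R) (k m n : nat).
Local Notation Omega := `]0, l[%classic.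

Lemma test_moll a b n x : 0 < a -> b < l -> a <= x -> x + n.+1%:R^-1 <= b ->
  test_function l (moll n x).
Proof.
move=> a0 bl ax xb; apply: (@test_fun _ _ _ a b) => // [k|z h].
  exact: smooth_moll.
apply: moll_out; case: h => h; [left|right]; first exact: lt_le_trans ax.
exact: le_lt_trans h.
Qed.

Lemma near_harmonic (e : R) : 0 < e -> \forall n \near \oo, n.+1%:R^-1 <= e.
Proof.
by move=> e0; have := near_infty_natSinv_lt (PosNum e0); apply: filterS => n /ltW.
Qed.

(** Testing against the mollifiers at x shows that w vanishes at each of its
    Lebesgue points.  As w is only locally integrable, it is first cut off to the
    compact intervals [1/(n+1), l - 1/(n+1)]. *)
Lemma weak0_ae w : locally_integrable Omega w ->
  (forall phi, test_function l phi -> \int[leb]_(x in Omega) (w x * phi x) = 0) ->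
  {ae leb, forall x, Omega x -> w x = 0}.
Proof.
move=> lw w0; have [mw oO iw] := lw.
pose I n := `[n.+1%:R^-1, l - n.+1%:R^-1]%classic : set R.
have n0 n : 0 < n.+1%:R^-1 :> R by rewrite invr_gt0.
have IO n : I n `<=` Omega.
  move=> x; rewrite /I /= !in_itv/= => /andP[a b].
  by rewrite (lt_le_trans _ a)// (le_lt_trans b)// gtrBl.
have iI n : leb.-integrable setT (EFin \o (w \_ (I n))).
  apply: (proj1 (itg_restrict w measurableT (measurable_itv _))).
  rewrite setTI; apply/integrableP; split.
    by apply/measurable_EFinP; apply: measurable_funS mw => //; exact: IO.
  by apply: iw; [exact: IO|exact: segment_compact].
have : {ae leb, forall x, forall n, lebesgue_pt (w \_ (I n)) x}.
  apply/ae_foralln => n; apply: lebesgue_differentiation.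
  exact: open_integrable_locally openT (iI n).
apply: ae_imp => x Lx; rewrite /= in_itv/= => /andP[x0 xl].
have [n [nx nl]] : exists n, n.+1%:R^-1 < x /\ x < l - n.+1%:R^-1.
  have m0 : 0 < Num.min x (l - x) / 2 by rewrite divr_gt0// lt_min x0 subr_gt0.
  have [n _ nP] := near_harmonic m0; exists n.
  have := nP n (leqnn n) => /= h.
  have h1 : Num.min x (l - x) <= x by rewrite ge_min lexx.
  have h2 : Num.min x (l - x) <= l - x by rewrite ge_min lexx orbT.
  by move: h h1 h2 m0; move: (n.+1%:R^-1) (Num.min _ _) => e m h h1 h2 m0; split; lra.
have cv := moll_cvg (iI n) (Lx n).
have wx : (w \_ (I n)) x = w x by rewrite patchE ifT// inE /I /= in_itv/= !ltW.
rewrite -wx; apply: (@cvg_unique _ (@Rhausdorff R) _ _ _ _ cv).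
have d0 : 0 < l - n.+1%:R^-1 - x by rewrite subr_gt0.
apply: cvg_near_cst; near=> m.
have tm : test_function l (moll m x).
  apply: (@test_moll n.+1%:R^-1 (l - n.+1%:R^-1)) => //.
  - by rewrite gtrBl.
  - exact: ltW.
  - rewrite -lerBrDl; near: m; exact: near_harmonic.
rewrite -[RHS](w0 _ tm) [RHS]Rintegral_mkcond; apply: eq_Rintegral => z _.
rewrite !patchE; case: ifPn => zI; first by rewrite ifT// inE; exact/(IO n)/set_mem.
rewrite mul0r; case: ifPn => // _.
rewrite moll_out ?mulr0//.
have [zx|xz] := ltP z x; [by left|right].
rewrite ltNge; apply/negP => zx; move/negP: zI; apply.
rewrite inE /I /= in_itv/= (le_trans _ xz) ?(ltW nx)//= (le_trans zx)//.
rewrite -lerBrDl; near: m; exact: near_harmonic.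
Unshelve. all: by end_near. Qed.

Lemma weak_derive_unique k v g h : is_weak_derive l k v g -> is_weak_derive l k v h ->
  {ae leb, forall x, Omega x -> g x = h x}.
Proof.
move=> [lv lg vg] [_ lh vh].
have := @weak0_ae (fun x => g x - h x).
have lgh : locally_integrable Omega (fun x => g x - h x) by exact: locally_integrableB.
move=> /(_ lgh) H; have {}H := H _.
have : {ae leb, forall x, Omega x -> g x - h x = 0}.
  apply: H => phi tphi.
  under eq_Rintegral do rewrite mulrBl.
  rewrite RintB//; [|exact: test_integrable|exact: test_integrable].
  have : (-1) ^+ k != 0 :> R by rewrite expf_neq0// oppr_eq0.
  move=> /mulfI inj; apply/eqP; rewrite subr_eq0; apply/eqP/inj.
  by rewrite -vg// -vh.
by apply: ae_imp => x gh /gh /eqP; rewrite subr_eq0 => /eqP.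
Qed.

(** The difference of two smoothed steps at x and y is a test function close to the
    indicator of ]x, y], and its derivative is a difference of mollifiers: the
    definition of weak derivatives turns into the fundamental theorem of calculus
    in the limit. *)
Lemma du_Bois_Reymond h g : is_weak_derive l 1 h g ->
  leb.-integrable Omega (EFin \o h) -> leb.-integrable Omega (EFin \o g) ->
  {ae leb, forall x, lebesgue_pt (h \_ Omega) x} /\
  forall x y, 0 < x -> x < y -> y < l ->
    lebesgue_pt (h \_ Omega) x -> lebesgue_pt (h \_ Omega) y ->
    h y - h x = \int[leb]_(z in `]x, y]) g z.
Proof.
move=> [_ _ hg] ih ig.
have mO : measurable Omega by exact: measurable_itv.
have iH : leb.-integrable setT (EFin \o (h \_ Omega)).
  by apply: (proj1 (itg_restrict h measurableT mO)); rewrite setTI.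
split.
  by apply: lebesgue_differentiation; exact: open_integrable_locally openT iH.
move=> x y x0 xy yl Lx Ly.
have xO : (h \_ Omega) x = h x by rewrite patchE ifT// inE /= in_itv/= x0 (lt_trans xy).
have yO : (h \_ Omega) y = h y by rewrite patchE ifT// inE /= in_itv/= yl (lt_trans x0).
have cvL : (\int[leb]_z ((h \_ Omega) z * moll n x z) -
    \int[leb]_z ((h \_ Omega) z * moll n y z)) @[n --> \oo] -->
    (h \_ Omega) x - (h \_ Omega) y.
  by apply: cvgB; apply: moll_cvg.
pose phi n z := bigstep n x z - bigstep n y z.
have [C C0 dC] := @dstep_bound R.
have imoll n u : leb.-integrable setT (EFin \o (fun z => (h \_ Omega) z * moll n u z)).
  apply: (@integrable_mulb _ _ _ _ (n.+1%:R * C)) => //.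
    by apply: continuous_measurable; apply: smooth_continuous; exact: (smooth_moll 1).
  by move=> z _; rewrite /moll normrM ger0_norm// ler_wpM2l.
have phim n z : is_derive z 1 (phi n) (moll n x z - moll n y z).
  by apply: is_deriveB; exact: is_derive_bigstep.
have sphi k n : smooth k (phi n).
  apply: smoothD; first exact: smooth_bigstep.
  by apply: smoothN; exact: smooth_bigstep.
have mphi n D : measurable_fun D (phi n).
  by apply: continuous_measurable; apply: smooth_continuous; exact: (sphi 1%N).
have phi1 n z : `|phi n z| <= 1.
  have /andP[a b] := step01 (n.+1%:R * (z - x)).
  have /andP[c d] := step01 (n.+1%:R * (z - y)).
  by rewrite /phi /bigstep ler_norml; apply/andP; split; lra.
(* phi n is bounded by 1 and converges pointwise to the indicator of ]x, y]. *)
have cvR : \int[leb]_(z in Omega) (g z * phi n z) @[n --> \oo] -->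
    \int[leb]_(z in `]x, y]) g z.
  have -> : \int[leb]_(z in `]x, y]) g z = \int[leb]_(z in Omega) (g \_ `]x, y]) z.
    rewrite -Rintegral_mkcondr; congr Rintegral; rewrite setIidr//.
    move=> z /=; rewrite !in_itv/= => /andP[a b].
    by rewrite (lt_trans x0 a) (le_lt_trans b yl).
  apply: (@dominated_Rcvg _ _ _ _ (fun z => `|g z|)) => //.
  - move=> n; apply: measurable_funM => //.
    by have := measurable_int leb ig => /measurable_EFinP.
  - exact: itg_norm.
  - by move=> n z _; rewrite normrM ler_piMr.
  - move=> z _; apply: cvg_near_cst; rewrite patchE.
    have big (u : R) : u < z -> \forall n \near \oo, 1 <= n.+1%:R * (z - u).
      move=> uz; have : 0 < z - u by rewrite subr_gt0.
      move/near_harmonic; apply: filterS => j jz.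
      by rewrite -ler_pdivrMl// mulr1.
    have low (n : nat) (u : R) : z <= u -> n.+1%:R * (z - u) <= 0.
      by move=> zu; rewrite pmulr_rle0// subr_le0.
    rewrite /phi /bigstep; case: ifPn.
      rewrite inE /= in_itv/= => /andP[xz zy]; near=> n.
      rewrite step1 ?step0 ?subr0 ?mulr1//; first exact: low.
      by near: n; exact: big.
    rewrite notin_setE /= in_itv/= => /negP; rewrite negb_and -leNgt -ltNge => /orP[zx|yz].
      near=> n; rewrite !step0 ?subr0 ?mulr0//; last exact: low.
      by apply: low; rewrite (le_trans zx)// ltW.
    near=> n; rewrite !step1 ?subrr ?mulr0//; near: n; apply: big => //.
    exact: lt_trans yz.
  - have mg : measurable_fun Omega g.
      by have := measurable_int leb ig => /measurable_EFinP.
    exact: measurable_funS_restrict.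
(* For these n the support of phi n stays inside ]0, l[. *)
have e : forall n, y + n.+1%:R^-1 < l ->
    \int[leb]_z ((h \_ Omega) z * moll n x z) - \int[leb]_z ((h \_ Omega) z * moll n y z)
    = - \int[leb]_(z in Omega) (g z * phi n z).
  move=> n nl; rewrite -RintB//.
  have tphi : test_function l (phi n).
    apply: (@test_fun _ _ _ x (y + n.+1%:R^-1)) => // z h'.
    case: h' => h'; rewrite /phi /bigstep.
      by rewrite !step0 ?subr0// pmulr_rle0// subr_le0 ltW// (lt_trans h').
    have nn : 0 < n.+1%:R^-1 :> R by rewrite invr_gt0.
    have zy : n.+1%:R^-1 <= z - y by rewrite lerBrDl ltW.
    have zx : n.+1%:R^-1 <= z - x by apply: le_trans zy _; rewrite lerD2l lerN2 ltW.
    by rewrite !step1 ?subrr// -ler_pdivrMl// mulr1.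
  have := hg _ tphi; rewrite expr1 mulN1r => <-.
  rewrite [RHS]Rintegral_mkcond; apply: eq_Rintegral => z _.
  rewrite !patchE; case: ifPn => _; last by rewrite !mul0r subrr.
  rewrite -mulrBr derive1n1 derive1E; congr (_ * _).
  by have [_ ->] := phim n z.
have : h x - h y = - \int[leb]_(z in `]x, y]) g z.
  have cvL' : (- \int[leb]_(z in Omega) (g z * phi n z)) @[n --> \oo] --> h x - h y.
    rewrite -xO -yO; apply: cvg_trans cvL; apply: near_eq_cvg; near=> n.
    rewrite /= -e//; near: n.
    have yl2 : 0 < (l - y) / 2 by lra.
    have := near_harmonic yl2; apply: filterS => n nl; rewrite -ltrBrDl (le_lt_trans nl)//. lra.
  apply: (@cvg_unique _ (@Rhausdorff R) _ _ _ _ cvL').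
  exact: cvgN cvR.
by move=> /(congr1 -%R); rewrite opprK opprB.
Unshelve. all: by end_near. Qed.

End DuBoisReymond.

(** * Square-integrable functions on an interval *)

Section SquareIntegrable.
Context {R : realType}.
Local Notation leb := (@lebesgue_measure R).
Variable l : R.
Hypothesis l_gt0 : 0 < l.
Implicit Types (v w f g h phi : R -> R) (x y z a b : R) (D : set R) (k m n : nat).
Local Notation Omega := `]0, l[%classic.

Local Notation one := (cst 1 : R -> R).

Let mO : measurable (Omega : set R). Proof. exact: measurable_itv. Qed.

Lemma inL2_measurable g : inL2 l g -> measurable_fun setT (g \_ Omega).
Proof. by rewrite /inL2 inE => /andP[+ _]; rewrite inE. Qed.

Lemma inL2_lty g : inL2 l g -> ('N[leb]_2%:E[EFin \o (g \_ Omega)] < +oo)%E.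
Proof. by rewrite /inL2 inE => /andP[_]; rewrite inE. Qed.

Lemma inL2_cst1 : inL2 l one.
Proof.
rewrite /inL2 inE; apply/andP; split; rewrite inE /=.
  exact: (@measurable_funS_restrict _ Omega setT).
rewrite /finite_norm unlock /=; apply: poweR_lty.
have -> : (\int[leb]_x (`|(EFin \o (one \_ Omega)) x| `^ 2%R) =
    \int[leb]_(x in Omega) (one x)%:E)%E.
  rewrite [RHS]integral_mkcond; apply: eq_integral => x _.
  rewrite /= !patchE; case: ifPn => _ /=; first by rewrite normr1 powR1.
  by rewrite normr0 powR0.
rewrite EFin_Rint ?ltry//; apply: (@integrable_bdd _ _ _ 1) => //.
  by rewrite [X in (X < _)%E]lebesgue_measure_itv/= lte_fin l_gt0 -EFinB ltry.
by move=> x _; rewrite normr1.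
Qed.

(** Hoelder's inequality against the constant function 1. *)
Lemma inL2_hoelder g : inL2 l g ->
  leb.-integrable Omega (EFin \o g) /\
  \int[leb]_(x in Omega) `|g x| <= L2norm l one * L2norm l g.
Proof.
move=> g2; have o2 := inL2_cst1.
have H : (\int[leb]_(x in Omega) `|(g x)%:E| <=
   'N[leb]_2%:E[EFin \o (one \_ Omega)] * 'N[leb]_2%:E[EFin \o (g \_ Omega)])%E.
  have h := @hoelder _ _ _ leb _ _ 2 2 (inL2_measurable o2) (inL2_measurable g2).
  have : 2^-1 + 2^-1 = 1 :> R by lra.
  move/(h (ltr0Sn _ _) (ltr0Sn _ _)); apply: le_trans.
  rewrite Lnorm1 [leLHS]integral_mkcond le_eqVlt; apply/orP; left; apply/eqP.
  apply: eq_integral => x _; rewrite /= !patchE; case: ifPn => _ /=.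
    by rewrite mul1r.
  by rewrite mul0r normr0.
have n1 := inL2_lty o2; have n2 := inL2_lty g2.
have f1 : ('N[leb]_2%:E[EFin \o (one \_ Omega)])%E \is a fin_num.
  by rewrite ge0_fin_numE ?Lnorm_ge0.
have f2 : ('N[leb]_2%:E[EFin \o (g \_ Omega)])%E \is a fin_num.
  by rewrite ge0_fin_numE ?Lnorm_ge0.
have ig : leb.-integrable Omega (EFin \o g).
  apply/integrableP; split.
    apply/measurable_EFinP.
    exact: (proj2 (measurable_restrictT _ mO) (inL2_measurable g2)).
  by apply: le_lt_trans H _; rewrite -ge0_fin_numE ?fin_numM// mule_ge0 ?Lnorm_ge0.
split => //.
rewrite /L2norm -fineM// /Rintegral; apply: fine_le => //.
- exact: (@integrable_fin_num _ _ _ leb _ mO _ (itg_norm ig)).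
- by rewrite fin_numM.
Qed.

(** Needed because weak derivatives are determined only up to null sets. *)
Lemma L2norm_ae g h : measurable_fun Omega g -> measurable_fun Omega h ->
  {ae leb, forall x, Omega x -> g x = h x} ->
  ('N[leb]_2%:E[EFin \o (g \_ Omega)] = 'N[leb]_2%:E[EFin \o (h \_ Omega)])%E.
Proof.
move=> mg mh gh; rewrite unlock /=.
pose F f x := (`|(EFin \o (f \_ Omega)) x| `^ 2%R)%E.
have mF f : measurable_fun Omega f -> measurable_fun setT (F f).
  move=> mf; apply/measurable_EFinP.
  apply: (@measurableT_comp _ _ _ _ _ _ (fun x : R => x `^ 2)) => //.
  by apply: measurableT_comp => //; exact: (proj1 (measurable_restrictT _ mO) mf).
have aeF : {ae leb, forall x, setT x -> F g x = F h x}.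
  have impl x : (Omega x -> g x = h x) -> setT x -> F g x = F h x.
    by move=> ghx _; rewrite /F /= !patchE; case: ifPn => // /set_mem xO; rewrite ghx.
  exact: ae_imp impl gh.
have -> // : (\int[leb]_x (F g) x = \int[leb]_x (F h) x)%E.
by apply: ae_eq_integral => //; exact: mF.
Qed.

Lemma inL2_ae g h : measurable_fun Omega h ->
  {ae leb, forall x, Omega x -> g x = h x} -> inL2 l g -> inL2 l h.
Proof.
move=> mh gh g2; have mg := inL2_measurable g2.
rewrite /inL2 inE; apply/andP; split; rewrite inE /=.
  exact: (proj1 (measurable_restrictT _ mO) mh).
rewrite /finite_norm -(L2norm_ae _ mh gh); first exact: inL2_lty.
exact: (proj2 (measurable_restrictT _ mO) mg).
Qed.

Lemma inL2_lin a g b h : inL2 l g -> inL2 l h -> inL2 l (fun x => a * g x + b * h x).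
Proof.
move=> g2 h2.
have l12 : (1 <= 2%:E :> \bar R)%E by rewrite lee_fin ler1n.
have [_ Z] := @Lfun_submod_closed _ _ R leb 2%:E l12.
have [z0 _] := @Lfun_submod_closed _ _ R leb 2%:E l12.
have := Z a _ _ g2 (Z b _ _ h2 z0).
rewrite /inL2; set F := (X in X \in _ -> _).
suff -> : F = (fun x => a * g x + b * h x) \_ Omega by [].
apply/funext => x; rewrite /F patchE.
rewrite [LHS](_ : _ = a * (g \_ Omega) x + (b * (h \_ Omega) x + 0))//.
by rewrite !patchE; case: ifPn => _; rewrite ?mulr0 ?addr0.
Qed.

End SquareIntegrable.

(** * Absolutely continuous representatives of Sobolev functions *)

Section Sobolev.
Context {R : realType}.
Local Notation leb := (@lebesgue_measure R).
Variable l : R.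
Hypothesis l_gt0 : 0 < l.
Implicit Types (v w f g h phi : R -> R) (x y z a b : R) (D : set R) (k m n : nat).
Local Notation Omega := `]0, l[%classic.

Let mO : measurable (Omega : set R). Proof. exact: measurable_itv. Qed.

Lemma subO x y : 0 <= x -> y <= l -> `]x, y[ `<=` Omega.
Proof.
move=> x0 yl z /=; rewrite !in_itv/= => /andP[xz zy].
by rewrite (le_lt_trans x0 xz) (lt_le_trans zy yl).
Qed.

Lemma ae_point (P : R -> Prop) a b : a < b -> {ae leb, forall x, P x} ->
  exists2 x, a < x < b & P x.
Proof.
move=> ab aeP; apply: contrapT => noP.
have : leb.-negligible `]a, b[.
  apply: negligibleS aeP => x /=; rewrite in_itv/= => xab Px.
  by apply: noP; exists x.
move/negligibleP => /(_ (measurable_itv _)).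
rewrite [X in X = _ -> _](lebesgue_measure_itv `]a, b[)/= lte_fin ab -EFinB => /eqP.
by rewrite eqe subr_eq0 (gt_eqF ab).
Qed.

Lemma Rint_ae g h x y : 0 <= x -> y <= l ->
  leb.-integrable Omega (EFin \o g) -> leb.-integrable Omega (EFin \o h) ->
  {ae leb, forall x, Omega x -> g x = h x} ->
  \int[leb]_(z in `]x, y[) g z = \int[leb]_(z in `]x, y[) h z.
Proof.
move=> x0 yl ig ih gh; congr fine.
have mi : measurable (`]x, y[ : set R) by exact: measurable_itv.
have ig' := itgS mO mi (subO x0 yl) ig; have ih' := itgS mO mi (subO x0 yl) ih.
apply: ae_eq_integral => //; [exact: (measurable_int leb ig')|exact: (measurable_int leb ih')|].
have impl z : (Omega z -> g z = h z) -> `]x, y[%classic z -> (EFin \o g) z = (EFin \o h) z.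
  by move=> gz xyz /=; rewrite gz//; exact: (subO x0 yl).
exact: ae_imp impl gh.
Qed.

Lemma Rint_restrict f x y : 0 <= x -> y <= l -> leb.-integrable Omega (EFin \o f) ->
  \int[leb]_(z in `[x, y]) (f \_ Omega) z = \int[leb]_(z in `]x, y[) f z.
Proof.
move=> x0 yl fi.
have iR : leb.-integrable setT (EFin \o (f \_ Omega)).
  by apply: (proj1 (itg_restrict f measurableT mO)); rewrite setTI.
have iI (i : interval R) : leb.-integrable [set` i] (EFin \o (f \_ Omega)).
  by apply: (itgS measurableT _ _ iR) => //; exact: measurable_itv.
rewrite -Rintegral_itv_obnd_cbnd// -Rintegral_itv_bndo_bndc//.
apply: eq_Rintegral => z; rewrite inE => xyz.
by rewrite patchE ifT// inE; exact: (subO x0 yl).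
Qed.

Lemma Rint_cat f x y z : 0 <= x -> x <= y -> y <= z -> z <= l ->
  leb.-integrable Omega (EFin \o f) ->
  \int[leb]_(s in `]x, z[) f s = \int[leb]_(s in `]x, y[) f s + \int[leb]_(s in `]y, z[) f s.
Proof.
move=> x0 xy yz zl fi.
have iR : leb.-integrable setT (EFin \o (f \_ Omega)).
  by apply: (proj1 (itg_restrict f measurableT mO)); rewrite setTI.
have iI (i : interval R) : leb.-integrable [set` i] (EFin \o (f \_ Omega)).
  by apply: (itgS measurableT _ _ iR) => //; exact: measurable_itv.
rewrite -!Rint_restrict//; [|exact: le_trans xy|exact: le_trans zl].
apply/eqP; rewrite -subr_eq0 opprD addrA subr_eq0; apply/eqP.
by rewrite Rintegral_itvB// ?bnd_simp// Rintegral_itv_obnd_cbnd.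
Qed.

Lemma Rint_le_abs f x y : 0 <= x -> y <= l -> leb.-integrable Omega (EFin \o f) ->
  `|\int[leb]_(s in `]x, y[) f s| <= \int[leb]_(s in `]x, y[) `|f s|.
Proof.
move=> x0 yl fi; apply: le_normr_Rint; first exact: measurable_itv.
by apply: (itgS mO _ _ fi); [exact: measurable_itv|exact: subO].
Qed.

Lemma Rint_sub_le f x y : (forall z, 0 <= f z) -> 0 <= x -> x <= y -> y <= l ->
  leb.-integrable Omega (EFin \o f) ->
  \int[leb]_(s in `]x, y[) f s <= \int[leb]_(s in Omega) f s.
Proof.
move=> f0 x0 xy yl fi.
rewrite (@Rint_cat f 0 x l)//; last exact: le_trans yl.
rewrite (@Rint_cat f x y l)//.
rewrite [leRHS]addrCA lerDl addr_ge0//; exact: Rintegral_ge0.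
Qed.

(** The chosen weak derivative may differ from the square-integrable one given by
    the hypothesis, but only on a null set. *)
Lemma weak_derive_spec m k v : inH l m v -> (k <= m)%N ->
  is_weak_derive l k v (weak_derive l k v) /\ inL2 l (weak_derive l k v).
Proof.
move=> Hv km; have [g vg g2] := Hv k km.
have wd : is_weak_derive l k v (weak_derive l k v).
  by apply: (@xgetPex _ (cst 0) [set g | is_weak_derive l k v g]); exists g.
split=> //; apply: (inL2_ae _ _ g2); first by case: wd => _ [].
exact: weak_derive_unique vg wd.
Qed.

Lemma is_weak_derive_ae k v g h : is_weak_derive l k v g -> inL2 l g ->
  measurable_fun Omega h -> {ae leb, forall x, Omega x -> g x = h x} ->
  is_weak_derive l k v h /\ inL2 l h.
Proof.
move=> [lv lg vg] g2 mh gh; have h2 := inL2_ae mh gh g2.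
have [ih _] := inL2_hoelder l_gt0 h2.
have lh : locally_integrable Omega h by exact: open_integrable_locally.
split => //; split => //.
move=> phi tphi; rewrite vg//; congr (_ * _).
apply: Rint_ae => //; [exact: test_integrable|exact: test_integrable|].
have impl z : (Omega z -> g z = h z) -> Omega z -> g z * phi z = h z * phi z.
  by move=> gz Oz; rewrite gz.
exact: ae_imp impl gh.
Qed.

Lemma primitive_continuous f : leb.-integrable Omega (EFin \o f) ->
  {within `[0, l], continuous (fun x => \int[leb]_(z in `]0, x[) f z)}.
Proof.
move=> fi.
have iR : leb.-integrable setT (EFin \o (f \_ Omega)).
  by apply: (proj1 (itg_restrict f measurableT mO)); rewrite setTI.
have icc : leb.-integrable `[0, l] (EFin \o (f \_ Omega)).
  by apply: (itgS measurableT _ _ iR) => //; exact: measurable_itv.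
have := parameterized_integral_continuous (ltW l_gt0) icc.
apply: subspace_eq_continuous => x; rewrite inE /= in_itv/= => /andP[x0 xl].
by rewrite /from_subspace/= /parameterized_integral Rint_restrict.
Qed.

(** G k is a weak derivative of order k of v, and below the top order it is a
    primitive of the next one.  This is the only form in which Sobolev regularity
    is used from here on. *)
Definition sobrep m v (G : nat -> R -> R) : Prop :=
  (forall k, (k <= m)%N -> is_weak_derive l k v (G k) /\ inL2 l (G k)) /\
  (forall k, (k < m)%N -> forall x y, 0 <= x -> x <= y -> y <= l ->
     G k y - G k x = \int[leb]_(z in `]x, y[) G k.+1 z).

Lemma sobrep_integrable m v G k : sobrep m v G -> (k <= m)%N ->
  leb.-integrable Omega (EFin \o G k).
Proof. by move=> [h _] km; have [_ g2] := h k km; have [] := inL2_hoelder l_gt0 g2. Qed.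

(** By the du Bois-Reymond lemma each weak derivative below the top order agrees
    almost everywhere with a constant plus a primitive of the next one; these
    primitives are the representatives. *)
Lemma sobrep_exists m v : inH l m v -> exists G, sobrep m v G.
Proof.
move=> Hv; pose g k := weak_derive l k v.
have wd k (km : (k <= m)%N) := weak_derive_spec Hv km.
have ig k : (k <= m)%N -> leb.-integrable Omega (EFin \o g k).
  by move=> km; have [_ g2] := wd k km; have [] := inL2_hoelder l_gt0 g2.
pose P k x := \int[leb]_(z in `]0, x[) g k z.
have Pcat k x y : (k <= m)%N -> 0 <= x -> x <= y -> y <= l ->
    P k y - P k x = \int[leb]_(z in `]x, y[) g k z.
  by move=> km x0 xy yl; rewrite /P (@Rint_cat _ 0 x y)//; [rewrite addrC addKr|exact: ig].
have ex k : exists c, (k < m)%N -> {ae leb, forall x, Omega x -> g k x = c + P k.+1 x}.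
  have [km|] := boolP (k < m)%N; last by exists 0.
  have [wk _] := wd k (ltnW km); have [wk1 _] := wd k.+1 km.
  have [aeL dB] := du_Bois_Reymond (is_weak_derive_next wk wk1) (ig _ (ltnW km)) (ig _ km).
  (* The constant is read off at any Lebesgue point x0. *)
  have [x0 /andP[x00 x0l] Lx0] := ae_point l_gt0 aeL.
  have ig1 := ig _ km.
  have oc x y : 0 <= x -> y < l ->
      \int[leb]_(z in `]x, y]) g k.+1 z = \int[leb]_(z in `]x, y[) g k.+1 z.
    move=> x1 yl; rewrite Rintegral_itv_bndo_bndc//.
    by apply: (itgS mO _ _ ig1); [exact: measurable_itv|apply: subO => //; exact: ltW].
  exists (g k x0 - P k.+1 x0) => _.
  have impl x : lebesgue_pt (g k \_ Omega) x -> Omega x -> g k x = g k x0 - P k.+1 x0 + P k.+1 x.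
    move=> Lx; rewrite /= in_itv/= => /andP[x1 xl].
    have [xx0|xx0|->] := ltgtP x x0; last by rewrite subrK.
      have : g k x0 - g k x = _ := dB _ _ x1 xx0 x0l Lx Lx0; rewrite oc ?(ltW x1)//.
      by rewrite -Pcat ?(ltW x1) ?(ltW xx0) ?(ltW x0l)//; move: (g k x) (g k x0) (P k.+1 x) (P k.+1 x0) => a1 a2 a3 a4 h; lra.
    have : g k x - g k x0 = _ := dB _ _ x00 xx0 xl Lx0 Lx; rewrite oc ?(ltW x00)//.
    by rewrite -Pcat ?(ltW x00) ?(ltW xx0) ?(ltW xl)//; move: (g k x) (g k x0) (P k.+1 x) (P k.+1 x0) => a1 a2 a3 a4 h; lra.
  exact: ae_imp impl aeL.
have [c cP] := choice ex.
pose G k := if (k < m)%N then fun x => c k + P k.+1 x else g k.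
have mG k : (k <= m)%N -> measurable_fun Omega (G k).
  move=> km; rewrite /G; case: ifP => [km'|_]; last first.
    by have := measurable_int leb (ig k km) => /measurable_EFinP.
  apply: measurable_funD => //.
  apply: (@measurable_funS _ _ _ _ `[0, l]) => //; first exact: subset_itv_oo_cc.
  apply: subspace_continuous_measurable_fun; first exact: measurable_itv.
  exact: primitive_continuous (ig _ km').
have aeG k : (k <= m)%N -> {ae leb, forall x, Omega x -> g k x = G k x}.
  move=> km; rewrite /G; case: ifP => [km'|_]; first exact: cP.
  by apply: aeW.
have wG k : (k <= m)%N -> is_weak_derive l k v (G k) /\ inL2 l (G k).
  by move=> km; have [w w2] := wd k km; apply: is_weak_derive_ae w w2 (mG k km) (aeG k km).
exists G; split=> // k km x y x0 xy yl.
have -> : \int[leb]_(z in `]x, y[) G k.+1 z = \int[leb]_(z in `]x, y[) g k.+1 z.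
  apply/esym/Rint_ae => //; [exact: ig| |exact: aeG].
  by have [_ G2] := wG k.+1 km; have [] := inL2_hoelder l_gt0 G2.
by rewrite -Pcat// /G km opprD addrACA subrr add0r.
Qed.

End Sobolev.

(** * The Sobolev inequality in dimension one *)

Section SobolevBounds.
Context {R : realType}.
Local Notation leb := (@lebesgue_measure R).
Variable l : R.
Hypothesis l_gt0 : 0 < l.
Implicit Types (v w f g h phi : R -> R) (x y z a b : R) (D : set R) (k m n : nat).
Implicit Types (G H : nat -> R -> R).
Local Notation Omega := `]0, l[%classic.

Let mO : measurable (Omega : set R). Proof. exact: measurable_itv. Qed.

Lemma sobrepW m' m v G : (m' <= m)%N -> sobrep l m v G -> sobrep l m' v G.
Proof.
move=> mm [wG iG]; split=> k km; first exact/wG/(leq_trans km mm).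
exact/iG/(leq_trans km mm).
Qed.

Lemma sobrep_lin m a v G b w H : sobrep l m v G -> sobrep l m w H ->
  sobrep l m (fun x => a * v x + b * w x) (fun k x => a * G k x + b * H k x).
Proof.
move=> sG sH; split=> k km.
  have [vG G2] := proj1 sG k km; have [wH H2] := proj1 sH k km.
  split; last exact: inL2_lin.
  by apply: is_weak_deriveD; apply: is_weak_deriveZ.
move=> x y x0 xy yl.
have iG := sobrep_integrable l_gt0 sG km; have iH := sobrep_integrable l_gt0 sH km.
have mi : measurable (`]x, y[ : set R) by exact: measurable_itv.
have iG' := itgS mO mi (subO x0 yl) iG; have iH' := itgS mO mi (subO x0 yl) iH.
rewrite RintD//; [|exact: itgZl|exact: itgZl].
rewrite !RintZl// -(proj2 sG k km _ _ x0 xy yl) -(proj2 sH k km _ _ x0 xy yl).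
by ring.
Qed.

Lemma sobrep_inH m v G : sobrep l m v G -> inH l m v.
Proof. by move=> [wG _] k km; have [a b] := wG k km; exists (G k). Qed.

Lemma sobrep_continuous m v G k : sobrep l m v G -> (k < m)%N ->
  {within `[0, l], continuous (G k)}.
Proof.
move=> sG km.
have iG := sobrep_integrable l_gt0 sG km.
have cP := primitive_continuous l_gt0 iG.
have cP' : {within `[0, l], continuous (fun x => G k 0 + \int[leb]_(z in `]0, x[) G k.+1 z)}.
  move=> x; apply: cvgD; [exact: cvg_cst|exact: cP].
move: cP'; apply: subspace_eq_continuous => x; rewrite inE /= in_itv/= => /andP[x0 xl].
by rewrite /from_subspace /= -(proj2 sG k km 0 x)// addrC subrK.
Qed.

Lemma sobrep_is_derive m v G k x : sobrep l m v G -> (k.+1 < m)%N -> 0 < x < l ->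
  is_derive x 1 (G k) (G k.+1 x).
Proof.
move=> sG km /andP[x0 xl].
have iG := sobrep_integrable l_gt0 sG (ltnW km).
have iR : leb.-integrable setT (EFin \o (G k.+1 \_ Omega)).
  by apply: (proj1 (itg_restrict _ measurableT mO)); rewrite setTI.
have cG : {for x, continuous (G k.+1 \_ Omega)}.
  have cw := sobrep_continuous sG km.
  have xO : x \in `]0, l[%classic by rewrite inE /= in_itv/= x0 xl.
  have nO : nbhs x (Omega : set R).
    by apply: open_nbhs_nbhs; split; [exact: interval_open|exact: set_mem xO].
  have : {within Omega, continuous (G k.+1)}.
    by apply: continuous_subspaceW cw; exact: subset_itv_oo_cc.
  rewrite continuous_open_subspace; last exact: interval_open.
  move=> /(_ x xO) cx.
  suff : (G k.+1 \_ Omega) y @[y --> x] --> G k.+1 x.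
    by have -> : G k.+1 x = (G k.+1 \_ Omega) x by rewrite patchE xO.
  apply: cvg_trans cx; apply: near_eq_cvg; near=> y.
  rewrite patchE ifT// inE; near: y; exact: nO.
have icc : leb.-integrable `[0, l] (EFin \o (G k.+1 \_ Omega)).
  by apply: (itgS measurableT _ _ iR) => //; exact: measurable_itv.
have [dF F'] := continuous_FTC1_closed xl icc x0 cG.
have := derivableP dF; rewrite -derive1E F' patchE ifT; last by rewrite inE /= in_itv/= x0 xl.
move=> dF'.
apply: (@near_eq_is_derive _ _ _
  (fun y => G k 0 + \int[leb]_(t in `[0, y]) (G k.+1 \_ Omega) t)).
  near=> y; have y0 : 0 < y by near: y; exact: lt_nbhsr.
  have yl : y < l by near: y; exact: lt_nbhsl.
  rewrite (Rint_restrict (lexx 0) (ltW yl) iG) -(proj2 sG k (ltnW km) 0 y (lexx 0) (ltW y0) (ltW yl)).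
  by rewrite addrC subrK.
have := is_deriveD (is_derive_cst (G k 0) x 1) dF'.
by rewrite add0r.
Unshelve. all: by end_near. Qed.

(** A nonempty interval around x contains a point where f and g agree. *)
Lemma continuous_ae_eq f g : {within `[0, l], continuous f} -> {within `[0, l], continuous g} ->
  {ae leb, forall x, Omega x -> f x = g x} -> forall x, 0 <= x <= l -> f x = g x.
Proof.
move=> cf cg fg x /andP[x0 xl]; apply/eqP; rewrite -subr_eq0; apply/negPn/negP => d0.
have cd : {within `[0, l], continuous (fun x => f x - g x)}.
  by move=> y; apply: cvgB; [exact: cf|exact: cg].
have xI : `[0, l]%classic x by rewrite /= in_itv/= x0 xl.
have : \forall y \near x, `[0, l]%classic y -> f y - g y != 0.
  have := cd x; rewrite /continuous_at /prop_for /= => h.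
  have H : @nbhs_subspace _ `[0, l] x [set y | f y - g y != 0] := @cvgr_neq0 _ _ _ _ _ _ _ h d0.
  by have := nbhs_subspace_in xI => e; rewrite -e in H; exact: H.
move=> -[e /= e0 eP].
have [y /andP[y1 y2] yP] : exists2 y, Num.max 0 (x - e) < y < Num.min l (x + e) & (Omega y -> f y = g y).
  apply: ae_point fg; rewrite lt_min !gt_max l_gt0.
  apply/andP; split; apply/andP; split; lra.
move: y1 y2; rewrite lt_min gt_max => /andP[y0 ye] /andP[yl ye'].
have := eP y; rewrite /= in_itv/= !ltW//= ltr_distlC.
rewrite yP ?subrr ?eqxx; last by rewrite /= in_itv/= y0 yl.
move=> h; have : false by apply: h => //; apply/andP; split; lra.
by [].
Qed.

(** Ties the values of v at the grid points, for the continuous v of the hypotheses,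
    to the representatives. *)
Lemma sobrep0 m v G : {within `[0, l], continuous v} -> sobrep l m.+1 v G ->
  forall x, 0 <= x <= l -> G 0%N x = v x.
Proof.
move=> cv sG; apply: continuous_ae_eq => //; first exact: sobrep_continuous sG _.
have [w0 _] := proj1 sG 0%N isT.
apply: (weak_derive_unique w0); have [lv _ _] := w0; split=> //.
by move=> phi _; rewrite expr0 mul1r derive1n0.
Qed.

Lemma L2norm_ge0 g : 0 <= L2norm l g.
Proof. by rewrite /L2norm fine_ge0// Lnorm_ge0. Qed.

Lemma Hnorm_ge0 m v : 0 <= Hnorm l m v.
Proof. exact: sqrtr_ge0. Qed.

Lemma L2norm_le_Hnorm m v k : (k <= m)%N -> L2norm l (weak_derive l k v) <= Hnorm l m v.
Proof.
move=> km; rewrite /Hnorm -(ger0_norm (L2norm_ge0 _)) -sqrtr_sqr.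
apply: ler_wsqrtr; rewrite (bigD1_seq k) ?iota_uniq ?mem_index_iota//=.
by rewrite lerDl; apply: sumr_ge0 => i _; exact: sqr_ge0.
Qed.

Lemma sobrep_L2norm m v G k : sobrep l m v G -> (k <= m)%N ->
  L2norm l (G k) <= Hnorm l m v.
Proof.
move=> sG km; apply: le_trans (L2norm_le_Hnorm v km).
have [wG G2] := proj1 sG k km.
have [wd d2] := weak_derive_spec (sobrep_inH sG) km.
rewrite /L2norm (@L2norm_ae _ _ _ (weak_derive l k v))//; first by case: wG => _ [].
  by case: wd => _ [].
exact: weak_derive_unique wG wd.
Qed.

(** |G k x| differs from |G k y| by at most the integral of |G k.+1|; average over y
    and apply [inL2_hoelder] to both integrals. *)
Lemma sobrep_bound : exists2 C, 0 < C & forall m v G, sobrep l m v G ->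
  (forall k x, (k < m)%N -> 0 <= x <= l -> `|G k x| <= C * Hnorm l m v) /\
  \int[leb]_(x in Omega) `|G m x| <= C * Hnorm l m v.
Proof.
pose K := L2norm l (cst 1 : R -> R).
have K0 : 0 <= K by exact: L2norm_ge0.
exists (1 + K + K / l).
  by rewrite -addrA ltr_pwDl// addr_ge0// divr_ge0// ltW.
move=> m v G sG.
have int k : (k <= m)%N -> \int[leb]_(x in Omega) `|G k x| <= K * Hnorm l m v.
  move=> km; have [_ G2] := proj1 sG k km; have [_ h] := inL2_hoelder l_gt0 G2.
  by apply: le_trans h _; apply: ler_wpM2l => //; exact: (sobrep_L2norm sG).
have HG := Hnorm_ge0 m v.
have Kl : 0 <= K / l by rewrite divr_ge0// ltW.
split=> [k x km|]; last first.
  by apply: le_trans (int m (leqnn m)) _; rewrite ler_wpM2r//; lra.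
move=> /andP[x0 xl].
have iG := sobrep_integrable l_gt0 sG (ltnW km).
have iG1 := sobrep_integrable l_gt0 sG km.
pose J := \int[leb]_(x in Omega) `|G k.+1 x|.
have osc y : Omega y -> `|G k x| <= `|G k y| + J.
  move=> /=; rewrite in_itv/= => /andP[y0 yl].
  suff : `|G k x - G k y| <= J.
    move=> h; have := ler_normD (G k y) (G k x - G k y); rewrite [G k y + _]addrC subrK; lra.
  have [xy|yx] := leP x y.
    rewrite distrC (proj2 sG k km)//; last exact: ltW.
    apply: le_trans (Rint_le_abs x0 (ltW yl) iG1) _.
    by apply: Rint_sub_le => //; [exact: ltW|exact: itg_norm].
  rewrite (proj2 sG k km)// ?(ltW yx) ?(ltW y0)//.
  apply: le_trans (Rint_le_abs (ltW y0) xl iG1) _.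
  by apply: Rint_sub_le => //; [exact: ltW|exact: ltW|exact: itg_norm].
have lO : (leb Omega < +oo)%E.
  by rewrite [X in (X < _)%E]lebesgue_measure_itv/= lte_fin l_gt0 -EFinB ltry.
have ic (c : R) : leb.-integrable Omega (EFin \o cst c).
  by apply: (@integrable_bdd _ _ _ `|c|).
have cl (c : R) : \int[leb]_(y in Omega) (cst c y) = c * l.
  rewrite Rintegral_cst//; congr (_ * _).
  by rewrite [X in fine X]lebesgue_measure_itv/= lte_fin l_gt0 -EFinB subr0.
have : \int[leb]_(y in Omega) (cst `|G k x| y) <= \int[leb]_(y in Omega) (`|G k y| + cst J y).
  by apply: le_Rint => //; apply: itgD => //; exact: itg_norm.
rewrite RintD//; last exact: itg_norm.
rewrite !cl => h.
have h1 := int k (ltnW km); have h2 := int k.+1 km; rewrite -/J in h2.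
have : `|G k x| <= (K * Hnorm l m v) / l + J.
  by rewrite -(ler_pM2r l_gt0) mulrDl divfK ?gt_eqF//; apply: le_trans h _; rewrite lerD2r.
move=> h3; apply: le_trans h3 _.
rewrite mulrDl [K / l * _]mulrAC addrC lerD2r mulrDl mul1r; lra.
Qed.

End SobolevBounds.

(** * Differentiation on a closed time interval *)

Section TimeDerivative.
Context {R : realType}.
Variable T : R.
Hypothesis T_gt0 : 0 < T.
Implicit Types (q p : R -> R) (s t : R).

(** Differentiability on [0, T] with one-sided limits at the end points, in the form
    of the limits of difference quotients that define derivatives of curves in H^m. *)
Definition tder q q' : Prop := forall t, 0 <= t <= T ->
  (fun s => (s - t)^-1 * (q s - q t)) @ within `[0, T] (t^') --> q' t.

Lemma within_proper t : 0 <= t <= T -> ProperFilter (within `[0, T] (t^')).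
Proof.
move=> /andP[t0 tT]; apply: Build_ProperFilter_ex => P.
move=> [e /= e0 eP].
have [tT'|Tt] := ltP t T.
  pose s := Num.min T (t + e / 2).
  have st : t < s by rewrite lt_min tT' ltrDl divr_gt0.
  have s1 : s <= t + e / 2 by rewrite ge_min lexx orbT.
  exists s; apply: eP.
  - by rewrite /= ltr0_norm ?subr_lt0//; lra.
  - by rewrite gt_eqF.
  - by rewrite /= in_itv/= ge_min lexx andbT (le_trans t0)// ltW.
pose s := Num.max 0 (t - e / 2).
have st : s < t by rewrite gt_max (lt_le_trans T_gt0 Tt)/= gtrBl divr_gt0.
have s1 : t - e / 2 <= s by rewrite le_max lexx orbT.
exists s; apply: eP.
- by rewrite /= gtr0_norm ?subr_gt0//; lra.
- by rewrite lt_eqF.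
- by rewrite /= in_itv/= le_max lexx /= (le_trans (ltW st)).
Qed.

Lemma time_derive_tder q q' t : tder q q' -> 0 <= t <= T -> time_derive T q t = q' t.
Proof.
move=> qq' t0T; rewrite /time_derive; apply: (@cvg_lim R^o).
  exact: Rhausdorff.
apply: within_proper t0T.
exact: qq'.
Qed.

Lemma tder_is_derive q q' t : tder q q' -> 0 < t < T -> is_derive t 1 q (q' t).
Proof.
move=> qq' /andP[t0 tT].
have := qq' t; rewrite !ltW//= => /(_ isT) /cvgrPdist_lt cv.
have : h^-1 *: (q (h *: 1 + t) - q t) @[h --> (0:R)^'] --> q' t.
  apply/cvgrPdist_lt => e e0; have [d /= d0 dP] := cv _ e0.
  near=> h.
  have h0 : h != 0 by near: h; exact: nbhs_dnbhs_neq.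
  have ht : `|h| < t.
    by near: h; apply: dnbhs0_lt.
  have hT : `|h| < T - t.
    by near: h; apply: dnbhs0_lt; rewrite subr_gt0.
  have hd : `|h| < d by near: h; apply: dnbhs0_lt.
  have := dP (h + t); rewrite /= opprD addrCA subrr addr0 normrN => /(_ hd).
  rewrite -subr_eq0 addrK => /(_ h0).
  rewrite /GRing.scale /= mulr1; apply.
  rewrite in_itv/=.
  move: ht hT; rewrite !ltr_norml => /andP[h1 _] /andP[_ h2].
  by apply/andP; split; lra.
move=> H; split; [by apply/cvg_ex; exists (q' t)|exact/cvg_lim].
Unshelve. all: by end_near. Qed.

Lemma tder_lipschitz q q' t : tder q q' -> 0 <= t <= T ->
  exists2 d, 0 < d & forall s, 0 <= s <= T -> `|s - t| < d ->
    `|q s - q t| <= (`|q' t| + 1) * `|s - t|.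
Proof.
move=> qq' t0T; have /cvgrPdist_lt cv := qq' t t0T.
have [d /= d0 dP] := cv _ ltr01; exists d => // s s0T sd.
have [->|st] := eqVneq s t; first by rewrite !subrr normr0 mulr0.
have st0 : 0 < `|s - t| by rewrite normr_gt0 subr_eq0.
rewrite -ler_pdivrMr//.
have -> : `|q s - q t| / `|s - t| = `|(s - t)^-1 * (q s - q t)|.
  by rewrite normrM normfV mulrC.
have := dP s; rewrite /= distrC => /(_ sd st s0T) h.
rewrite -[X in `|X|](subrK (q' t)) addrC.
by apply: le_trans (ler_normD _ _) _; rewrite lerD2l distrC ltW.
Qed.

Lemma tder_continuous q q' : tder q q' -> {within `[0, T], continuous q}.
Proof.
move=> qq'; apply/subspace_continuousP => t tI.
have t0T : 0 <= t <= T by move: tI; rewrite /= in_itv/=.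
have [d d0 dP] := tder_lipschitz qq' t0T.
apply/cvgrPdist_le => e e0.
have L0 : 0 < `|q' t| + 1 by rewrite ltr_wpDl.
exists (Num.min d (e / (`|q' t| + 1))) => /=; first by rewrite lt_min d0 divr_gt0.
move=> s /=; rewrite lt_min distrC => /andP[sd se]; rewrite in_itv/= => s0T.
rewrite distrC (le_trans (dP _ s0T sd))// mulrC -ler_pdivlMr//; exact: ltW.
Qed.

Lemma tder_lin a q q' b p p' : tder q q' -> tder p p' ->
  tder (fun t => a * q t + b * p t) (fun t => a * q' t + b * p' t).
Proof.
move=> qq' pp' t t0T.
have pf := within_proper t0T.
rewrite (_ : (fun s => _) = fun s => a * ((s - t)^-1 * (q s - q t)) + b * ((s - t)^-1 * (p s - p t))).
  apply: cvgD; apply: cvgMr; [exact: qq'|exact: pp'].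
by apply/funext => s; ring.
Qed.

Lemma tder_cst c : tder (fun=> c) (fun=> 0).
Proof.
move=> t t0T; have pf := within_proper t0T.
by under eq_fun do rewrite subrr mulr0; exact: cvg_cst.
Qed.

Lemma tder_sum n (c : 'I_n -> R) (q q' : 'I_n -> R -> R) : (forall i, tder (q i) (q' i)) ->
  tder (fun t => \sum_(i < n) c i * q i t) (fun t => \sum_(i < n) c i * q' i t).
Proof.
elim: n c q q' => [|n IH] c q q' qq'.
  have e (f : 'I_0 -> R -> R) : (fun t => \sum_(i < 0) c i * f i t) = fun=> 0.
    by apply/funext => t; rewrite big_ord0.
  by rewrite !e; exact: tder_cst.
have e (f : 'I_n.+1 -> R -> R) : (fun t => \sum_(i < n.+1) c i * f i t) =
   fun t => 1 * (\sum_(i < n) c (widen_ord (leqnSn n) i) * f (widen_ord (leqnSn n) i) t)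
            + c ord_max * f ord_max t.
  by apply/funext => t; rewrite big_ord_recr/= mul1r.
rewrite !e; apply: tder_lin => //; exact: IH.
Qed.

Lemma tder_MVT q q' s t : tder q q' -> 0 <= s -> s < t -> t <= T ->
  exists2 c, s < c < t & q t - q s = q' c * (t - s).
Proof.
move=> qq' s0 st tT.
have [||c] := @MVT _ q q' s t st.
- move=> c; rewrite in_itv/= => /andP[sc ct]; apply: (tder_is_derive qq').
  by rewrite (le_lt_trans s0 sc) (lt_le_trans ct tT).
- apply: continuous_subspaceW (tder_continuous qq').
  by apply: subset_itv; rewrite bnd_simp.
by rewrite in_itv/= => sct e; exists c.
Qed.

Lemma tder_le q q' M s t : tder q q' -> (forall r, 0 <= r <= T -> `|q' r| <= M) ->
  0 <= s -> s <= t -> t <= T -> `|q t - q s| <= M * (t - s).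
Proof.
move=> qq' qM s0; rewrite le_eqVlt => /predU1P[->|st] tT; first by rewrite !subrr normr0 mulr0.
have [c /andP[sc ct] ->] := tder_MVT qq' s0 st tT.
have ts : 0 <= t - s by rewrite subr_ge0 ltW.
rewrite normrM [`|t - s|]ger0_norm//; apply: ler_wpM2r => //; apply: qM; rewrite (le_trans s0 (ltW sc))/= (le_trans (ltW ct))//.
Qed.

(** The difference quotient is a value of q' in [s, t], by the mean value theorem. *)
Lemma tder_taylor q q' q'' M s t r : tder q q' -> tder q' q'' ->
  (forall r, 0 <= r <= T -> `|q'' r| <= M) ->
  0 <= s -> s < t -> t <= T -> s <= r <= t ->
  `|(q t - q s) / (t - s) - q' r| <= M * (t - s).
Proof.
move=> qq' qq'' qM s0 st tT /andP[sr rt].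
have M0 : 0 <= M by apply: le_trans (qM 0 _) => //; rewrite lexx ltW.
have [c /andP[sc ct] ->] := tder_MVT qq' s0 st tT.
rewrite mulfK; last by rewrite subr_eq0 gt_eqF.
have [cr|rc] := leP c r.
  rewrite distrC (le_trans (tder_le qq'' qM _ cr _))//.
  - by rewrite (le_trans s0)// ltW.
  - exact: le_trans rt tT.
  - by apply: ler_wpM2l => //; lra.
rewrite (le_trans (tder_le qq'' qM _ (ltW rc) _))//.
- exact: le_trans sr.
- by rewrite (le_trans (ltW ct)).
- by apply: ler_wpM2l => //; lra.
Qed.

End TimeDerivative.

Section TimeRep.
Context {R : realType}.
Variables l T : R.
Hypotheses (l_gt0 : 0 < l) (T_gt0 : 0 < T).

(** Evaluation of the k-th representative at x is a bounded functional on H^m for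
    k < m, applied to the difference quotient minus its limit. *)
Lemma tder_sobrep m (w w' : R -> R -> R) (W W' : R -> nat -> R -> R) :
  H_derivative l T m w w' ->
  (forall t, 0 <= t <= T -> sobrep l m (w ^~ t) (W t)) ->
  (forall t, 0 <= t <= T -> sobrep l m (w' ^~ t) (W' t)) ->
  forall k x, (k < m)%N -> 0 <= x <= l ->
    tder T (fun t => W t k x) (fun t => W' t k x).
Proof.
move=> dw rW rW' k x km xl t t0T.
have [C C0 CP] := sobrep_bound l_gt0.
have /cvgrPdist_lt cv := dw t t0T.
apply/cvgrPdist_lt => e e0.
have [d /= d0 dP] := cv _ (divr_gt0 e0 C0).
exists d => // s sd st sI.
have s0T : 0 <= s <= T by move: sI; rewrite /= in_itv/=.
have rS := sobrep_lin l_gt0 1 (-1)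
  (sobrep_lin l_gt0 (s - t)^-1 (- (s - t)^-1) (rW s s0T) (rW t t0T)) (rW' t t0T).
have [bd _] := CP _ _ _ rS; have {bd} := bd k x km xl.
rewrite distrC; set lhs := `|_|; set lhs' := `|_|; have -> : lhs = lhs'.
  by congr `|_|; ring.
move/le_lt_trans; apply.
rewrite mulrC -ltr_pdivlMr//.
have h : `|0 - Hnorm l m (fun y => (s - t)^-1 * (w y s - w y t) - w' y t)| < e / C :=
  dP s sd st sI.
move: h; rewrite sub0r normrN (ger0_norm (Hnorm_ge0 _ _ _)).
have -> // : (fun y => (s - t)^-1 * (w y s - w y t) - w' y t) =
  (fun y => 1 * ((s - t)^-1 * w y s + - (s - t)^-1 * w y t) + -1 * w' y t).
by apply/funext => y; ring.
Qed.

End TimeRep.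

(** * Consistency of the discrete Laplacian *)

Section SpatialConsistency.
Context {R : realType}.
Local Notation leb := (@lebesgue_measure R).
Implicit Types (f g : R -> R) (x y a b : R).

Lemma derive_le f f' M a b x y : (forall z, a < z < b -> is_derive z 1 f (f' z)) ->
  {within `[a, b], continuous f} -> (forall z, a < z < b -> `|f' z| <= M) ->
  a <= x <= b -> a <= y <= b -> `|f y - f x| <= M * `|y - x|.
Proof.
move=> df cf fM.
wlog xy : x y / x <= y.
  move=> H; have [xy|yx] := leP x y; first exact: H.
  by move=> xab yab; rewrite distrC [`|y - x|]distrC; apply: H => //; exact: ltW.
move: xy; rewrite le_eqVlt => /predU1P[-> _ _|xy /andP[ax xb] /andP[ay yb]].
  by rewrite !subrr normr0 mulr0.
have [||z] := @MVT _ f f' x y xy.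
- move=> z; rewrite in_itv/= => /andP[xz zy]; apply: df.
  by rewrite (le_lt_trans ax xz) (lt_le_trans zy yb).
- by apply: continuous_subspaceW cf; apply: subset_itv; rewrite bnd_simp.
rewrite in_itv/= => /andP[xz zy] ->.
rewrite normrM ler_wpM2r//; apply: fM.
by rewrite (le_lt_trans ax xz) (lt_le_trans zy yb).
Qed.

Lemma is_derive_cubic x c0 c1 c2 c3 y :
  is_derive y 1 (fun y => c0 + c1 * (y - x) + c2 * (y - x) ^+ 2 + c3 * (y - x) ^+ 3)
    (c1 + 2 * c2 * (y - x) + 3 * c3 * (y - x) ^+ 2).
Proof.
have d1 : is_derive y 1 (fun y : R => y - x) 1.
  by have := is_deriveB (is_derive_id y 1) (is_derive_cst x y 1); rewrite subr0.
have dX n : is_derive y 1 (fun y : R => (y - x) ^+ n.+1) (n.+1%:R * (y - x) ^+ n).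
  by have := is_deriveX n.+1 d1; rewrite exprfctE /GRing.scale /= mulr1.
have dZ n c : is_derive y 1 (fun y : R => c * (y - x) ^+ n.+1) (c * (n.+1%:R * (y - x) ^+ n)).
  exact: is_deriveZ.
have dZ1 : is_derive y 1 (fun y : R => c1 * (y - x)) c1.
  by have := is_deriveZ c1 d1; rewrite /GRing.scale /= mulr1.
have := is_deriveD (is_deriveD (is_deriveD (is_derive_cst c0 y 1) dZ1) (dZ 1%N c2)) (dZ 2%N c3).
move/is_derive_eq; apply; rewrite expr1; ring.
Qed.

Lemma cubic_continuous x c0 c1 c2 c3 :
  continuous (fun y => c0 + c1 * (y - x) + c2 * (y - x) ^+ 2 + c3 * (y - x) ^+ 3).
Proof.
move=> y; apply: differentiable_continuous; apply/derivable1_diffP.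
by case: (is_derive_cubic x c0 c1 c2 c3 y).
Qed.

(** Integrating a Taylor approximation of f' of order two gives one of f of order
    three; only the derivative of the difference is needed, through the mean value
    inequality. *)
Lemma taylor_step f f' x h M c0 c1 c2 : 0 <= M -> 0 < h ->
  (forall z, x - h < z < x + h -> is_derive z 1 f (f' z)) ->
  {within `[x - h, x + h], continuous f} ->
  (forall z, x - h <= z <= x + h -> `|f' z - (c0 + 2 * c1 * (z - x) + 3 * c2 * (z - x) ^+ 2)| <= M) ->
  forall z, x - h <= z <= x + h ->
    `|f z - (f x + c0 * (z - x) + c1 * (z - x) ^+ 2 + c2 * (z - x) ^+ 3)| <= h * M.
Proof.
move=> M0 h0 df cf fM z zI.
pose p z := f x + c0 * (z - x) + c1 * (z - x) ^+ 2 + c2 * (z - x) ^+ 3.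
have px : p x = f x by rewrite /p subrr !expr0n/= !mulr0 !addr0.
have := @derive_le (fun z => f z - p z)
  (fun z => f' z - (c0 + 2 * c1 * (z - x) + 3 * c2 * (z - x) ^+ 2)) M (x - h) (x + h) x z.
rewrite px subrr subr0 => H; apply: le_trans (H _ _ _ _ zI) _.
- move=> y yI; apply: is_deriveB; [exact: df|exact: is_derive_cubic].
- move=> y; apply: cvgB; [exact: cf|].
  by have := continuous_subspaceT (@cubic_continuous x (f x) c0 c1 c2); apply.
- by move=> y /andP[a b]; apply: fM; rewrite !ltW.
- by apply/andP; split; lra.
- rewrite mulrC ler_wpM2r//.
  by move: zI => /andP[a b]; rewrite ler_norml; apply/andP; split; lra.
Qed.

(** Third-order Taylor expansion of f0 at x, with f3 only known to oscillate by at
    most A; the odd terms cancel between x + h and x - h. *)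
Lemma second_difference f0 f1 f2 f3 x h A : 0 <= A -> 0 < h ->
  (forall z, x - h < z < x + h -> is_derive z 1 f0 (f1 z)) ->
  (forall z, x - h < z < x + h -> is_derive z 1 f1 (f2 z)) ->
  (forall z, x - h < z < x + h -> is_derive z 1 f2 (f3 z)) ->
  {within `[x - h, x + h], continuous f0} ->
  {within `[x - h, x + h], continuous f1} ->
  {within `[x - h, x + h], continuous f2} ->
  (forall z, x - h <= z <= x + h -> `|f3 z - f3 x| <= A) ->
  `|f0 (x + h) - 2 * f0 x + f0 (x - h) - h ^+ 2 * f2 x| <= 2 * h ^+ 3 * A.
Proof.
move=> A0 h0 d0 d1 d2 k0 k1 k2 f3A.
have s2 := @taylor_step f2 f3 x h A (f3 x) 0 0 A0 h0 d2 k2.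
have {}s2 z : x - h <= z <= x + h -> `|f2 z - (f2 x + f3 x * (z - x))| <= h * A.
  move=> zI; have := s2 _ z zI; rewrite !mul0r !addr0; apply => y yI.
  by rewrite !mulr0 !mul0r !addr0; exact: f3A.
have hA : 0 <= h * A by rewrite mulr_ge0// ltW.
have s1 := @taylor_step f1 f2 x h (h * A) (f2 x) (f3 x / 2) 0 hA h0 d1 k1.
have {}s1 z : x - h <= z <= x + h ->
    `|f1 z - (f1 x + f2 x * (z - x) + f3 x / 2 * (z - x) ^+ 2)| <= h * (h * A).
  move=> zI; have := s1 _ z zI; rewrite !mul0r !addr0; apply => y yI.
  have := s2 y yI; rewrite mulr0 mul0r addr0.
  by rewrite (_ : 2 * (f3 x / 2) = f3 x)//; field.
have hhA : 0 <= h * (h * A) by rewrite mulr_ge0// ltW.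
have s0 := @taylor_step f0 f1 x h (h * (h * A)) (f1 x) (f2 x / 2) (f3 x / 6) hhA h0 d0 k0.
have {}s0 z : x - h <= z <= x + h ->
    `|f0 z - (f0 x + f1 x * (z - x) + f2 x / 2 * (z - x) ^+ 2 + f3 x / 6 * (z - x) ^+ 3)|
      <= h * (h * (h * A)).
  move=> zI; apply: s0 => // y yI; have := s1 y yI.
  rewrite (_ : 2 * (f2 x / 2) = f2 x); last by field.
  by rewrite (_ : 3 * (f3 x / 6) = f3 x / 2)//; field.
have Ip : x - h <= x + h <= x + h by apply/andP; split; lra.
have Im : x - h <= x - h <= x + h by apply/andP; split; lra.
have := lerD (s0 _ Ip) (s0 _ Im) => H.
apply: le_trans (_ : _ <= h * (h * (h * A)) + h * (h * (h * A))) _; last first.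
  by rewrite le_eqVlt; apply/orP; left; apply/eqP; ring.
apply: le_trans H; apply: le_trans (ler_normD _ _).
by rewrite le_eqVlt; apply/orP; left; apply/eqP; congr `|_|; field.
Qed.

Variable l : R.
Hypothesis l_gt0 : 0 < l.
Local Notation Omega := `]0, l[%classic.

Lemma xnode_le N i : (0 < N)%N -> (i <= N)%N -> 0 <= xnode l N i <= l.
Proof.
move=> N0 iN; rewrite /xnode /hstep.
have NR : 0 < N%:R :> R by rewrite ltr0n.
rewrite mulr_ge0 ?divr_ge0 ?(ltW l_gt0)//= mulrCA ger_pMr// ler_pdivrMr// mul1r ler_nat//.
Qed.

(** The oscillation of the third derivative is at most the integral of |G 4| over
    the two cells next to the node; F is introduced so that the bounds telescope. *)
Lemma sobrep_laplacian v G N i : sobrep l 4 v G -> (i.+1 < N)%N ->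
  let h := hstep l N in
  let F x := \int[leb]_(z in `]0, x[) `|G 4%N z| in
  is_true (`|(G 0%N (xnode l N i) - 2 * G 0%N (xnode l N i.+1) + G 0%N (xnode l N i.+2)) / h ^+ 2
     - G 2%N (xnode l N i.+1)| <= 2 * h * (F (xnode l N i.+2) - F (xnode l N i))).
Proof.
move=> sG iN h F.
have N0 : (0 < N)%N by apply: leq_ltn_trans iN.
have h0 : 0 < h by rewrite /h /hstep divr_gt0// ltr0n.
set x := xnode l N i.+1.
have xm : xnode l N i = x - h by rewrite /x /xnode -/h -natr1; ring.
have xp : xnode l N i.+2 = x + h by rewrite /x /xnode -/h -[i.+2%:R]natr1; ring.
have /andP[xm0 _] := xnode_le N0 (ltnW (ltnW iN)).
have /andP[_ xpl] := xnode_le N0 iN.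
rewrite xm in xm0; rewrite xp in xpl; rewrite xm xp.
have iG := sobrep_integrable l_gt0 sG (leqnn 4).
have iG' := itg_norm iG.
set A := F (x + h) - F (x - h).
have AE : A = \int[leb]_(z in `]x - h, x + h[) `|G 4%N z|.
  rewrite /A /F (@Rint_cat _ l _ 0 (x - h) (x + h))//; last by lra.
  by rewrite addrC addKr.
have A0 : 0 <= A by rewrite AE; apply: Rintegral_ge0.
have sub : `[x - h, x + h] `<=` `[0, l] by apply: subset_itv; rewrite bnd_simp.
have dG k z : (k.+1 < 4)%N -> x - h < z < x + h -> is_derive z 1 (G k) (G k.+1 z).
  move=> k4 /andP[z1 z2]; apply: (sobrep_is_derive l_gt0 sG) => //.
  by rewrite (le_lt_trans xm0 z1) (lt_le_trans z2 xpl).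
have cG k : (k < 4)%N -> {within `[x - h, x + h], continuous (G k)}.
  by move=> k4; apply: continuous_subspaceW sub (sobrep_continuous l_gt0 sG k4).
have sub_le a b : x - h <= a -> a <= b -> b <= x + h -> \int[leb]_(z in `]a, b[) `|G 4%N z| <= A.
  move=> xa ab bx; rewrite AE (@Rint_cat _ l _ (x - h) a (x + h))//; last by lra.
  rewrite (@Rint_cat _ l _ a b (x + h))//; last by lra.
  by rewrite addrCA lerDl addr_ge0//; apply: Rintegral_ge0.
have := @second_difference (G 0%N) (G 1%N) (G 2%N) (G 3%N) x h A A0 h0
  (fun z => dG 0%N z isT) (fun z => dG 1%N z isT) (fun z => dG 2%N z isT)
  (cG 0%N isT) (cG 1%N isT) (cG 2%N isT).
move=> H; have {}H := H _.
have hh : 0 < h ^+ 2 by rewrite exprn_gt0.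
rewrite -(ler_pM2r hh) -{2}(ger0_norm (ltW hh)) -normrM.
rewrite mulrBl divfK ?gt_eqF//.
apply: le_trans (_ : _ <= 2 * h ^+ 3 * A) _; last first.
  by rewrite le_eqVlt; apply/orP; left; apply/eqP; ring.
have -> : G 0%N (x - h) - 2 * G 0%N x + G 0%N (x + h) - G 2%N x * h ^+ 2 =
  G 0%N (x + h) - 2 * G 0%N x + G 0%N (x - h) - h ^+ 2 * G 2%N x by ring.
apply: H => z /andP[z1 z2].
have [xz|zx] := leP x z.
  rewrite (proj2 sG 3%N isT x z)//; [|lra|lra].
  by apply: le_trans (Rint_le_abs _ _ iG) (sub_le _ _ _ _ _) => //; lra.
rewrite distrC (proj2 sG 3%N isT z x)//; [|lra|exact: ltW|lra].
by apply: le_trans (Rint_le_abs _ _ iG) (sub_le _ _ _ _ _) => //; lra.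
Qed.

(** Each cell is counted twice.  The factor is h rather than h^2: the missing h
    comes from the weight of the discrete L^1 norm. *)
Lemma sobrep_laplacian_sum v G N : sobrep l 4 v G -> (0 < N)%N ->
  let h := hstep l N in
  is_true (\sum_(i < N.-1)
  `|(G 0%N (xnode l N i) - 2 * G 0%N (xnode l N i.+1) + G 0%N (xnode l N i.+2)) / h ^+ 2
     - G 2%N (xnode l N i.+1)| <= 4 * h * \int[leb]_(z in Omega) `|G 4%N z|).
Proof.
move=> sG N0 h.
pose F x := \int[leb]_(z in `]0, x[) `|G 4%N z|.
have h0 : 0 < h by rewrite /h /hstep divr_gt0// ltr0n.
apply: le_trans (_ : _ <= \sum_(i < N.-1) 2 * h * (F (xnode l N i.+2) - F (xnode l N i))) _.
  apply: ler_sum => i _; have := ltn_ord i; rewrite ltn_predRL => iN.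
  exact: (sobrep_laplacian sG iN).
have iG := itg_norm (sobrep_integrable l_gt0 sG (leqnn 4)).
have F0 x : 0 <= F x by apply: Rintegral_ge0.
have Fl j : (j <= N)%N -> F (xnode l N j) <= \int[leb]_(z in Omega) `|G 4%N z|.
  by move=> jN; have /andP[a b] := xnode_le N0 jN; apply: Rint_sub_le.
rewrite -mulr_sumr.
have -> : \sum_(i < N.-1) (F (xnode l N i.+2) - F (xnode l N i)) =
    (F (xnode l N N) - F (xnode l N 1)) + (F (xnode l N N.-1) - F (xnode l N 0)).
  rewrite -(prednK N0) /=.
  rewrite -(telescope_sumr (fun j => F (xnode l N.-1.+1 j.+1)) (leq0n N.-1)).
  rewrite -(telescope_sumr (fun j => F (xnode l N.-1.+1 j)) (leq0n N.-1)).
  rewrite !big_mkord -big_split /=; apply: eq_bigr => i _; ring.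
have -> : 4 * h * \int[leb]_(z in Omega) `|G 4%N z| = 2 * h * (2 * \int[leb]_(z in Omega) `|G 4%N z|) by ring.
apply: ler_wpM2l; first by rewrite mulr_ge0// ltW.
have := Fl N (leqnn N); have := Fl N.-1 (leq_pred N); have := F0 (xnode l N 1); have := F0 (xnode l N 0); lra.
Qed.

End SpatialConsistency.

(** * The Caputo kernel *)

Section Kernel.
Context {R : realType}.
Local Notation leb := (@lebesgue_measure R).
Implicit Types (f g : R -> R) (s t x y a b : R).
Variable alpha : R.
Hypothesis alpha01 : 0 < alpha < 1.
Let al1 : 0 < 1 - alpha. Proof. by have /andP[_ ?] := alpha01; rewrite subr_gt0. Qed.

Definition ker t s : R := (t - s) `^ (- alpha).

Lemma ker_ge0 t s : 0 <= ker t s. Proof. exact: powR_ge0. Qed.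

Lemma is_derive_prim t s : s < t ->
  is_derive s 1 (fun s => - (t - s) `^ (1 - alpha) / (1 - alpha)) (ker t s).
Proof.
move=> st; have ts : 0 < t - s by rewrite subr_gt0.
have d1 : is_derive s 1 (fun s : R => t - s) (-1).
  by have := is_deriveB (is_derive_cst t s 1) (is_derive_id s 1); rewrite sub0r.
have := @is_derive1_comp _ (fun y : R => y `^ (1 - alpha)) (fun s => t - s) s _ _ (@is_derive1_powR R (1 - alpha) _ ts) d1.
move=> d2; have := is_deriveZ (- (1 - alpha)^-1) d2.
rewrite (_ : - (1 - alpha)^-1 \*: _ = (fun s => - (t - s) `^ (1 - alpha) / (1 - alpha))); last first.
  by apply/funext => z; rewrite /= /GRing.scale /= mulNr mulNr mulrC.
move/is_derive_eq; apply.
rewrite /GRing.scale /= /ker addrAC subrr add0r.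
by field; rewrite gt_eqF.
Qed.

Lemma ker_continuous t s : s < t -> {for s, continuous (ker t)}.
Proof.
move=> st; have ts : 0 < t - s by rewrite subr_gt0.
apply: (@continuous_comp _ _ _ (fun s => t - s) (fun y : R => y `^ (- alpha))).
  by apply: cvgB; [exact: cvg_cst|exact: cvg_id].
have [d _] := @is_derive1_powR R (- alpha) _ ts.
by apply: differentiable_continuous; apply/derivable1_diffP.
Qed.

Lemma ker_measurable t : measurable_fun `]-oo, t[ (ker t).
Proof.
apply: open_continuous_measurable_fun; first exact: interval_open.
by move=> s; rewrite inE /= in_itv/= => st; exact: ker_continuous.
Qed.

Lemma ker_int_lt t a b : a < b -> b < t ->
  (\int[leb]_(s in `[a, b]) (ker t s)%:E =
   (((t - a) `^ (1 - alpha) - (t - b) `^ (1 - alpha)) / (1 - alpha))%:E)%E.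
Proof.
move=> ab bt.
pose P s := - (t - s) `^ (1 - alpha) / (1 - alpha).
have cP s : s < t -> {for s, continuous P}.
  move=> st; apply: differentiable_continuous; apply/derivable1_diffP.
  by case: (is_derive_prim st).
rewrite (@continuous_FTC2 _ _ P)//.
- by rewrite -EFinB /P; congr EFin; field; rewrite gt_eqF.
- apply: continuous_in_subspaceT => s; rewrite inE /= in_itv/= => /andP[_ sb].
  by apply: ker_continuous; exact: le_lt_trans bt.
- split.
  + move=> s; rewrite in_itv/= => /andP[_ sb].
    by case: (is_derive_prim (lt_trans sb bt)).
  + by apply: cvg_at_right_filter; apply: cP; exact: lt_trans bt.
  + by apply: cvg_at_left_filter; exact: cP.
- move=> s; rewrite in_itv/= => /andP[_ sb].
  by rewrite derive1E; have [_ ->] := is_derive_prim (lt_trans sb bt).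
Qed.

(** The kernel is unbounded at t, so the fundamental theorem is applied on intervals
    ending before t, which exhaust ]0, t[ by monotone convergence. *)
Lemma ker_int0 t : 0 < t ->
  (\int[leb]_(s in `]0%R, t[) (ker t s)%:E = (t `^ (1 - alpha) / (1 - alpha))%:E)%E.
Proof.
move=> t0.
pose b n := t - t / n.+2%:R.
have bt n : b n < t by rewrite gtrBl divr_gt0.
have b0 n : 0 < b n by rewrite subr_gt0 ltr_pdivrMr// ltr_pMr// ltr1n.
pose F n := `]0, b n]%classic : set R.
have Fb : \bigcup_n F n = `]0, t[%classic.
  apply/seteqP; split => [s [n _]|s] /=; rewrite /F /= !in_itv/= => /andP[s0 sb].
    by rewrite s0 (le_lt_trans sb).
  have e0 : 0 < (t - s) / t by rewrite divr_gt0// subr_gt0.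
  have [n _ nP] := near_harmonic e0; exists n => //=; rewrite in_itv/= s0/= /b lerBrDl -lerBrDr.
  have := nP n (leqnn n); rewrite /= -(ler_pM2l t0) [t * ((t - s) / t)]mulrC divfK ?gt_eqF// => h.
  by apply: le_trans h; rewrite ler_pM2l// lef_pV2 ?posrE// ler_nat.
have mF n : measurable (F n) by exact: measurable_itv.
have mk n : measurable_fun (F n) (EFin \o ker t).
  apply/measurable_EFinP; have km := @ker_measurable t.
  apply: (measurable_funS (measurable_itv _) _ km).
  by move=> s; rewrite /F /= !in_itv/= => /andP[_ sb]; exact: le_lt_trans (bt n).
have nd : nondecreasing_seq F.
  move=> n m nm; rewrite subsetEset; apply: subset_itvl; rewrite bnd_simp /b lerD2l lerN2.
  by rewrite ler_pM2l// lef_pV2 ?posrE// ler_nat.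
have k0 n s : F n s -> (0 <= (EFin \o ker t) s)%E by move=> _; rewrite lee_fin ker_ge0.
have := @ge0_nondecreasing_set_cvg_integral _ (measurableTypeR R) R F (EFin \o ker t) leb nd mF mk k0.
rewrite Fb.
have FE n : (\int[leb]_(s in F n) (EFin \o ker t) s =
    ((t `^ (1 - alpha) - (t / n.+2%:R) `^ (1 - alpha)) / (1 - alpha))%:E)%E.
  rewrite /F integral_itv_obnd_cbnd; last exact: mk.
  by rewrite ker_int_lt// subr0 /b subKr.
under eq_fun do rewrite FE.
move=> cv; apply: (@cvg_unique _ (@ereal_hausdorff R) _ _ _ _ cv).
apply/cvg_EFin; first exact: nearW.
have -> : t `^ (1 - alpha) / (1 - alpha) = (t `^ (1 - alpha) - 0) / (1 - alpha) by rewrite subr0.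
apply: cvgMl; apply: cvgB; first exact: cvg_cst.
have := powR_cvg0 al1; move/cvg_at_rightP; apply; split; first by move=> n; rewrite divr_gt0.
rewrite -(mulr0 t); apply: cvgMr.
apply/cvgrPdist_le => e e0; have := near_harmonic e0; apply: filterS => n h.
rewrite sub0r normrN ger0_norm ?invr_ge0//; apply: le_trans h.
by rewrite lef_pV2 ?posrE// ler_nat.
Qed.

Lemma ker_itg t : 0 < t -> leb.-integrable `]0, t[ (EFin \o ker t).
Proof.
move=> t0; apply/integrableP; split.
  apply/measurable_EFinP; have km := @ker_measurable t.
  apply: (measurable_funS (measurable_itv _) _ km); exact: subset_itvr.
rewrite (_ : (\int[leb]_(x in _) _)%E = (\int[leb]_(s in `]0%R, t[) (ker t s)%:E)%E).
  by rewrite ker_int0// ltry.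
by apply: eq_integral => s _ /=; rewrite ger0_norm// ker_ge0.
Qed.

Lemma ker_Rint t a b : 0 < t -> 0 <= a -> a <= b -> b <= t ->
  \int[leb]_(s in `]a, b[) ker t s =
  ((t - a) `^ (1 - alpha) - (t - b) `^ (1 - alpha)) / (1 - alpha).
Proof.
move=> t0 a0 ab bt; have ki := ker_itg t0.
have al0 : 1 - alpha != 0 by rewrite gt_eqF.
have pre c : 0 <= c -> c <= t -> \int[leb]_(s in `]0, c[) ker t s =
    (t `^ (1 - alpha) - (t - c) `^ (1 - alpha)) / (1 - alpha).
  rewrite le_eqVlt => /predU1P[<- _|c0].
    by rewrite set_itvoo0 Rintegral_set0 subr0 subrr mul0r.
  rewrite le_eqVlt => /predU1P[->|ct].
    by rewrite /Rintegral ker_int0//= subrr powR0// subr0.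
  have ki' : leb.-integrable `]0, c[ (EFin \o ker t).
    by apply: itgS ki => //; apply: subset_itvl; rewrite bnd_simp ltW.
  rewrite Rintegral_itv_bndo_bndc// Rintegral_itv_obnd_cbnd; last first.
    by apply: itgS ki => //; apply: subset_itvl; rewrite bnd_simp.
  by rewrite /Rintegral ker_int_lt//= subr0.
have := @Rint_cat _ t (ker t) 0 a b (lexx 0) a0 ab bt ki.
have b0 := le_trans a0 ab; have at' := le_trans ab bt.
rewrite !pre//.
by move=> h; apply: (addrI ((t `^ (1 - alpha) - (t - a) `^ (1 - alpha)) / (1 - alpha))); rewrite -h; field.
Qed.

End Kernel.

(** * The functional equation of the Gamma function *)

Section GammaFunction.
Context {R : realType}.
Local Notation leb := (@lebesgue_measure R).
Implicit Types (s z : R).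

Let Bz z s : R := s `^ z * expR (- s).

Let is_derive_Bz z s : 0 < s -> is_derive s 1 (Bz z) (z * Bz (z - 1) s - Bz z s).
Proof.
move=> s0.
have dN : is_derive s 1 (fun s : R => - s) (-1).
  exact: (is_deriveN (is_derive_id s 1)).
have dE := @is_derive1_comp _ expR (fun s : R => - s) s _ _ (is_derive_expR (- s)) dN.
have dP := @is_derive1_powR R z s s0.
have := is_deriveM dP dE; move/is_derive_eq; apply.
by rewrite /GRing.scale /= /Bz; ring.
Qed.

Let Bz_continuous z s : 0 < s -> {for s, continuous (Bz z)}.
Proof.
move=> s0; apply: differentiable_continuous; apply/derivable1_diffP.
by case: (is_derive_Bz z s0).
Qed.

Let Bz_ge0 z s : 0 <= Bz z s.
Proof. by rewrite mulr_ge0 ?powR_ge0 ?expR_ge0. Qed.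

Lemma Gamma_ge0 z : 0 <= Gamma z.
Proof. by apply: Rintegral_ge0 => s _; exact: Bz_ge0. Qed.

(** Integration by parts on [1/(n+2), n+2], then monotone convergence; the boundary
    terms vanish because 0 < z, and the bound exp x >= x^2/2 suffices since z < 1. *)
Lemma GammaS z : 0 < z < 1 -> Gamma (z + 1) = z * Gamma z.
Proof.
move=> /andP[z0 z1].
pose c (n : nat) : R := n.+2%:R.
have c1 n : 1 < c n by rewrite /c ltr1n.
have c0 n : 0 < c n by rewrite (lt_trans ltr01).
have ci n : (c n)^-1 < 1 by rewrite invf_lt1.
have ci0 n : 0 < (c n)^-1 by rewrite invr_gt0.
have cc n : (c n)^-1 < c n by exact: lt_trans (c1 n).
pose F n := `[(c n)^-1, c n]%classic : set R.
have Fpos n s : F n s -> 0 < s.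
  by rewrite /F /= in_itv/= => /andP[h _]; exact: lt_le_trans h.
have Fb : \bigcup_n F n = `]0, +oo[%classic.
  apply/seteqP; split => [s [n _ /Fpos]|s] /=; rewrite !in_itv/= andbT// => s0.
  have sV : 0 < s^-1 by rewrite invr_gt0.
  have [n _ nP] := near_harmonic s0.
  have [m _ mP] := near_harmonic sV.
  exists (maxn n m) => //; rewrite /F /= in_itv/=; apply/andP; split.
    apply: le_trans (nP _ (leq_maxl n m)).
    by rewrite lef_pV2 ?posrE// /c ler_nat.
  have := mP _ (leq_maxr n m); rewrite /= lef_pV2 ?posrE// => h.
  by apply: le_trans h _; rewrite /c ler_nat.
have mF n : measurable (F n) by exact: measurable_itv.
have cB w n : {within F n, continuous (Bz w)}.
  apply: continuous_in_subspaceT => s; rewrite inE => /Fpos s0; exact: Bz_continuous.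
have iB w n : leb.-integrable (F n) (EFin \o Bz w).
  by apply: continuous_compact_integrable => //; exact: segment_compact.
have mB w n : measurable_fun (F n) (EFin \o Bz w) by exact: (measurable_int leb (iB w n)).
have nd : nondecreasing_seq F.
  move=> n m nm; rewrite subsetEset; apply: subset_itv; rewrite bnd_simp.
    by rewrite lef_pV2 ?posrE// /c ler_nat.
  by rewrite /c ler_nat.
have pB w n s : F n s -> (0 <= (EFin \o Bz w) s)%E by move=> _; rewrite lee_fin.
have cv w : (\int[leb]_(s in F n) (Bz w s)%:E @[n --> \oo] -->
    \int[leb]_(s in `]0%R, +oo[) (Bz w s)%:E)%E.
  have := @ge0_nondecreasing_set_cvg_integral _ (measurableTypeR R) R F (EFin \o Bz w) leb nd mF (mB w) (pB w).
  by rewrite Fb.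
pose X (w : R) : \bar R := (\int[leb]_(s in `]0%R, +oo[) (Bz w s)%:E)%E.
have part n : (\int[leb]_(s in F n) (Bz z s)%:E + (Bz z (c n) - Bz z (c n)^-1)%:E
    = z%:E * \int[leb]_(s in F n) (Bz (z - 1)%R s)%:E)%E.
  have cD : {within F n, continuous (fun s => z * Bz (z - 1) s - Bz z s)}.
    move=> s; apply: cvgB; last exact: cB.
    by apply: cvgMr; exact: cB.
  have ftc := @continuous_FTC2 _ (fun s => z * Bz (z - 1) s - Bz z s) (Bz z) _ _ (cc n) cD.
  have {}ftc := ftc _ _.
  have : (\int[leb]_(s in F n) (z * Bz (z - 1) s - Bz z s)%:E = (Bz z (c n))%:E - (Bz z (c n)^-1)%:E)%E.
    apply: ftc.
    - split.
      + move=> s; rewrite in_itv/= => /andP[h _].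
        by case: (is_derive_Bz z (lt_trans (ci0 n) h)).
      + by apply: cvg_at_right_filter; exact: Bz_continuous.
      + by apply: cvg_at_left_filter; exact: Bz_continuous.
    - move=> s; rewrite in_itv/= => /andP[h _].
      by rewrite derive1E; have [_ ->] := is_derive_Bz z (lt_trans (ci0 n) h).
  have iZ := itgZl z (mF n) (iB (z - 1) n).
  rewrite (EFin_Rint (mF n) (itgB (mF n) iZ (iB z n))) RintB//.
  rewrite RintZl// !EFin_Rint// -EFinB => -[h].
  by rewrite -EFinD -EFinM; congr EFin; rewrite -h; ring.
have dB : Bz z (c n) - Bz z (c n)^-1 @[n --> \oo] --> (0:R).
  rewrite -[X in _ --> X](subr0 0); apply: cvgB.
    apply/cvgrPdist_le => e e0.
    have e2 : 0 < e / 2 by rewrite divr_gt0.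
    have := near_harmonic e2; apply: filterS => n h.
    rewrite sub0r normrN ger0_norm ?Bz_ge0// /Bz expRN.
    have h1 : c n `^ z <= c n.
      by rewrite -[leRHS]powRr1 ?(ltW (c0 n))//; apply: ler_powR; exact: ltW.
    have h2 : c n ^+ 2 / 2 <= expR (c n).
      have := expR_ge1Dxn 1 (ltW (c0 n)); apply: le_trans.
      by rewrite lerDr.
    rewrite ler_pdivrMr ?expR_gt0// (le_trans h1)//.
    apply: le_trans (_ : e * (c n ^+ 2 / 2) <= _); last by rewrite ler_wpM2l// ltW.
    have h3 : 1 <= c n * (e / 2).
      rewrite -ler_pdivrMl// mulr1; apply: le_trans h.
      by rewrite lef_pV2 ?posrE// /c ler_nat.
    have -> : e * (c n ^+ 2 / 2) = c n * (c n * (e / 2)) by ring.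
    by rewrite ler_peMr// ltW.
  have cvi : (c n)^-1 @[n --> \oo] --> (0:R).
    apply/cvgrPdist_le => e e0; have := near_harmonic e0; apply: filterS => n h.
    rewrite sub0r normrN ger0_norm ?(ltW (ci0 n))//; apply: le_trans h.
    by rewrite lef_pV2 ?posrE// /c ler_nat.
  have p0 : (c n)^-1 `^ z @[n --> \oo] --> (0:R).
    by have := powR_cvg0 z0; move/cvg_at_rightP; apply; split.
  apply: (@squeeze_cvgr _ _ _ _ (fun=> 0) (fun n => (c n)^-1 `^ z)) => //.
    near=> n; rewrite Bz_ge0/= /Bz ler_piMr ?powR_ge0//.
    by rewrite ltW// expR_lt1 oppr_lt0.
  exact: cvg_cst.
have XE : X z = (z%:E * X (z - 1)%R)%E.
  have l1 : (\int[leb]_(s in F n) (Bz z s)%:E + (Bz z (c n) - Bz z (c n)^-1)%:E @[n --> \oo] --> X z + 0%:E)%E.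
    apply: cvgeD; [by rewrite fin_num_adde_defl|exact: cv|].
    by apply/cvg_EFin => //; exact: nearW.
  have l2 : (z%:E * \int[leb]_(s in F n) (Bz (z - 1) s)%:E @[n --> \oo] --> z%:E * X (z - 1)%R)%E.
    by apply: cvgeZl => //; exact: cv.
  have := @cvg_unique _ (@ereal_hausdorff R) _ _ _ _ l1.
  under eq_fun do rewrite part.
  by move=> H; have := H _ _ l2; rewrite adde0; apply.
have GE w : Gamma w = fine (X (w - 1)) by [].
rewrite !GE addrK XE.
have X0 : (0 <= X (z - 1)%R)%E by apply: integral_ge0 => s _; rewrite lee_fin Bz_ge0.
move: X0; case: (X (z - 1)) => [x||] //= _.
by rewrite gt0_muley ?lte_fin//= mulr0.
Unshelve. all: by end_near. Qed.

End GammaFunction.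

(** * The graded mesh and the L1 approximation of the Caputo derivative *)

Section Mesh.
Context {R : realType}.
Variables (T r : R) (M : nat).
Hypotheses (T_gt0 : 0 < T) (r_ge1 : 1 <= r) (M_gt0 : (0 < M)%N).
Local Notation t := (tnode T r M).
Local Notation tau := (tau T r M).

Let r_gt0 : 0 < r. Proof. exact: lt_le_trans r_ge1. Qed.
Let MR : 0 < M%:R :> R. Proof. by rewrite ltr0n. Qed.

Lemma tnode0 : t 0 = 0.
Proof. by rewrite /tnode mul0r powR0 ?mulr0// gt_eqF. Qed.

Lemma tnodeM : t M = T.
Proof. by rewrite /tnode divff ?gt_eqF// powR1 mulr1. Qed.

Lemma tnode_lt i j : (i < j)%N -> t i < t j.
Proof.
move=> ij; rewrite /tnode ltr_pM2l// gt0_ltr_powR ?nnegrE ?divr_ge0//.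
by rewrite ltr_pM2r ?invr_gt0// ltr_nat.
Qed.

Lemma tnode_le i j : (i <= j)%N -> t i <= t j.
Proof. by rewrite leq_eqVlt => /predU1P[->//|/tnode_lt/ltW]. Qed.

Lemma tnode_itv k : (k <= M)%N -> 0 <= t k <= T.
Proof. by move=> kM; rewrite -[X in X <= _ <= _]tnode0 -[X in _ <= _ <= X]tnodeM !tnode_le. Qed.

Lemma tau_gt0 k : (0 < k)%N -> 0 < tau k.
Proof. by case: k => // k _; rewrite /tau subr_gt0 tnode_lt. Qed.

Lemma sum_tau k : \sum_(1 <= j < k.+1) tau j = t k.
Proof.
elim: k => [|k IH]; first by rewrite big_geq// tnode0.
by rewrite big_nat_recr//= IH /tau /= addrC subrK.
Qed.

Lemma tau_le_taumax k : (1 <= k <= M)%N -> tau k <= taumax T r M.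
Proof.
move=> kM; rewrite /taumax; apply: le_bigmax_seq => //.
by rewrite mem_index_iota ltnS.
Qed.

Lemma taumax_ge0 : 0 <= taumax T r M.
Proof. by apply: le_trans (tau_le_taumax (k := M) _); [exact/ltW/tau_gt0|rewrite M_gt0/=]. Qed.

End Mesh.

Section CaputoError.
Context {R : realType}.
Local Notation leb := (@lebesgue_measure R).
Variables (alpha T : R).
Hypotheses (alpha01 : 0 < alpha < 1) (T_gt0 : 0 < T).

(** Matches the constant of the Caputo derivative with that of its L1 formula, whose
    weights lack the factor 1/(1 - alpha). *)
Lemma Gamma_inv : (Gamma (1 - alpha))^-1 = (1 - alpha) * (Gamma (2 - alpha))^-1 :> R.
Proof.
have /andP[a0 a1] := alpha01.
have -> : 2 - alpha = (1 - alpha) + 1 by ring.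
rewrite GammaS; last by apply/andP; split; lra.
by rewrite invfM mulVKf// gt_eqF// subr_gt0.
Qed.

Variables (r : R) (M : nat).
Hypotheses (r_ge1 : 1 <= r) (M_gt0 : (0 < M)%N).
Local Notation t := (tnode T r M).

Lemma Rint_nodes f k n : (k <= M)%N -> (n <= k)%N ->
  leb.-integrable `]0, t k[ (EFin \o f) ->
  \int[leb]_(s in `]0, t n[) f s = \sum_(j < n) \int[leb]_(s in `]t j, t j.+1[) f s.
Proof.
move=> kM; elim: n => [|n IH] nk fi.
  by rewrite big_ord0 tnode0// set_itvoo0 Rintegral_set0.
rewrite big_ord_recr /= -IH//; last exact: ltnW.
have t0 : t 0%N = 0 by exact: tnode0.
apply: (@Rint_cat _ (t k)) => //; last exact: tnode_le.
  by rewrite -t0 tnode_le.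
exact: tnode_le.
Qed.

(** The L1 formula integrates the kernel exactly against the piecewise constant
    function of difference quotients of q, and these differ from q' by at most
    K taumax. *)
Lemma caputo_L1 (q q' q'' : R -> R) K k :
  tder T q q' -> tder T q' q'' -> (forall s, 0 <= s <= T -> `|q'' s| <= K) ->
  (1 <= k <= M)%N ->
  `|(Gamma (2 - alpha))^-1 * \sum_(j < k) dcoef T r M alpha k j.+1 * (q (t j.+1) - q (t j))
    - (Gamma (1 - alpha))^-1 * \int[leb]_(s in `]0, t k[) (ker alpha (t k) s * q' s)|
  <= (Gamma (2 - alpha))^-1 * T `^ (1 - alpha) * K * taumax T r M.
Proof.
move=> dq dq' qK /andP[k1 kM].
have /andP[a0 a1] := alpha01.
have al : 1 - alpha != 0 by rewrite gt_eqF// subr_gt0.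
have tk0 : 0 < t k by rewrite -(tnode0 T M r_ge1); exact: tnode_lt.
have /andP[_ tkT] := tnode_itv T_gt0 r_ge1 M_gt0 kM.
have K0 : 0 <= K by apply: le_trans (qK 0 _) => //; rewrite lexx ltW.
have ki := ker_itg alpha01 tk0.
have mI : measurable (`]0, t k[ : set R) by exact: measurable_itv.
have mq' : measurable_fun `]0, t k[ q'.
  apply: (@measurable_funS _ _ _ _ `[0, T]) => //.
    by apply: subset_itv; rewrite bnd_simp.
  apply: subspace_continuous_measurable_fun; first exact: measurable_itv.
  exact: tder_continuous dq'.
have bq' s : `]0, t k[%classic s -> `|q' s| <= `|q' 0| + K * T.
  rewrite /= in_itv/= => /andP[s0 sk].
  have sT : s <= T by apply: le_trans tkT; exact: ltW.
  have h := tder_le dq' qK (lexx 0) (ltW s0) sT.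
  rewrite -[q' s](subrK (q' 0)) addrC (le_trans (ler_normD _ _))// lerD2l.
  by apply: le_trans h _; rewrite subr0 ler_wpM2l.
have ki' := integrable_mulb mI ki mq' bq'.
pose I j := \int[leb]_(s in `]t j, t j.+1[) ker alpha (t k) s.
pose J j := \int[leb]_(s in `]t j, t j.+1[) (ker alpha (t k) s * q' s).
pose dl j := (q (t j.+1) - q (t j)) / (t j.+1 - t j).
have tt j : t j < t j.+1 by exact: tnode_lt.
have tpos j : 0 <= t j by rewrite -(tnode0 T M r_ge1); exact: tnode_le.
have dE (j : 'I_k) : dcoef T r M alpha k j.+1 * (q (t j.+1) - q (t j)) = (1 - alpha) * (dl j * I j).
  rewrite /I ker_Rint//; [|exact: ltW|exact: tnode_le].
  have d0 : t j.+1 - t j != 0 by rewrite subr_eq0 gt_eqF.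
  rewrite /dcoef /dl /=; move: (t j.+1 - t j) d0 => d d0.
  move: (_ `^ _) (_ `^ _) (q _ - q _) => A B c; field; exact/andP.
have GI := Gamma_inv; rewrite [X in _ - X * _]GI (Rint_nodes kM (leqnn k) ki').
have -> : \sum_(j < k) dcoef T r M alpha k j.+1 * (q (t j.+1) - q (t j)) =
    (1 - alpha) * \sum_(j < k) dl j * I j.
  by rewrite mulr_sumr; apply: eq_bigr => j _; exact: dE.
have -> : (Gamma (2 - alpha))^-1 * ((1 - alpha) * \sum_(j < k) dl j * I j) -
  (1 - alpha) / Gamma (2 - alpha) * \sum_(j < k) J j =
  (Gamma (2 - alpha))^-1 * ((1 - alpha) * \sum_(j < k) (dl j * I j - J j)).
  by rewrite sumrB; ring.
have G0 : 0 <= (Gamma (2 - alpha))^-1 :> R by rewrite invr_ge0 Gamma_ge0.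
rewrite normrM (ger0_norm G0) -!mulrA ler_wpM2l//.
rewrite normrM (@ger0_norm _ (1 - alpha)); last by rewrite subr_ge0 ltW.
have loc (j : 'I_k) : `|dl j * I j - J j| <= K * taumax T r M * I j.
  have sub : `]t j, t j.+1[ `<=` `]0, t k[.
    by apply: subset_itv; rewrite bnd_simp//; exact: tnode_le.
  have mIj : measurable (`]t j, t j.+1[ : set R) by exact: measurable_itv.
  have kj := itgS mI mIj sub ki; have kj' := itgS mI mIj sub ki'.
  rewrite /I /J -(RintZl _ mIj kj) -RintB//; last exact: itgZl.
  rewrite -(RintZl _ mIj kj).
  have iB := itgB mIj (itgZl (dl j) mIj kj) kj'.
  apply: le_trans (le_normr_Rint mIj iB) _.
  apply: le_Rint => //; [exact: itg_norm|exact: itgZl|].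
  move=> s; rewrite /= in_itv/= => /andP[js sj].
  rewrite [dl j * _]mulrC -mulrBr normrM (ger0_norm (ker_ge0 _ _ _)) mulrC.
  rewrite ler_wpM2r ?ker_ge0//.
  have jM : (j.+1 <= M)%N by apply: leq_trans kM.
  have /andP[_ tjT] := tnode_itv T_gt0 r_ge1 M_gt0 jM.
  apply: le_trans (tder_taylor T_gt0 dq dq' qK (tpos j) (tt j) tjT _) _.
    by rewrite !ltW.
  by rewrite ler_wpM2l//; apply: (@tau_le_taumax _ T r M j.+1).
apply: (@le_trans _ _ ((1 - alpha) * \sum_(j < k) (K * taumax T r M * I j))).
  apply: ler_wpM2l; first by rewrite subr_ge0 ltW.
  apply: le_trans (ler_norm_sum _ _ _) _; exact: ler_sum.
rewrite -mulr_sumr -(Rint_nodes kM (leqnn k) ki) (ker_Rint alpha01 tk0 (lexx 0) (ltW tk0) (lexx (t k))).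
rewrite subr0 subrr powR0// subr0.
have -> : (1 - alpha) * (K * taumax T r M * (t k `^ (1 - alpha) / (1 - alpha))) =
  t k `^ (1 - alpha) * (K * taumax T r M) by field.
apply: ler_wpM2r; first by rewrite mulr_ge0// (taumax_ge0 T_gt0 r_ge1 M_gt0).
by apply: ge0_ler_powR; rewrite ?nnegrE ?subr_ge0 ?(ltW a1) ?(ltW tk0) ?(ltW T_gt0).
Qed.

End CaputoError.

(** * Monotonicity of the graded mesh *)

Section PowerMVT.
Context {R : realType}.
Implicit Types (a b p x : R).

Lemma powR_MVT p a b : 0 < p -> 0 <= a -> a < b ->
  exists2 c, a < c < b & b `^ p - a `^ p = p * c `^ (p - 1) * (b - a).
Proof.
move=> p0 a0 ab.
have cx x : 0 < x -> {for x, continuous (fun y : R => y `^ p)}.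
  move=> x0; have [d _] := @is_derive1_powR R p x x0.
  by apply: differentiable_continuous; apply/derivable1_diffP.
have cab : {within `[a, b], continuous (fun y : R => y `^ p)}.
  apply/continuous_within_itvP => //; split.
  - by move=> x; rewrite in_itv/= => /andP[ax _]; apply: cx; exact: le_lt_trans ax.
  - move: a0; rewrite le_eqVlt => /predU1P[<-|a0]; last by apply: cvg_at_right_filter; exact: cx.
    by rewrite powR0 ?gt_eqF//; exact: powR_cvg0.
  - by apply: cvg_at_left_filter; apply: cx; exact: le_lt_trans ab.
have [||c] := @MVT _ (fun y : R => y `^ p) (fun x => p * x `^ (p - 1)) a b ab.
- by move=> x; rewrite in_itv/= => /andP[ax _]; apply: is_derive1_powR; exact: le_lt_trans ax.
- exact: cab.
by rewrite in_itv/= => acb h; exists c.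
Qed.

(** Mean value theorem on both intervals, and the derivative beta c^(beta-1)
    decreases. *)
Lemma powR_concave_incr beta (x y z : R) : 0 < beta < 1 -> 0 <= x -> x < y -> y < z ->
  z - y <= y - x -> z `^ beta - y `^ beta <= y `^ beta - x `^ beta.
Proof.
move=> /andP[b0 b1] x0 xy yz zy.
have [c /andP[c1 c2] ->] := powR_MVT b0 (le_trans x0 (ltW xy)) yz.
have [d /andP[d1 d2] ->] := powR_MVT b0 x0 xy.
have d0 : 0 < d by exact: le_lt_trans d1.
have dc : d < c by exact: lt_trans c1.
apply: ler_pM => //; first by rewrite mulr_ge0 ?powR_ge0// ltW.
  by rewrite subr_ge0 ltW.
apply: ler_wpM2l; first exact: ltW.
rewrite -(opprB 1 beta) !powRN lef_pV2 ?posrE ?powR_gt0//; last exact: lt_trans dc.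
apply: ge0_ler_powR; rewrite ?nnegrE ?subr_ge0 ?(ltW b1) ?(ltW d0) ?(ltW dc)//.
by rewrite ltW// (lt_trans d0).
Qed.

End PowerMVT.

Section MeshGrading.
Context {R : realType}.
Variables (T r : R) (M : nat).
Hypotheses (T_gt0 : 0 < T) (r_ge1 : 1 <= r) (M_gt0 : (0 < M)%N).
Local Notation t := (tnode T r M).
Local Notation tau := (tau T r M).
Let MR : 0 < M%:R :> R. Proof. by rewrite ltr0n. Qed.

Lemma tau_MVT k : exists2 c : R, k%:R / M%:R < c < k.+1%:R / M%:R &
  tau k.+1 = T * r * c `^ (r - 1) / M%:R.
Proof.
have r0 : 0 < r by exact: lt_le_trans r_ge1.
have k0 : 0 <= k%:R / M%:R :> R by rewrite divr_ge0.
have kk : k%:R / M%:R < k.+1%:R / M%:R :> R by rewrite ltr_pM2r ?invr_gt0// ltr_nat.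
have [c cI h] := powR_MVT r0 k0 kk; exists c => //.
rewrite /tau /tnode /= -mulrBr h -natr1; field; exact: lt0r_neq0.
Qed.

(** The function x^r is convex for 1 <= r. *)
Lemma tau_mono k : (0 < k)%N -> tau k <= tau k.+1.
Proof.
case: k => // k _.
have [c /andP[c1 c2] ->] := tau_MVT k; have [d /andP[d1 d2] ->] := tau_MVT k.+1.
have r0 : 0 < r by exact: lt_le_trans r_ge1.
have c0 : 0 < c by apply: le_lt_trans c1; rewrite divr_ge0.
have cd : c < d by exact: lt_trans d1.
rewrite ler_pM2r ?invr_gt0// ler_pM2l ?mulr_gt0//.
by apply: ge0_ler_powR; rewrite ?nnegrE ?subr_ge0 ?(ltW c0) ?(ltW cd) ?(ltW (lt_trans c0 cd)).
Qed.

Lemma taumax_le : taumax T r M <= T * r / M%:R.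
Proof.
have r0 : 0 < r by exact: lt_le_trans r_ge1.
rewrite /taumax big_seq; apply: bigmax_le; first by rewrite divr_ge0// mulr_ge0// ltW.
move=> [|k]; rewrite mem_index_iota//= ltnS => kM.
have [c /andP[c1 c2] ->] := tau_MVT k.
have c0 : 0 < c by apply: le_lt_trans c1; rewrite divr_ge0.
have cl : c <= 1.
  by apply: le_trans (ltW c2) _; rewrite ler_pdivrMr// mul1r ler_nat.
rewrite ler_pM2r ?invr_gt0//; apply: ler_piMr; first by rewrite mulr_ge0// ltW.
rewrite -[leRHS](powRr0 c); apply: ger_powR; first by rewrite c0.
by rewrite subr_ge0.
Qed.

End MeshGrading.

(** * A Gronwall inequality for weakly singular kernels *)

Section Gronwall.
Context {R : realType}.
Variables (T r : R) (M : nat).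
Hypotheses (T_gt0 : 0 < T) (r_ge1 : 1 <= r) (M_gt0 : (0 < M)%N).
Local Notation t := (tnode T r M).
Local Notation tau := (tau T r M).

(** Phi applied to the lags t_k - t_j; for Phi = x^(1-alpha) this is the weight
    d_(k,j) times tau_j. *)
Definition incr (Phi : R -> R) k j := Phi (t k - t j.-1) - Phi (t k - t j).

(** Cells within distance delta of t_k carry total mass at most Phi delta, and for
    the other ones the weight exp(lambda t_j) is smaller than exp(lambda t_k) by the
    factor exp(- lambda delta).  A cell with right end t_j within delta of t_k need
    not lie in the delta window itself; replacing its mass by that of the next cell,
    which is at least as large, repairs this for every mesh size. *)
Lemma incr_exp_sum (Phi : R -> R) delta lambda k :
  Phi 0 = 0 -> (forall x y, 0 <= x -> x <= y -> Phi x <= Phi y) ->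
  0 <= delta -> 0 <= lambda -> (k <= M)%N ->
  (forall j, (1 <= j < k)%N -> incr Phi k j <= incr Phi k j.+1) ->
  \sum_(1 <= j < k) incr Phi k j * expR (lambda * t j) <=
  (Phi delta + Phi T * expR (- (lambda * delta))) * expR (lambda * t k).
Proof.
move=> Phi0 PhiM d0 l0 kM mono.
have Phi_ge0 x : 0 <= x -> 0 <= Phi x by move=> x0; rewrite -Phi0; apply: PhiM.
have tk i j : (i <= j)%N -> t i <= t j := @tnode_le _ T r M T_gt0 r_ge1 M_gt0 i j.
have /andP[tk0 tkT] := tnode_itv T_gt0 r_ge1 M_gt0 kM.
(* Truncation at delta, so that the near cells telescope to Psi <= Phi delta. *)
pose Psi x := Phi (Num.min x delta).
have PsiM x y : 0 <= x -> x <= y -> Psi x <= Psi y.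
  move=> x0 xy; apply: PhiM; first by rewrite le_min x0.
  by rewrite le_min !ge_min xy lexx orbT.
pose E := expR (lambda * t k).
have E0 : 0 < E by exact: expR_gt0.
have term j : (1 <= j < k)%N -> incr Phi k j * expR (lambda * t j) <=
    E * incr Psi k j.+1 + E * expR (- (lambda * delta)) * incr Phi k j.+1.
  move=> jk; have /andP[j1 jk'] := jk.
  have p1 : 0 <= t k - t j.+1 by rewrite subr_ge0 tk.
  have p2 : t k - t j.+1 <= t k - t j by rewrite lerD2l lerN2 tk.
  have i0 : 0 <= incr Phi k j.+1 by rewrite /incr subr_ge0 PhiM.
  have s0 : 0 <= incr Psi k j.+1 by rewrite /incr subr_ge0 PsiM.
  apply: le_trans (_ : incr Phi k j.+1 * expR (lambda * t j) <= _).
    by rewrite ler_wpM2r ?expR_ge0// mono.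
  have [near|far] := leP (t k - t j) delta.
    have -> : incr Psi k j.+1 = incr Phi k j.+1.
      by rewrite /incr /Psi !min_l// (le_trans p2).
    apply: le_trans (_ : E * incr Phi k j.+1 <= _).
      rewrite mulrC ler_wpM2r// ler_expR ler_wpM2l// tk//; exact: ltnW.
    by rewrite lerDl mulr_ge0// mulr_ge0 ?expR_ge0// ltW.
  apply: le_trans (_ : E * expR (- (lambda * delta)) * incr Phi k j.+1 <= _).
    rewrite mulrC ler_wpM2r// /E -expRD ler_expR -mulrN -mulrDr ler_wpM2l//.
    by rewrite lerBrDr -lerBrDl ltW.
  by rewrite lerDr mulr_ge0// ltW.
have [k1|k1] := ltnP 0 k; last first.
  rewrite big_geq; last by rewrite (leq_trans k1).
  rewrite mulr_ge0 ?(ltW E0)// addr_ge0 ?Phi_ge0//.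
  by rewrite mulr_ge0 ?expR_ge0// Phi_ge0// ltW.
have tel F : \sum_(1 <= j < k) incr F k j.+1 = F (t k - t 1%N) - F 0.
  rewrite [LHS](eq_bigr (fun j => - F (t k - t j.+1) - - F (t k - t j))); last first.
    by move=> j _; rewrite /incr /= opprK addrC.
  by rewrite (telescope_sumr (fun j => - F (t k - t j)))// subrr opprK addrC.
apply: le_trans (ler_sum_nat term) _.
rewrite big_split /= -!mulr_sumr !tel.
have t1 : 0 <= t k - t 1%N by rewrite subr_ge0 tk.
have Psi0 : Psi 0 = 0 by rewrite /Psi min_l.
rewrite Phi0 Psi0 !subr0 mulrDl [Phi delta * _]mulrC; apply: lerD.
  rewrite ler_pM2l//; apply: PhiM; first by rewrite le_min t1.
  by rewrite ge_min lexx orbT.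
rewrite -/E mulrC -mulrA [expR _ * E]mulrC ler_wpM2r ?mulr_ge0 ?expR_ge0 ?(ltW E0)//.
apply: PhiM => //; apply: le_trans tkT; rewrite gerBl.
by rewrite -(tnode0 T M r_ge1) tk.
Qed.

End Gronwall.

Section DiscreteGronwall.
Context {R : realType}.
Variables (alpha T P Q : R).
Hypotheses (alpha01 : 0 < alpha < 1) (T_gt0 : 0 < T) (P_ge0 : 0 <= P) (Q_ge0 : 0 <= Q).

(** First delta is chosen so small that the undamped terms are at most 1/8 each, then
    lambda so large that Y exp(- lambda delta) is at most 1/4. *)
Lemma small_large : exists delta lambda : R, [/\ 0 <= delta, 0 <= lambda &
  P * (delta `^ (1 - alpha) + T `^ (1 - alpha) * expR (- (lambda * delta)))
  + Q * (delta + T * expR (- (lambda * delta))) <= 2^-1].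
Proof.
have /andP[a0 a1] := alpha01.
have b0 : 0 < 1 - alpha by rewrite subr_gt0.
have P1 : 0 < 8 * (P + 1) by rewrite mulr_gt0// ltr_wpDl.
have Q1 : 0 < 8 * (Q + 1) by rewrite mulr_gt0// ltr_wpDl.
pose p := ((8 * (P + 1))^-1) `^ ((1 - alpha)^-1).
pose delta := Num.min p (8 * (Q + 1))^-1.
have p0 : 0 < p by rewrite powR_gt0// invr_gt0.
have d0 : 0 < delta by rewrite lt_min p0 invr_gt0.
pose Y := P * T `^ (1 - alpha) + Q * T.
have Y0 : 0 <= Y by rewrite addr_ge0// mulr_ge0 ?powR_ge0// ltW.
exists delta, (4 * Y / delta); split; [exact: ltW|by rewrite divr_ge0 ?mulr_ge0// ltW|].
rewrite divfK ?gt_eqF//.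
(* With lambda delta = 4 Y this is 1 + 4 Y <= exp(4 Y). *)
have e1 : Y * expR (- (4 * Y)) <= 4^-1.
  have h : 1 + 4 * Y <= expR (4 * Y) by exact: expR_ge1Dx.
  rewrite expRN ler_pdivrMr ?expR_gt0//.
  by apply: le_trans (ler_wpM2l _ h); [lra|rewrite invr_ge0].
have e2 : P * delta `^ (1 - alpha) <= 8^-1.
  have h : delta `^ (1 - alpha) <= (8 * (P + 1))^-1.
    apply: le_trans (_ : p `^ (1 - alpha) <= _).
      apply: ge0_ler_powR; rewrite ?nnegrE ?(ltW b0) ?(ltW d0) ?(ltW p0)//.
      by rewrite ge_min lexx.
    by rewrite /p -powRrM mulVf ?gt_eqF// powRr1// invr_ge0 ltW.
  apply: le_trans (ler_wpM2l P_ge0 h) _.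
  rewrite ler_pdivrMr// mulrA mulVf// mul1r; lra.
have e3 : Q * delta <= 8^-1.
  have h : delta <= (8 * (Q + 1))^-1 by rewrite ge_min lexx orbT.
  apply: le_trans (ler_wpM2l Q_ge0 h) _.
  rewrite ler_pdivrMr// mulrA mulVf// mul1r; lra.
apply: le_trans (_ : P * delta `^ (1 - alpha) + Q * delta + Y * expR (- (4 * Y)) <= _); last lra.
by rewrite le_eqVlt; apply/orP; left; apply/eqP; rewrite {3}/Y; ring.
Qed.

(** Strong induction on a_k <= 2 B exp(lambda t_k): with delta and lambda from
    [small_large] the sum contributes at most half of this bound, so the constant
    depends neither on the mesh nor on r. *)
Lemma discrete_gronwall : exists2 C : R, 0 < C & forall (r : R) (M : nat) (a : nat -> R) (B : R),
  1 <= r -> (0 < M)%N -> 0 <= B ->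
  (forall k, (1 <= k <= M)%N -> 0 <= a k /\
     a k <= B + \sum_(1 <= j < k)
       (P * incr T r M (fun x => x `^ (1 - alpha)) k j + Q * incr T r M id k j) * a j) ->
  forall k, (1 <= k <= M)%N -> a k <= C * B.
Proof.
have /andP[a0 a1] := alpha01.
have b0 : 0 < 1 - alpha by rewrite subr_gt0.
have b01 : 0 < 1 - alpha < 1 by apply/andP; split; lra.
have [delta [lambda [d0 l0 small]]] := small_large.
exists (2 * expR (lambda * T)); first by rewrite mulr_gt0 ?expR_gt0.
move=> r M a B r1 M0 B0 aB.
pose t := tnode T r M.
pose A := incr T r M (fun x => x `^ (1 - alpha)).
pose D := incr T r M id.
have tk i j : (i <= j)%N -> t i <= t j := @tnode_le _ T r M T_gt0 r1 M0 i j.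
have tlt i j : (i < j)%N -> t i < t j := @tnode_lt _ T r M T_gt0 r1 M0 i j.
have A0 k j : (j <= k)%N -> 0 <= A k j.
  move=> jk; have h1 : 0 <= t k - t j by rewrite subr_ge0 tk.
  have h2 : t k - t j <= t k - t j.-1 by rewrite lerD2l lerN2 tk// leq_pred.
  rewrite /A /incr subr_ge0; apply: ge0_ler_powR => //; rewrite ?nnegrE//; first exact: ltW.
  exact: le_trans h2.
have D0 k j : 0 <= D k j by rewrite /D /incr subr_ge0 lerD2l lerN2 tk// leq_pred.
have Dm k j : (1 <= j < k)%N -> D k j <= D k j.+1.
  case: j => // j _; have := tau_mono T_gt0 r1 M0 (ltn0Sn j).
  rewrite /D /incr /tau /= -/t; lra.
have Am k j : (1 <= j < k)%N -> A k j <= A k j.+1.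
  move=> /andP[]; case: j => [h0|j _ jk]; first by exfalso; rewrite ltnn in h0.
  have h : t j.+1 - t j <= t j.+2 - t j.+1 := tau_mono T_gt0 r1 M0 (ltn0Sn j).
  rewrite /A /incr /= -/t; apply: powR_concave_incr => //.
  - by rewrite subr_ge0 tk.
  - by rewrite ltrD2l ltrN2 tlt.
  - by rewrite ltrD2l ltrN2 tlt.
  - lra.
have E0 s : 0 < expR (lambda * s) by exact: expR_gt0.
suff H k : (1 <= k <= M)%N -> a k <= 2 * B * expR (lambda * t k).
  move=> k kM; apply: le_trans (H k kM) _.
  rewrite mulrAC ler_wpM2r// ler_pM2l// ler_expR ler_wpM2l//.
  by have /andP[_ ?] := kM; have /andP[] := @tnode_itv _ T r M T_gt0 r1 M0 k (proj2 (andP kM)).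
elim/ltn_ind: k => k IH kM; have [_ h] := aB k kM; apply: le_trans h _.
have /andP[k1 kM'] := kM.
have sA : \sum_(1 <= j < k) A k j * expR (lambda * t j) <=
    (delta `^ (1 - alpha) + T `^ (1 - alpha) * expR (- (lambda * delta))) * expR (lambda * t k).
  have p0 : (fun x : R => x `^ (1 - alpha)) 0 = 0 by rewrite powR0// gt_eqF.
  have pM (x y : R) : 0 <= x -> x <= y ->
      (fun x : R => x `^ (1 - alpha)) x <= (fun x : R => x `^ (1 - alpha)) y.
    move=> x0 xy; apply: ge0_ler_powR => //; rewrite ?nnegrE//; first exact: ltW.
    exact: le_trans xy.
  exact: (@incr_exp_sum _ T r M T_gt0 r1 M0 _ delta lambda k p0 pM d0 l0 kM' (Am k)).
have sD : \sum_(1 <= j < k) D k j * expR (lambda * t j) <=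
    (delta + T * expR (- (lambda * delta))) * expR (lambda * t k).
  exact: (@incr_exp_sum _ T r M T_gt0 r1 M0 id delta lambda k erefl (fun _ _ _ xy => xy) d0 l0 kM' (Dm k)).
have bnd : \sum_(1 <= j < k) (P * A k j + Q * D k j) * a j <=
   2 * B * (P * (\sum_(1 <= j < k) A k j * expR (lambda * t j)) +
            Q * (\sum_(1 <= j < k) D k j * expR (lambda * t j))).
  rewrite !mulr_sumr -big_split /= mulr_sumr; apply: ler_sum_nat => j /andP[j1 jk].
  have jM : (1 <= j <= M)%N by rewrite j1 (leq_trans (ltnW jk)).
  have c0 : 0 <= P * A k j + Q * D k j by rewrite addr_ge0 ?mulr_ge0 ?A0 ?D0// ltnW.
  apply: le_trans (ler_wpM2l c0 (IH j jk jM)) _.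
  by rewrite le_eqVlt; apply/orP; left; apply/eqP; ring.
have key : P * (\sum_(1 <= j < k) A k j * expR (lambda * t j)) +
            Q * (\sum_(1 <= j < k) D k j * expR (lambda * t j)) <= 2^-1 * expR (lambda * t k).
  apply: le_trans (lerD (ler_wpM2l P_ge0 sA) (ler_wpM2l Q_ge0 sD)) _.
  by rewrite !mulrA -mulrDl ler_wpM2r// ltW.
have B2 : 0 <= 2 * B by rewrite mulr_ge0.
have h := le_trans bnd (ler_wpM2l B2 key).
apply: le_trans (lerD (lexx B) h) _.
have e1 : 1 <= expR (lambda * t k).
  rewrite -expR0 ler_expR mulr_ge0//.
  by have /andP[] := @tnode_itv _ T r M T_gt0 r1 M0 k kM'.
have -> : 2 * B * (2^-1 * expR (lambda * t k)) = B * expR (lambda * t k) by field.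
have -> : 2 * B * expR (lambda * t k) = B * expR (lambda * t k) + B * expR (lambda * t k) by ring.
by rewrite lerD2r ler_peMr.
Qed.

End DiscreteGronwall.

(** * Discrete norms *)

Section CauchySchwarz.
Context {R : realType}.

Lemma sum_cauchy_schwarz n (a b : 'I_n -> R) :
  \sum_(i < n) a i * b i <=
  Num.sqrt (\sum_(i < n) a i ^+ 2) * Num.sqrt (\sum_(i < n) b i ^+ 2).
Proof.
set A := \sum_(i < n) a i ^+ 2; set B := \sum_(i < n) b i ^+ 2.
have A0 : 0 <= A by apply: sumr_ge0 => i _; exact: sqr_ge0.
have B0 : 0 <= B by apply: sumr_ge0 => i _; exact: sqr_ge0.
have degenerate (c d : 'I_n -> R) : \sum_(i < n) c i ^+ 2 = 0 -> \sum_(i < n) c i * d i = 0.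
  move=> /eqP; rewrite psumr_eq0; last by move=> i _; exact: sqr_ge0.
  move=> /allP c0; rewrite big1// => i _; have := c0 i (mem_index_enum _).
  by rewrite /= sqrf_eq0 => /eqP ->; rewrite mul0r.
set p := Num.sqrt A; set q := Num.sqrt B.
have p0 : 0 <= p by exact: sqrtr_ge0.
have q0 : 0 <= q by exact: sqrtr_ge0.
have [Ae|An] := eqVneq A 0; first by rewrite (degenerate _ _ Ae) mulr_ge0.
have [Be|Bn] := eqVneq B 0.
  under eq_bigr do rewrite mulrC.
  by rewrite (degenerate _ _ Be) mulr_ge0.
have pp : 0 < p by rewrite sqrtr_gt0 lt_neqAle eq_sym An.
have qq : 0 < q by rewrite sqrtr_gt0 lt_neqAle eq_sym Bn.
have : 0 <= \sum_(i < n) (q * a i - p * b i) ^+ 2 by apply: sumr_ge0 => i _; exact: sqr_ge0.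
have -> : \sum_(i < n) (q * a i - p * b i) ^+ 2 =
  q ^+ 2 * A + p ^+ 2 * B - 2 * (p * q) * \sum_(i < n) a i * b i.
  rewrite /A /B !mulr_sumr -big_split -sumrB /=; apply: eq_bigr => i _; ring.
rewrite -[A](sqr_sqrtr A0) -[B](sqr_sqrtr B0) -/p -/q.
have pq : 0 < p * q by rewrite mulr_gt0.
have -> : q ^+ 2 * p ^+ 2 + p ^+ 2 * q ^+ 2 - 2 * (p * q) * \sum_(i < n) a i * b i =
  2 * (p * q) * (p * q - \sum_(i < n) a i * b i) by ring.
by rewrite pmulr_rge0 ?subr_ge0// mulr_gt0.
Qed.

Lemma norm_sum_cauchy_schwarz n (a b : 'I_n -> R) :
  `|\sum_(i < n) a i * b i| <=
  Num.sqrt (\sum_(i < n) a i ^+ 2) * Num.sqrt (\sum_(i < n) b i ^+ 2).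
Proof.
rewrite ler_norml sum_cauchy_schwarz andbT lerNl -sumrN.
have := sum_cauchy_schwarz (fun i => - a i) b.
under eq_bigr do rewrite mulNr.
by under [X in _ <= Num.sqrt X * _ -> _]eq_bigr do rewrite sqrrN.
Qed.

End CauchySchwarz.

Section DiscreteNorms.
Context {R : realType}.
Variables (l : R) (n : nat).
Hypothesis l_gt0 : 0 < l.
Local Notation N := n.+1.
Local Notation h := (hstep l N).
Implicit Types v w : 'cV[R]_n.
Local Notation ext := (@vext R N).

Lemma hstep_gt0 : 0 < h.
Proof. by rewrite /hstep divr_gt0// ltr0n. Qed.
Let h0 := hstep_gt0.

(** Indexed by all N cells, with the zero boundary values included. *)
Definition dif v (i : 'I_N) : R := ext v i.+1 - ext v i.

Lemma ext_ord v (i : 'I_n) : ext v i.+1 = v i 0.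
Proof. by rewrite /= insubT //= => lt; congr (v _ _); apply: val_inj. Qed.

Lemma ext_last v : ext v N = 0.
Proof. by rewrite /= insubF// ltnn. Qed.

Lemma extD v w i : ext (v + w) i = ext v i + ext w i.
Proof. by case: i => [|j] /=; [rewrite addr0|case: insubP => [k _ _|_] /=; rewrite ?mxE ?addr0]. Qed.

Lemma extZ c v i : ext (c *: v) i = c * ext v i.
Proof. by case: i => [|j] /=; [rewrite mulr0|case: insubP => [k _ _|_] /=; rewrite ?mxE ?mulr0]. Qed.

Lemma LhD v w : Lh l (v + w : 'cV_N.-1) = Lh l (v : 'cV_N.-1) + Lh l (w : 'cV_N.-1).
Proof. by apply/colP => i; rewrite !mxE !extD; ring. Qed.

Lemma LhZ c v : Lh l (c *: v : 'cV_N.-1) = c *: Lh l (v : 'cV_N.-1).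
Proof. by apply/colP => i; rewrite !mxE !extZ; ring. Qed.

(** Summation by parts; the boundary values are 0. *)
Lemma ipr_Lh v w : ipr l (- Lh l (v : 'cV_N.-1)) w = h^-1 * \sum_(i < N) dif v i * dif w i.
Proof.
have hn : h != 0 by rewrite gt_eqF.
have e : \sum_(i < N) dif v i * dif w i =
    \sum_(i < n) (ext v i.+1 - ext v i) * ext w i.+1 - \sum_(i < n) (ext v i.+2 - ext v i.+1) * ext w i.+1.
  rewrite /dif; under eq_bigr do rewrite mulrBr; rewrite sumrB; congr (_ - _).
    by rewrite big_ord_recr /= -/(ext w N) ext_last mulr0 addr0.
  by rewrite big_ord_recl /= mulr0 add0r; apply: eq_bigr => i _; rewrite /bump /= add1n.
rewrite e /ipr -sumrB !mulr_sumr; apply: eq_bigr => i _.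
rewrite !mxE -/(ext v i) -/(ext v i.+1) -/(ext v i.+2) -ext_ord; field.
exact: hn.
Qed.

Lemma gradnorm_ge0 v : 0 <= gradnorm l (v : 'cV_N.-1).
Proof. exact: sqrtr_ge0. Qed.

Lemma gradnorm_sqr v : gradnorm l (v : 'cV_N.-1) ^+ 2 = ipr l (- Lh l (v : 'cV_N.-1)) v.
Proof.
rewrite /gradnorm sqr_sqrtr// ipr_Lh mulr_ge0 ?invr_ge0 ?(ltW h0)//.
by apply: sumr_ge0 => i _; rewrite -expr2 sqr_ge0.
Qed.

Lemma grad_cauchy_schwarz v w :
  `|ipr l (- Lh l (v : 'cV_N.-1)) w| <= gradnorm l (v : 'cV_N.-1) * gradnorm l (w : 'cV_N.-1).
Proof.
rewrite /gradnorm !ipr_Lh.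
have e u : \sum_(i < N) dif u i * dif u i = \sum_(i < N) dif u i ^+ 2.
  by apply: eq_bigr => i _; rewrite expr2.
rewrite !e !sqrtrM ?invr_ge0 ?(ltW h0)// mulrACA -expr2 sqr_sqrtr ?invr_ge0 ?(ltW h0)//.
rewrite normrM ger0_norm ?invr_ge0 ?(ltW h0)// ler_pM2l ?invr_gt0//.
exact: norm_sum_cauchy_schwarz.
Qed.

(** The value at a node is a sum of differences from the boundary, and
    Cauchy-Schwarz over the N cells costs the factor sqrt (N h) = sqrt l. *)
Lemma sup_gradnorm v (i : 'I_n) : `|v i 0| <= Num.sqrt l * gradnorm l (v : 'cV_N.-1).
Proof.
have abs : `|v i 0| <= \sum_(j < N) `|dif v j| * 1.
  have iN : (i.+1 <= N)%N by rewrite ltnS ltnW.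
  have -> : v i 0 = \sum_(0 <= j < i.+1) (ext v j.+1 - ext v j).
    by rewrite telescope_sumr// subr0 ext_ord.
  apply: le_trans (ler_norm_sum _ _ _) _.
  rewrite (eq_bigr (fun j : 'I_N => `|ext v j.+1 - ext v j|)); last by move=> j _; rewrite mulr1.
  rewrite -(big_mkord xpredT (fun j => `|ext v j.+1 - ext v j|)).
  by rewrite (big_cat_nat (leq0n i.+1) iN) /= lerDl sumr_ge0.
apply: le_trans abs _; apply: le_trans (sum_cauchy_schwarz _ _) _.
have -> : \sum_(j < N) (1:R) ^+ 2 = N%:R.
  by rewrite (eq_bigr (fun=> 1)) ?sumr_const ?card_ord// => j _; rewrite expr1n.
have -> : \sum_(j < N) `|dif v j| ^+ 2 = h * (gradnorm l (v : 'cV_N.-1) ^+ 2).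
  rewrite gradnorm_sqr ipr_Lh mulrA divff ?gt_eqF// mul1r.
  by apply: eq_bigr => j _; rewrite real_normK ?num_real// expr2.
rewrite -sqrtrM; last by rewrite mulr_ge0 ?sqr_ge0 ?(ltW h0).
have -> : h * gradnorm l (v : 'cV_N.-1) ^+ 2 * N%:R = l * gradnorm l (v : 'cV_N.-1) ^+ 2.
  by rewrite mulrAC /hstep divfK// pnatr_eq0.
rewrite (sqrtrM _ (ltW l_gt0)) sqrtr_sqr ger0_norm//; exact: gradnorm_ge0.
Qed.

Definition l1norm v : R := h * \sum_(i < n) `|v i 0|.

(** Lets a residual that is small only in L^1 act on the error. *)
Lemma ipr_l1 v w : `|ipr l (v : 'cV_N.-1) w| <= l1norm v * (Num.sqrt l * gradnorm l (w : 'cV_N.-1)).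
Proof.
rewrite /ipr /l1norm normrM (ger0_norm (ltW h0)) -mulrA ler_pM2l//.
apply: le_trans (ler_norm_sum _ _ _) _; rewrite mulr_suml; apply: ler_sum => i _.
by rewrite normrM ler_wpM2l// sup_gradnorm.
Qed.

Lemma l1_gradnorm v : l1norm v <= l * (Num.sqrt l * gradnorm l (v : 'cV_N.-1)).
Proof.
rewrite /l1norm.
apply: le_trans (_ : h * (\sum_(i < n) Num.sqrt l * gradnorm l (v : 'cV_N.-1)) <= _).
  by rewrite ler_pM2l//; apply: ler_sum => i _; exact: sup_gradnorm.
rewrite sumr_const card_ord; set X := Num.sqrt l * _.
have X0 : 0 <= X by rewrite mulr_ge0 ?sqrtr_ge0.
have -> : h * (X *+ n) = h * n%:R * X by rewrite -mulr_natl mulrA.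
apply: ler_wpM2r => //.
by rewrite /hstep -mulrA ger_pMr// mulrC ler_pdivrMr ?ltr0n// mul1r ler_nat.
Qed.

Lemma ipr_gradnorm v w :
  `|ipr l (v : 'cV_N.-1) w| <= l ^+ 2 * (gradnorm l (v : 'cV_N.-1) * gradnorm l (w : 'cV_N.-1)).
Proof.
have g := gradnorm_ge0 w; have sl := sqrtr_ge0 l.
apply: le_trans (ipr_l1 v w) _.
apply: le_trans (ler_wpM2r _ (l1_gradnorm v)) _; first by rewrite mulr_ge0.
rewrite le_eqVlt; apply/orP; left; apply/eqP.
have e := sqr_sqrtr (ltW l_gt0).
transitivity (l * Num.sqrt l ^+ 2 *
  (gradnorm l (v : 'cV_N.-1) * gradnorm l (w : 'cV_N.-1))); first by ring.
by rewrite e expr2.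
Qed.

(** The discrete Poincare inequality. *)
Lemma hnorm_gradnorm v : hnorm l (v : 'cV_N.-1) <= l * gradnorm l (v : 'cV_N.-1).
Proof.
have lg : 0 <= l * gradnorm l (v : 'cV_N.-1) by rewrite mulr_ge0 ?(ltW l_gt0) ?gradnorm_ge0.
rewrite -(ger0_norm lg) -sqrtr_sqr /hnorm; apply: ler_wsqrtr.
apply: le_trans (ler_norm _) _; apply: le_trans (ipr_gradnorm v v) _.
by rewrite exprMn expr2.
Qed.

End DiscreteNorms.

(** * Stability of the scheme *)

Section Stability.
Context {R : realType}.

(** Passes from the weighted history of the scheme to the L1 formula in the
    increments. *)
Lemma abel_sum m (d : nat -> R) (e : nat -> 'cV[R]_m) k : (1 <= k)%N ->
  \sum_(1 <= j < k.+1) d j *: (e j - e j.-1) =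
  d k *: e k - (d 1%N *: e 0%N + \sum_(1 <= j < k) (d j.+1 - d j) *: e j).
Proof.
case: k => // k _; elim: k => [|k IH].
  by rewrite big_nat1 /= scalerBr big_geq// addr0.
rewrite big_nat_recr//= IH [in RHS]big_nat_recr//= scalerBr scalerBl.
set X := \sum_(1 <= j < k.+1) _.
move: (_ *: e k.+1) (_ *: e 0%N) X (_ *: e k.+2) (_ *: e k.+1) => x1 x2 x3 x4 x5.
by apply/colP => i; rewrite !mxE; ring.
Qed.

Variables (l : R) (n : nat).
Hypothesis l_gt0 : 0 < l.
Local Notation N := n.+1.
Implicit Types v w : 'cV[R]_N.-1.

Lemma iprDl v w u : ipr l (v + w) u = ipr l v u + ipr l w u.
Proof.
rewrite /ipr -mulrDr -big_split /=; congr (_ * _); apply: eq_bigr => i _.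
by rewrite mxE mulrDl.
Qed.

Lemma iprZl c v u : ipr l (c *: v) u = c * ipr l v u.
Proof.
rewrite /ipr [RHS]mulrCA; congr (_ * _); rewrite mulr_sumr; apply: eq_bigr => i _.
by rewrite mxE mulrA.
Qed.

Lemma ipr_suml (s : seq nat) (F : nat -> 'cV[R]_N.-1) u :
  ipr l (\sum_(j <- s) F j) u = \sum_(j <- s) ipr l (F j) u.
Proof.
elim: s => [|j s IH]; last by rewrite !big_cons iprDl IH.
by rewrite !big_nil -(scale0r 0) iprZl mul0r.
Qed.

Lemma LhN v : Lh l (- v) = - Lh l v.
Proof. by rewrite -scaleN1r -[RHS]scaleN1r; exact: (@LhZ R l n (-1) v). Qed.

Lemma Lh0 : Lh l (0 : 'cV[R]_N.-1) = 0.
Proof. by have := @LhZ R l n 0 0; rewrite !scale0r. Qed.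

Lemma ipr_Lh_sum (s : seq nat) (F : nat -> 'cV[R]_N.-1) u :
  ipr l (- Lh l (\sum_(j <- s) F j)) u = \sum_(j <- s) ipr l (- Lh l (F j)) u.
Proof.
rewrite -ipr_suml; congr ipr; elim: s => [|j s IH]; first by rewrite !big_nil Lh0 oppr0.
by rewrite !big_cons -IH -opprD; congr (- _); exact: LhD.
Qed.

Variables (alpha T mu0 : R).
Hypotheses (alpha01 : 0 < alpha < 1) (T_gt0 : 0 < T) (mu0_gt0 : 0 < mu0).

(** The error equation, rewritten for the increments E^j = e^j - e^(j-1), is paired
    with E^k.  The terms d_(k,k) |E^k|^2 and |grad E^k|^2 on the diagonal have the
    good sign and are dropped, the off-diagonal ones are bounded by Cauchy-Schwarz,
    and one factor b k is cancelled. *)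
Lemma energy_step (r : R) (M : nat) (muk : nat -> R) (e rho : nat -> 'cV[R]_N.-1) (B : R) k :
  1 <= r -> (0 < M)%N -> (1 <= k <= M)%N -> mu0 <= muk k -> e 0%N = 0 ->
  l1norm l (rho k : 'cV_n) <= B ->
  let d := dcoef T r M alpha in let G : R := Gamma (2 - alpha) in let tauk := tau T r M in
  (d k k / G) *: e k - (1 + muk k / tauk k) *: Lh l (e k) =
    ((d k 1%N / G) *: e 0%N + G^-1 *: \sum_(1 <= j < k) (d k j.+1 - d k j) *: e j)
    + rho k - (muk k / tauk k) *: Lh l (e k.-1) ->
  let b j := gradnorm l (e j - e j.-1) in
  is_true (mu0 / tauk k * b k <= Num.sqrt l * B + \sum_(1 <= j < k) (G^-1 * l ^+ 2 * d k j + 1) * b j).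
Proof.
move=> r1 M0 kM muk0 e0 rhoB d G tauk eqn b.
have /andP[k1 kM'] := kM.
pose E j := e j - e j.-1.
have tk0 : 0 < tauk k by exact: (tau_gt0 T_gt0 r1 M0 k1).
have G0 : 0 <= G^-1 by rewrite invr_ge0 Gamma_ge0.
have sumE : e k = \sum_(1 <= j < k.+1) E j.
  by rewrite big_add1 /= telescope_sumr// e0 subr0.
have eqn2 : rho k = G^-1 *: \sum_(1 <= j < k.+1) d k j *: E j - Lh l (e k) - (muk k / tauk k) *: Lh l (E k).
  rewrite (abel_sum (d k) e k1).
  have -> : Lh l (E k) = Lh l (e k) - Lh l (e k.-1).
    by rewrite /E [LHS](LhD l (e k : 'cV_n)) LhN.
  move: eqn; rewrite scalerDl scale1r => eqn.
  have -> : rho k = (d k k / G) *: e k - (Lh l (e k) + (muk k / tauk k) *: Lh l (e k)) -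
     ((d k 1%N / G) *: e 0%N + G^-1 *: \sum_(1 <= j < k) (d k j.+1 - d k j) *: e j) +
     (muk k / tauk k) *: Lh l (e k.-1).
    by rewrite eqn addrAC subrK addrAC subrr add0r.
  rewrite scalerBr scalerDr !scalerA [G^-1 * d k k]mulrC [G^-1 * d k 1%N]mulrC.
  rewrite [X in _ = _ - _ - X]scalerBr.
  move: (_ *: e k) (_ *: e 0%N) (G^-1 *: _) (Lh l (e k)) (_ *: Lh l (e k)) (_ *: Lh l (e k.-1)).
  move=> x1 x2 x3 x4 x5 x6; apply/colP => i; rewrite !mxE; ring.
have bE j : b j = gradnorm l (E j) by [].
have b0 j : 0 <= b j by exact: sqrtr_ge0.
have id1 : ipr l (rho k) (E k) =
  G^-1 * (\sum_(1 <= j < k) d k j * ipr l (E j) (E k) + d k k * ipr l (E k) (E k))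
  + (\sum_(1 <= j < k) ipr l (- Lh l (E j)) (E k) + b k ^+ 2)
  + muk k / tauk k * b k ^+ 2.
  rewrite eqn2 2!iprDl iprZl ipr_suml -scalerN iprZl; congr (_ * _ + _ + _ * _).
  - by rewrite big_nat_recr//= iprZl; congr (_ + _); apply: eq_bigr => j _; rewrite iprZl.
  - by rewrite {1}sumE ipr_Lh_sum big_nat_recr//= bE (gradnorm_sqr l_gt0).
  - by rewrite bE (gradnorm_sqr l_gt0).
have dk j : (1 <= j <= k)%N -> 0 <= d k j.
  move=> /andP[j1 jk]; rewrite /d /dcoef divr_ge0//; last first.
    exact: ltW (tau_gt0 T_gt0 r1 M0 j1).
  have /andP[_ a1] := alpha01.
  rewrite subr_ge0; apply: ge0_ler_powR; rewrite ?nnegrE ?subr_ge0 ?(ltW a1)//.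
  - exact: tnode_le.
  - by apply: tnode_le => //; exact: leq_trans (leq_pred _) jk.
  - by rewrite lerD2l lerN2; apply: tnode_le => //; exact: leq_pred.
have ikk : 0 <= ipr l (E k) (E k).
  rewrite /ipr mulr_ge0 ?(ltW (hstep_gt0 n l_gt0))//.
  by apply: sumr_ge0 => i _; rewrite -expr2 sqr_ge0.
have low1 : - (\sum_(1 <= j < k) d k j * (l ^+ 2 * (b j * b k))) <= \sum_(1 <= j < k) d k j * ipr l (E j) (E k).
  rewrite -sumrN; apply: ler_sum_nat => j /andP[j1 jk].
  rewrite -mulrN ler_wpM2l ?dk ?j1 ?(ltnW jk)//.
  have := ipr_gradnorm l_gt0 (E j : 'cV_n) (E k : 'cV_n).
  by rewrite ler_norml => /andP[].
have low2 : - (\sum_(1 <= j < k) b j * b k) <= \sum_(1 <= j < k) ipr l (- Lh l (E j)) (E k).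
  rewrite -sumrN; apply: ler_sum_nat => j _.
  have := grad_cauchy_schwarz l_gt0 (E j : 'cV_n) (E k : 'cV_n).
  by rewrite ler_norml => /andP[].
have up : ipr l (rho k) (E k) <= B * (Num.sqrt l * b k).
  apply: le_trans (ler_norm _) _; apply: le_trans (ipr_l1 l_gt0 _ _) _.
  by apply: ler_wpM2r => //; rewrite mulr_ge0 ?sqrtr_ge0.
have main : mu0 / tauk k * b k * b k <=
    (Num.sqrt l * B + \sum_(1 <= j < k) (G^-1 * l ^+ 2 * d k j + 1) * b j) * b k.
  have m0 : mu0 / tauk k * b k ^+ 2 <= muk k / tauk k * b k ^+ 2.
    by rewrite ler_wpM2r ?sqr_ge0// ler_wpM2r// invr_ge0 ltW.
  have gdk : 0 <= G^-1 * (d k k * ipr l (E k) (E k)).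
    by apply: mulr_ge0 => //; apply: mulr_ge0 => //; apply: dk; rewrite k1/=.
  have low1' := ler_wpM2l G0 low1.
  have bk2 := sqr_ge0 (b k).
  have -> : (Num.sqrt l * B + \sum_(1 <= j < k) (G^-1 * l ^+ 2 * d k j + 1) * b j) * b k =
     B * (Num.sqrt l * b k) - G^-1 * - (\sum_(1 <= j < k) d k j * (l ^+ 2 * (b j * b k)))
     - - (\sum_(1 <= j < k) b j * b k).
    rewrite mulrN !opprK mulr_sumr -addrA -big_split /= mulrDl; congr (_ + _); first by ring.
    by rewrite mulr_suml; apply: eq_bigr => j _; ring.
  rewrite -mulrA -expr2; move: id1 up; rewrite mulrDr; lra.
have [bk|bk] := eqVneq (b k) 0.
  rewrite bk mulr0 addr_ge0 ?mulr_ge0 ?sqrtr_ge0//.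
    apply: le_trans rhoB; rewrite /l1norm mulr_ge0 ?(ltW (hstep_gt0 n l_gt0))//.
    exact: sumr_ge0.
  rewrite big_nat; apply: sumr_ge0 => j /andP[j1 jk]; rewrite mulr_ge0// addr_ge0//.
  apply: mulr_ge0; first exact: mulr_ge0 G0 (sqr_ge0 l).
  by apply: dk; rewrite j1 ltnW.
by rewrite -(ler_pM2r (_ : 0 < b k))// lt_neqAle eq_sym bk b0.
Qed.

End Stability.

Section StabilityBound.
Context {R : realType}.
Variables (l alpha T mu0 : R).
Hypotheses (l_gt0 : 0 < l) (alpha01 : 0 < alpha < 1) (T_gt0 : 0 < T) (mu0_gt0 : 0 < mu0).

(** The inequality of [energy_step] divided by mu0, for a_k = b_k / tau_k, has the
    form required by [discrete_gronwall], since d_(k,j) tau_j is an increment of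
    x^(1-alpha) and tau_j one of x.  The gradient norm of e^k is at most the sum of
    the tau_j a_j. *)
Lemma stability : exists2 C : R, 0 < C &
  forall (r : R) (M n : nat) (muk : nat -> R) (e rho : nat -> 'cV[R]_n.+1.-1) (B : R),
  1 <= r -> (0 < M)%N -> 0 <= B -> e 0%N = 0 ->
  (forall k, (1 <= k <= M)%N -> mu0 <= muk k) ->
  (forall k, (1 <= k <= M)%N -> l1norm l (rho k : 'cV_n) <= B) ->
  (forall k, (1 <= k <= M)%N ->
    let d := dcoef T r M alpha in let G : R := Gamma (2 - alpha) in let tauk := tau T r M in
    (d k k / G) *: e k - (1 + muk k / tauk k) *: Lh l (e k) =
    ((d k 1%N / G) *: e 0%N + G^-1 *: \sum_(1 <= j < k) (d k j.+1 - d k j) *: e j)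
    + rho k - (muk k / tauk k) *: Lh l (e k.-1)) ->
  forall k, (k <= M)%N -> gradnorm l (e k) <= C * B.
Proof.
set G : R := Gamma (2 - alpha).
have G0 : 0 <= G^-1 by rewrite invr_ge0 Gamma_ge0.
have m1 : 0 <= mu0^-1 by rewrite invr_ge0 ltW.
have P0 : 0 <= G^-1 * l ^+ 2 / mu0 by rewrite mulr_ge0// mulr_ge0// sqr_ge0.
have [C C0 CP] := discrete_gronwall alpha01 T_gt0 P0 m1.
exists (T * (C * (Num.sqrt l / mu0))).
  by rewrite !mulr_gt0 ?sqrtr_gt0 ?invr_gt0.
move=> r M n muk e rho B r1 M0 B0 e0 muk0 rhoB eqn.
pose b j := gradnorm l (e j - e j.-1).
pose a j := b j / tau T r M j.
have b0 j : 0 <= b j by exact: sqrtr_ge0.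
have tau0 j : (0 < j)%N -> 0 < tau T r M j := @tau_gt0 _ T r M T_gt0 r1 M0 j.
have B1 : 0 <= Num.sqrt l / mu0 * B by rewrite mulr_ge0// mulr_ge0 ?sqrtr_ge0.
have ba j : (0 < j)%N -> b j = tau T r M j * a j.
  by move=> j0; rewrite /a mulrC divfK// gt_eqF// tau0.
have ak : forall k, (1 <= k <= M)%N -> a k <= C * (Num.sqrt l / mu0 * B).
  apply: (CP r M a) => // k kM; have /andP[k1 _] := kM.
  split; first by rewrite divr_ge0// ltW// tau0.
  have h := energy_step l_gt0 alpha01 T_gt0 r1 M0 kM (muk0 k kM) e0 (rhoB k kM) (eqn k kM).
  rewrite -(ler_pM2l mu0_gt0).
  have -> : mu0 * a k = mu0 / tau T r M k * b k by rewrite /a; ring.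
  apply: le_trans h _; rewrite le_eqVlt; apply/orP; left; apply/eqP.
  rewrite [RHS]mulrDr; congr (_ + _); first by field; exact: lt0r_neq0.
  rewrite mulr_sumr; apply: eq_big_nat => j /andP[j1 jk].
  have tj : tau T r M j != 0 by rewrite gt_eqF// tau0.
  rewrite -/(b j) ba// /incr /dcoef -/G /tau.
  have mu0n : mu0 != 0 by rewrite gt_eqF.
  have tj' : tnode T r M j - tnode T r M j.-1 != 0 by exact: tj.
  move: (_ `^ (1 - alpha)) (_ `^ (1 - alpha)) (a j) G^-1 => X Y z g.
  by move: (tnode T r M j) (tnode T r M j.-1) tj' => p q tj'; field; apply/andP.
move=> k kM.
have sumE : e k = \sum_(1 <= j < k.+1) (e j - e j.-1).
  by rewrite big_add1 /= telescope_sumr// e0 subr0.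
set g := gradnorm l (e k).
have g0 : 0 <= g by exact: sqrtr_ge0.
have hg : g * g <= (\sum_(1 <= j < k.+1) b j) * g.
  rewrite -expr2 /g (gradnorm_sqr l_gt0) {1}sumE ipr_Lh_sum mulr_suml.
  apply: ler_sum => j _; apply: le_trans (ler_norm _) _.
  exact: (grad_cauchy_schwarz l_gt0).
have hb : \sum_(1 <= j < k.+1) b j <= T * (C * (Num.sqrt l / mu0)) * B.
  apply: le_trans (_ : _ <= \sum_(1 <= j < k.+1) tau T r M j * (C * (Num.sqrt l / mu0 * B))) _.
    apply: ler_sum_nat => j /andP[j1 jk]; rewrite ba// ler_pM2l ?tau0//.
    by apply: ak; rewrite j1 /=; exact: leq_trans kM.
  rewrite -mulr_suml sum_tau//.
  have -> : T * (C * (Num.sqrt l / mu0)) * B = T * (C * (Num.sqrt l / mu0 * B)) by ring.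
  apply: ler_wpM2r; first by rewrite mulr_ge0// ltW.
  by have /andP[] := tnode_itv T_gt0 r1 M0 kM.
have [->|gn] := eqVneq g 0.
  by apply: le_trans hb; apply: sumr_ge0.
apply: le_trans hb; rewrite -(ler_pM2r (_ : 0 < g))//.
by rewrite lt_neqAle eq_sym gn.
Qed.

End StabilityBound.

(** * The consistency error of the scheme *)

Section Consistency.
Context {R : realType}.
Local Notation leb := (@lebesgue_measure R).
Variables (l T alpha mumax : R).
Variables (mu : R -> R) (u f : R -> R -> R).
Hypotheses (l_gt0 : 0 < l) (T_gt0 : 0 < T) (alpha01 : 0 < alpha < 1).
Variables (A B K : R -> nat -> R -> R) (ut : R -> R -> R) (C1 : R).
Hypothesis mu_bnd : forall t : R, 0 <= t <= T -> 0 <= mu t <= mumax.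
Hypothesis rA : forall t, 0 <= t <= T -> sobrep l 4 (u ^~ t) (A t).
Hypothesis rB : forall t, 0 <= t <= T -> sobrep l 4 (ut ^~ t) (B t).
Hypothesis tA : forall k x, (k < 4)%N -> 0 <= x <= l -> tder T (fun t => A t k x) (fun t => B t k x).
Hypothesis tB : forall k x, (k < 3)%N -> 0 <= x <= l -> tder T (fun t => B t k x) (fun t => K t k x).
Hypothesis K_le : forall t k x, 0 <= t <= T -> (k < 3)%N -> 0 <= x <= l -> `|K t k x| <= C1.
Hypothesis A_le : forall t, 0 <= t <= T -> \int[leb]_(x in `]0, l[) `|A t 4%N x| <= C1.
Hypothesis B_le : forall t, 0 <= t <= T -> \int[leb]_(x in `]0, l[) `|B t 4%N x| <= C1.
Hypothesis uA : forall t x, 0 <= t <= T -> 0 <= x <= l -> u x t = A t 0%N x.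

Lemma tder_eq (q p p' : R -> R) : (forall t, 0 <= t <= T -> q t = p t) ->
  tder T p p' -> tder T q p'.
Proof.
move=> qp dp t t0T; have pf := within_proper T_gt0 t0T.
apply: cvg_trans (dp t t0T); apply: near_eq_cvg.
exists 1 => //= s _ _; rewrite /= in_itv/= => s0T.
by rewrite !qp.
Qed.

(** The classical derivatives in the equation are derivatives of the representatives
    at interior points. *)
Lemma dxx_rep t x : 0 <= t <= T -> 0 < x < l -> dxx u x t = A t 2%N x.
Proof.
move=> t0T xl.
have near_in y : 0 < y < l -> \forall z \near y, 0 < z < l.
  move=> /andP[y0 yl]; near=> z; apply/andP; split; near: z.
    exact: lt_nbhsr.
  exact: lt_nbhsl.
have d1 y : 0 < y < l -> derive1 (u ^~ t) y = A t 1%N y.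
  move=> yI; have d := sobrep_is_derive l_gt0 (rA t0T) (isT : (1 < 4)%N) yI.
  rewrite derive1E (@near_eq_derive _ _ _ _ (A t 0%N)); first by case: d.
  near=> z; apply: uA => //; have /andP[a b] : 0 < z < l by near: z; exact: near_in.
  by rewrite !ltW.
rewrite /dxx derive1nS derive1n1.
have d := sobrep_is_derive l_gt0 (rA t0T) (isT : (2 < 4)%N) xl.
rewrite derive1E (@near_eq_derive _ _ _ _ (A t 1%N)); first by case: d.
near=> z; apply: d1; near: z; exact: near_in.
Unshelve. all: by end_near. Qed.

Lemma time_derive_rep t x : 0 <= t <= T -> 0 < x < l ->
  time_derive T (dxx u x) t = B t 2%N x.
Proof.
move=> t0T xl; have xl' : 0 <= x <= l by case/andP: xl => a b; rewrite !ltW.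
apply: (@time_derive_tder _ T T_gt0 _ (fun t => B t 2%N x)) => //.
by apply: tder_eq (tA _ xl') => // s s0T; exact: dxx_rep.
Qed.

Lemma caputo_rep t x : 0 < t <= T -> 0 <= x <= l ->
  caputo alpha u x t =
  (Gamma (1 - alpha))^-1 * \int[leb]_(s in `]0, t[) (ker alpha t s * B s 0%N x).
Proof.
move=> /andP[t0 tT] xl; rewrite /caputo; congr (_ * _).
apply: eq_Rintegral => s; rewrite inE /= in_itv/= => /andP[s0 st].
rewrite /ker; congr (_ * _).
have sI : 0 < s < T by rewrite s0 (lt_le_trans st).
have d := tder_is_derive (tA (isT : (0 < 4)%N) xl) sI.
rewrite derive1E (@near_eq_derive _ _ _ _ (fun s => A s 0%N x)); first by case: d.
near=> z; apply: uA => //; apply/andP; split; apply/ltW; near: z.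
  exact: lt_nbhsr.
by apply: lt_nbhsl; exact: lt_le_trans tT.
Unshelve. all: by end_near. Qed.

Variables (r : R) (M n : nat).
Hypotheses (r_ge1 : 1 <= r) (M_gt0 : (0 < M)%N).
Local Notation N := n.+1.
Local Notation h := (hstep l N).
Local Notation t := (tnode T r M).
Local Notation tm := (taumax T r M).
Hypothesis u_bc : forall t : R, 0 <= t <= T -> u 0 t = 0 /\ u l t = 0.
Hypothesis u_eq : forall i k, (1 <= i < N)%N -> (1 <= k <= M)%N ->
  equation_at alpha T mu u f (xnode l N i) (t k).

Let h_gt0 : 0 < h. Proof. by rewrite /hstep divr_gt0// ltr0n. Qed.

Let C1_ge0 : 0 <= C1.
Proof. by apply: le_trans (A_le (_ : 0 <= 0 <= T)); [exact: Rintegral_ge0|rewrite lexx ltW]. Qed.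

Lemma xnode_in i : (i <= N)%N -> 0 <= xnode l N i <= l.
Proof. by move=> iN; apply: xnode_le. Qed.

Lemma xnode_inner i : (i < n)%N -> 0 < xnode l N i.+1 < l.
Proof.
move=> iN; rewrite /xnode mulr_gt0// ?ltr0n//= /hstep mulrCA gtr_pMr//.
by rewrite ltr_pdivrMr ?ltr0n// mul1r ltr_nat.
Qed.

Definition exact_nodal k : 'cV[R]_N.-1 := nodal l N (u ^~ (t k)).

Lemma ext_nodal s i : 0 <= s <= T -> (i <= N)%N ->
  vext (nodal l N (u ^~ s)) i = A s 0%N (xnode l N i).
Proof.
move=> s0T iN; rewrite -uA//; last exact: xnode_in.
have [b0 bl] := u_bc s0T.
case: i iN => [|i] iN /=; first by rewrite /xnode mul0r b0.
case: insubP => [j _ <-|] /=; first by rewrite mxE.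
rewrite -leqNgt => ni; have -> : i = n by apply/eqP; rewrite eqn_leq ni andbT -ltnS.
by rewrite /xnode /hstep mulrC divfK ?bl// pnatr_eq0.
Qed.

(** L_h on the representatives themselves, where the boundary nodes need no special
    treatment. *)
Definition stencil (F : R -> nat -> R -> R) s (i : nat) : R :=
  (F s 0%N (xnode l N i) - 2 * F s 0%N (xnode l N i.+1) + F s 0%N (xnode l N i.+2)) / h ^+ 2.

Lemma Lh_nodal s (i : 'I_n) : 0 <= s <= T -> Lh l (nodal l N (u ^~ s)) i 0 = stencil A s i.
Proof.
move=> s0T; have iN := ltn_ord i.
rewrite mxE !ext_nodal//; first exact: ltnW.
by rewrite ltnW// ltnS ltnW.
Qed.

(** The defect of the exact nodal values in the scheme: the errors satisfy the
    scheme with this right-hand side. *)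
Definition residual k : 'cV[R]_N.-1 :=
  let d := dcoef T r M alpha in let G : R := Gamma (2 - alpha) in let tauk := tau T r M in
  (d k k / G) *: exact_nodal k - (1 + mu (t k) / tauk k) *: Lh l (exact_nodal k)
  - ((d k 1%N / G) *: exact_nodal 0%N + G^-1 *: \sum_(1 <= j < k) (d k j.+1 - d k j) *: exact_nodal j)
  - nodal l N (f ^~ (t k)) + (mu (t k) / tauk k) *: Lh l (exact_nodal k.-1).

(** Differentiating in time replaces u by u_t, to which [sobrep_laplacian_sum]
    applies as well.  The absolute values are handled by pairing with the signs of
    the increments, which are fixed numbers: a single linear combination then has to
    be differentiated. *)
Lemma sum_tder_lipschitz s s' : 0 <= s -> s < s' -> s' <= T ->
  \sum_(i < n) `|(stencil A s' i - A s' 2%N (xnode l N i.+1)) - (stencil A s i - A s 2%N (xnode l N i.+1))|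
  <= 4 * h * C1 * (s' - s).
Proof.
move=> s0 ss' s'T.
pose Z (F : R -> nat -> R -> R) (i : 'I_n) s := stencil F s i - F s 2%N (xnode l N i.+1).
have dZ i : tder T (Z A i) (Z B i).
  have iN : (i.+2 <= N)%N by exact: ltn_ord.
  have d0 j : (j <= N)%N -> tder T (fun s => A s 0%N (xnode l N j)) (fun s => B s 0%N (xnode l N j)).
    by move=> jN; apply: tA => //; exact: xnode_in.
  have d2 : tder T (fun s => A s 2%N (xnode l N i.+1)) (fun s => B s 2%N (xnode l N i.+1)).
    by apply: tA => //; apply: xnode_in; exact: ltnW.
  have l1 := tder_lin T_gt0 (a := 1) (b := -2) (d0 i (ltnW (ltnW iN))) (d0 i.+1 (ltnW iN)).
  have l2 := tder_lin T_gt0 (a := (h ^+ 2)^-1) (b := (h ^+ 2)^-1) l1 (d0 i.+2 iN).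
  have := tder_lin T_gt0 (a := 1) (b := -1) l2 d2.
  have e (F : R -> nat -> R -> R) : (fun s => 1 * ((h ^+ 2)^-1 * (1 * F s 0%N (xnode l N i) + -2 * F s 0%N (xnode l N i.+1))
      + (h ^+ 2)^-1 * F s 0%N (xnode l N i.+2)) + -1 * F s 2%N (xnode l N i.+1)) = Z F i.
    by apply/funext => y; rewrite /Z /stencil; ring.
  by rewrite !e.
pose sg (i : 'I_n) : R := Num.sg (Z A i s' - Z A i s).
have dQ := tder_sum T_gt0 (c := sg) dZ.
have Qle y : 0 <= y <= T -> `|\sum_(i < n) sg i * Z B i y| <= 4 * h * C1.
  move=> y0T; apply: le_trans (ler_norm_sum _ _ _) _.
  apply: le_trans (_ : _ <= \sum_(i < N.-1) `|Z B i y|) _.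
    apply: ler_sum => i _; rewrite normrM ler_piMl//.
    by rewrite normr_sg; case: (_ != 0).
  apply: le_trans (sobrep_laplacian_sum l_gt0 (rB y0T) (ltn0Sn n)) _.
  by rewrite ler_wpM2l// ?B_le// mulr_ge0// ltW.
have := tder_le dQ Qle s0 (ltW ss') s'T.
apply: le_trans; rewrite -sumrB.
apply: le_trans (ler_norm _); rewrite le_eqVlt; apply/orP; left; apply/eqP.
by apply: eq_bigr => i _; rewrite -mulrBr /sg -normrEsg.
Qed.

(** The differential equation expresses f through the exact terms, so each discrete
    term is compared with its exact counterpart. *)
Lemma residual_split k (i : 'I_n) : (1 <= k <= M)%N ->
  let x := xnode l N i.+1 in
  residual k i 0 =
  ((Gamma (2 - alpha))^-1 * \sum_(j < k) dcoef T r M alpha k j.+1 * (A (t j.+1) 0%N x - A (t j) 0%N x)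
    - (Gamma (1 - alpha))^-1 * \int[leb]_(s in `]0, t k[) (ker alpha (t k) s * B s 0%N x))
  - (stencil A (t k) i - A (t k) 2%N x)
  - mu (t k) * (((stencil A (t k) i - A (t k) 2%N x) - (stencil A (t k.-1) i - A (t k.-1) 2%N x)) / (t k - t k.-1)
     + ((A (t k) 2%N x - A (t k.-1) 2%N x) / (t k - t k.-1) - B (t k) 2%N x)).
Proof.
move=> kM x; have /andP[k1 kM'] := kM.
have tI j : (j <= M)%N -> 0 <= t j <= T := tnode_itv T_gt0 r_ge1 M_gt0 (k := j).
have xI : 0 < x < l by exact: xnode_inner.
have xI' : 0 <= x <= l by case/andP: xI => a b; rewrite !ltW.
have kM1 : (k.-1 <= M)%N by exact: leq_trans (leq_pred k) kM'.
have t0 : 0 < t k - t k.-1 by rewrite subr_gt0; apply: tnode_lt => //; rewrite prednK.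
have tk0 : 0 < t k <= T.
  have /andP[_ ->] := tI k kM'; rewrite andbT -(tnode0 T M r_ge1); exact: tnode_lt.
have iN : (1 <= i.+1 < N)%N by rewrite /= ltnS.
have := u_eq iN kM; rewrite /equation_at -/x.
rewrite (caputo_rep tk0 xI') (dxx_rep (tI k kM') xI) (time_derive_rep (tI k kM') xI).
move=> feq.
have UA j : (j <= M)%N -> exact_nodal j i 0 = A (t j) 0%N x.
  by move=> jM; rewrite mxE uA// tI.
have ab := abel_sum (dcoef T r M alpha k) exact_nodal k1.
have e1 : (dcoef T r M alpha k k / Gamma (2 - alpha)) * exact_nodal k i 0 -
   (dcoef T r M alpha k 1%N / Gamma (2 - alpha) * exact_nodal 0%N i 0 +
    (Gamma (2 - alpha))^-1 * (\sum_(1 <= j < k) (dcoef T r M alpha k j.+1 - dcoef T r M alpha k j) *: exact_nodal j) i 0) =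
   (Gamma (2 - alpha))^-1 * \sum_(j < k) dcoef T r M alpha k j.+1 * (A (t j.+1) 0%N x - A (t j) 0%N x).
  have -> : \sum_(j < k) dcoef T r M alpha k j.+1 * (A (t j.+1) 0%N x - A (t j) 0%N x) =
      (\sum_(1 <= j < k.+1) dcoef T r M alpha k j *: (exact_nodal j - exact_nodal j.-1)) i 0.
    rewrite big_add1 /= big_mkord summxE; apply: eq_bigr => j _.
    have jk := ltn_ord j.
    rewrite [RHS]mxE [X in _ = _ * X]mxE [X in _ = _ * (_ + X)]mxE !UA//.
      exact: leq_trans (ltnW jk) kM'.
    exact: leq_trans jk kM'.
  rewrite ab !mxE; set s1 := (\sum_(1 <= j < k) _).
  by rewrite /=; ring.
rewrite -e1 /residual /=.
set s1 := (\sum_(1 <= j < k) _).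
have LU j : (j <= M)%N ->
    (vext (exact_nodal j) i - 2 * vext (exact_nodal j) i.+1 + vext (exact_nodal j) i.+2) / h ^+ 2 = stencil A (t j) i.
  by move=> jM; rewrite -(Lh_nodal _ (tI j jM)) mxE.
rewrite !mxE !LU// -[f _ _]feq /tau.
move: (dcoef _ _ _ _ _ _ / _ * u _ (t k)) (_ + _^-1 * s1 i 0) => a1 a2.
move: (_ * \int[leb]_(s in _) _) (stencil A _ _) (stencil A _ _) (A _ _ x) (A _ _ x) (mu _) (B _ _ x) => I S1 S2 A1 A2 m b.
have t0' : t k - t k.-1 != 0 by rewrite gt_eqF.
by move: (t k - t k.-1) t0' => d d0; field.
Qed.

(** Only the two middle terms of [residual_split] involve the stencil error and need
    the sum over the nodes; h n <= l turns the pointwise bounds of the other ones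
    into bounds of the discrete L^1 norm. *)
Lemma residual_bound k : (1 <= k <= M)%N ->
  l1norm l (residual k : 'cV_n) <=
  (l * ((Gamma (2 - alpha))^-1 * T `^ (1 - alpha) * C1) + l * mumax * C1
    + 4 * C1 + 4 * mumax * C1) * (h ^+ 2 + tm).
Proof.
move=> kM; have /andP[k1 kM'] := kM.
have tI j : (j <= M)%N -> 0 <= t j <= T := tnode_itv T_gt0 r_ge1 M_gt0 (k := j).
have kM1 : (k.-1 <= M)%N by exact: leq_trans (leq_pred k) kM'.
have tau0 : 0 < t k - t k.-1 by rewrite subr_gt0; apply: tnode_lt => //; rewrite prednK.
have taum : t k - t k.-1 <= tm by exact: tau_le_taumax.
have /andP[m0 m1] := mu_bnd (tI k kM').
have mm0 : 0 <= mumax by exact: le_trans m1.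
have tm0 : 0 <= tm by exact: taumax_ge0.
set c := (Gamma (2 - alpha))^-1 * T `^ (1 - alpha) * C1.
have c0 : 0 <= c by rewrite !mulr_ge0 ?powR_ge0// invr_ge0 Gamma_ge0.
pose X (i : 'I_n) := xnode l N i.+1.
have XI (i : 'I_n) : 0 <= X i <= l by apply: xnode_in; rewrite ltnW// ltnS.
pose E2 (i : 'I_n) := `|stencil A (t k) i - A (t k) 2%N (X i)|.
pose E3 (i : 'I_n) := `|(stencil A (t k) i - A (t k) 2%N (X i)) - (stencil A (t k.-1) i - A (t k.-1) 2%N (X i))|.
have pt (i : 'I_n) : `|residual k i 0| <= c * tm + E2 i + mumax * (E3 i / (t k - t k.-1) + C1 * tm).
  rewrite residual_split//= -/(X i).
  have b1 := caputo_L1 alpha01 T_gt0 r_ge1 M_gt0 (tA (isT : (0 < 4)%N) (XI i))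
    (tB (isT : (0 < 3)%N) (XI i)) (fun s sI => K_le sI (isT : (0 < 3)%N) (XI i)) kM.
  have b2 : `|(A (t k) 2%N (X i) - A (t k.-1) 2%N (X i)) / (t k - t k.-1) - B (t k) 2%N (X i)| <= C1 * tm.
    have /andP[tk1 _] := tI _ kM1; have /andP[_ tkT] := tI _ kM'.
    have tlt : t k.-1 < t k by rewrite -subr_gt0.
    have tkI : t k.-1 <= t k <= t k by rewrite lexx ltW.
    apply: le_trans (tder_taylor T_gt0 (tA (isT : (2 < 4)%N) (XI i)) (tB (isT : (2 < 3)%N) (XI i))
      (fun s sI => K_le sI (isT : (2 < 3)%N) (XI i)) tk1 tlt tkT tkI) _.
    by rewrite ler_wpM2l.
  apply: le_trans (ler_normB _ _) _; apply: lerD.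
    by apply: le_trans (ler_normB _ _) _; apply: lerD.
  rewrite normrM (ger0_norm m0); apply: ler_pM => //.
  apply: le_trans (ler_normD _ _) _; apply: lerD => //.
  by rewrite normrM [`|_^-1|]ger0_norm// invr_ge0 ltW.
have s2 : \sum_(i < n) E2 i <= 4 * h * C1.
  apply: le_trans (sobrep_laplacian_sum l_gt0 (rA (tI k kM')) (ltn0Sn n)) _.
  by rewrite ler_wpM2l ?A_le ?tI// mulr_ge0// ltW.
have s3 : \sum_(i < n) E3 i <= 4 * h * C1 * (t k - t k.-1).
  have /andP[tk1 _] := tI _ kM1; have /andP[_ tkT] := tI _ kM'.
  have tlt : t k.-1 < t k by rewrite -subr_gt0.
  exact: (sum_tder_lipschitz tk1 tlt tkT).
have hn : h * n%:R <= l.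
  rewrite /hstep -mulrA ger_pMr// mulrC ler_pdivrMr ?ltr0n// mul1r ler_nat//.
apply: le_trans (_ : _ <= h * (\sum_(i < n) (c * tm + E2 i + mumax * (E3 i / (t k - t k.-1) + C1 * tm)))) _.
  by rewrite /l1norm ler_pM2l//; apply: ler_sum => i _; exact: pt.
have -> : \sum_(i < n) (c * tm + E2 i + mumax * (E3 i / (t k - t k.-1) + C1 * tm)) =
    n%:R * (c * tm) + \sum_(i < n) E2 i + mumax * ((\sum_(i < n) E3 i) / (t k - t k.-1) + n%:R * (C1 * tm)).
  rewrite 2!big_split /=; congr (_ + _ + _); first by rewrite sumr_const card_ord mulr_natl.
  by rewrite -mulr_sumr big_split /= mulr_suml sumr_const card_ord mulr_natl.
have s3' : (\sum_(i < n) E3 i) / (t k - t k.-1) <= 4 * h * C1 by rewrite ler_pdivrMr.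
have q0 : 0 <= c * tm by rewrite mulr_ge0.
have q1 : 0 <= C1 * tm by rewrite mulr_ge0.
have q2 : 0 <= h ^+ 2 by exact: sqr_ge0.
have r1 : h * (n%:R * (c * tm)) <= l * c * tm.
  rewrite -(mulrA l c) (mulrA h); exact: ler_wpM2r.
have r2 : h * \sum_(i < n) E2 i <= 4 * C1 * h ^+ 2.
  apply: le_trans (ler_wpM2l (ltW h_gt0) s2) _.
  by rewrite le_eqVlt; apply/orP; left; apply/eqP; ring.
have r3 : h * (mumax * ((\sum_(i < n) E3 i) / (t k - t k.-1) + n%:R * (C1 * tm))) <=
    mumax * (4 * C1 * h ^+ 2 + l * (C1 * tm)).
  rewrite mulrCA ler_wpM2l// mulrDr; apply: lerD.
    apply: le_trans (ler_wpM2l (ltW h_gt0) s3') _.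
    by rewrite le_eqVlt; apply/orP; left; apply/eqP; ring.
  by rewrite (mulrA h); exact: ler_wpM2r.
apply: le_trans (_ : _ <= l * c * tm + 4 * C1 * h ^+ 2 + mumax * (4 * C1 * h ^+ 2 + l * (C1 * tm))) _.
  by rewrite 2!(mulrDr h); apply: lerD => //; apply: lerD.
have -> : (l * c + l * mumax * C1 + 4 * C1 + 4 * mumax * C1) * (h ^+ 2 + tm) =
  (l * c * tm + 4 * C1 * h ^+ 2 + mumax * (4 * C1 * h ^+ 2 + l * (C1 * tm))) +
  ((l * c + l * mumax * C1) * h ^+ 2 + (4 * C1 + 4 * mumax * C1) * tm) by ring.
have l0 := ltW l_gt0.
have lc : 0 <= l * c := mulr_ge0 l0 c0.
have lm : 0 <= l * mumax * C1 := mulr_ge0 (mulr_ge0 l0 mm0) C1_ge0.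
have c4 : 0 <= 4 * C1 by rewrite mulr_ge0.
have m4 : 0 <= 4 * mumax * C1 by rewrite mulr_ge0// mulr_ge0.
by rewrite lerDl; apply: addr_ge0; apply: mulr_ge0 => //; exact: addr_ge0.
Qed.

End Consistency.

(** * The error estimate *)

Section ErrorBound.
Context {R : realType}.
Local Notation leb := (@lebesgue_measure R).

(** All that the error analysis uses of the exact solution: A, B, K represent u, u_t
    and u_tt together with their derivatives in x, and are linked by pointwise
    differentiation in time. *)
Lemma regularity (l T Cu : R) (u ut utt : R -> R -> R) :
  0 < l -> 0 < T ->
  (forall t : R, 0 <= t <= T -> {within `[0, l], continuous (u ^~ t)}) ->
  H_C1 l T 4 u ut -> H_C2 l T 3 u ut utt ->
  (forall t : R, 0 <= t <= T ->
     Hnorm l 4 (u ^~ t) + Hnorm l 4 (ut ^~ t) + Hnorm l 3 (utt ^~ t) <= Cu) ->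
  exists A B K : R -> nat -> R -> R, exists C1 : R,
  [/\ forall t, 0 <= t <= T -> sobrep l 4 (u ^~ t) (A t),
      forall t, 0 <= t <= T -> sobrep l 4 (ut ^~ t) (B t),
      forall k x, (k < 4)%N -> 0 <= x <= l -> tder T (fun t => A t k x) (fun t => B t k x),
      forall k x, (k < 3)%N -> 0 <= x <= l -> tder T (fun t => B t k x) (fun t => K t k x)
    & [/\ forall t k x, 0 <= t <= T -> (k < 3)%N -> 0 <= x <= l -> `|K t k x| <= C1,
      forall t, 0 <= t <= T -> \int[leb]_(x in `]0, l[) `|A t 4%N x| <= C1,
      forall t, 0 <= t <= T -> \int[leb]_(x in `]0, l[) `|B t 4%N x| <= C1
    & forall t x, 0 <= t <= T -> 0 <= x <= l -> u x t = A t 0%N x]].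
Proof.
move=> l0 T0 u_repr [cu cut du] [_ [_ cutt dut]] u_bnd.
have rep m (w : R -> R -> R) : H_continuous l T m w ->
    exists W, forall t, 0 <= t <= T -> sobrep l m (w ^~ t) (W t).
  move=> cw.
  have ex t : exists G, 0 <= t <= T -> sobrep l m (w ^~ t) G.
    have [tT|tT] := pselect (0 <= t <= T); last by exists (fun _ _ => 0).
    by have [G GP] := sobrep_exists l0 (proj1 (cw t tT)); exists G.
  by have [W WP] := boolp.choice ex; exists W.
have [A rA] := rep _ _ cu; have [B rB] := rep _ _ cut; have [K rK] := rep _ _ cutt.
have [C C0 CP] := sobrep_bound l0.
have sum3 (a b c d : R) : 0 <= a -> 0 <= b -> 0 <= c -> a + b + c <= d -> [/\ a <= d, b <= d & c <= d].
  by move=> *; split; lra.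
have bd t (tT : 0 <= t <= T) := sum3 _ _ _ _ (Hnorm_ge0 l 4 (u ^~ t)) (Hnorm_ge0 l 4 (ut ^~ t))
  (Hnorm_ge0 l 3 (utt ^~ t)) (u_bnd t tT).
have scale (a b : R) : a <= C * b -> b <= Cu -> a <= C * Cu.
  by move=> ab bC; apply: le_trans ab _; rewrite ler_pM2l.
exists A, B, K, (C * Cu); split => //.
- exact: (tder_sobrep l0 du rA rB).
- have rB3 t : 0 <= t <= T -> sobrep l 3 (ut ^~ t) (B t).
    by move=> tT; apply: sobrepW (rB t tT).
  exact: (tder_sobrep l0 dut rB3 rK).
- split.
  + move=> t k x tT k3 xl; have [H _] := CP _ _ _ (rK t tT).
    by have [_ _ h] := bd t tT; exact: scale (H k x k3 xl) h.
  + move=> t tT; have [_ H] := CP _ _ _ (rA t tT).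
    by have [h _ _] := bd t tT; exact: scale H h.
  + move=> t tT; have [_ H] := CP _ _ _ (rB t tT).
    by have [_ h _] := bd t tT; exact: scale H h.
  + by move=> t x tT xl; apply/esym; apply: (sobrep0 l0 (u_repr t tT) (rA t tT)).
Qed.

Variables (l T alpha r mu0 mumax Cu : R) (mu : R -> R) (u ut utt f : R -> R -> R).
Hypotheses (l_gt0 : 0 < l) (T_gt0 : 0 < T) (alpha01 : 0 < alpha < 1) (r_ge1 : 1 <= r).
Hypothesis mu0_gt0 : 0 < mu0.
Hypothesis mu_bnd : forall t : R, 0 <= t <= T -> mu0 <= mu t <= mumax.
Hypothesis u_repr : forall t : R, 0 <= t <= T -> {within `[0, l], continuous (u ^~ t)}.
Hypothesis u_eq_grid : forall N M i k : nat, (1 <= i < N)%N -> (1 <= k <= M)%N ->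
  equation_at alpha T mu u f (xnode l N i) (tnode T r M k).
Hypothesis u_bc : forall t : R, 0 <= t <= T -> u 0 t = 0 /\ u l t = 0.
Hypothesis u_C1H4 : H_C1 l T 4 u ut.
Hypothesis u_C2H3 : H_C2 l T 3 u ut utt.
Hypothesis u_bnd : forall t : R, 0 <= t <= T ->
  Hnorm l 4 (u ^~ t) + Hnorm l 4 (ut ^~ t) + Hnorm l 3 (utt ^~ t) <= Cu.

(** The error starts at 0 and satisfies the scheme with the residual as right-hand
    side, so that [stability] applies with the bound of [residual_bound]. *)
Lemma gradnorm_error : exists2 C : R, 0 < C &
  forall (N M : nat) (uh : nat -> 'cV[R]_N.-1), (0 < N)%N -> (0 < M)%N ->
    scheme l T alpha r mu f (u ^~ 0) M uh ->
    forall k, (k <= M)%N ->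
    gradnorm l (nodal_error l T r u M uh k) <= C * (hstep l N ^+ 2 + taumax T r M).
Proof.
have [A [B [K [C1 [rA rB tA tB [K_le A_le B_le uA]]]]]] :=
  regularity l_gt0 T_gt0 u_repr u_C1H4 u_C2H3 u_bnd.
have mu_bnd' t : 0 <= t <= T -> 0 <= mu t <= mumax.
  by move=> tT; have /andP[a b] := mu_bnd tT; rewrite b (le_trans (ltW mu0_gt0) a).
have mm0 : 0 <= mumax.
  have zT : 0 <= (0:R) <= T by rewrite lexx ltW.
  by have /andP[a b] := mu_bnd' _ zT; exact: le_trans b.
have C1_ge0 : 0 <= C1.
  have zT : 0 <= (0:R) <= T by rewrite lexx ltW.
  by apply: le_trans (A_le _ zT); exact: Rintegral_ge0.
have [Cs Cs0 CsP] := stability l_gt0 alpha01 T_gt0 mu0_gt0.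
pose Cr := l * ((Gamma (2 - alpha))^-1 * T `^ (1 - alpha) * C1) + l * mumax * C1
    + 4 * C1 + 4 * mumax * C1.
have Cr0 : 0 <= Cr.
  have l0 := ltW l_gt0.
  have c0 : 0 <= (Gamma (2 - alpha))^-1 * T `^ (1 - alpha) * C1.
    by rewrite !mulr_ge0 ?powR_ge0// invr_ge0 Gamma_ge0.
  rewrite /Cr; move: c0; set c := _^-1 * _ * C1 => c0.
  have h4 : 0 <= 4 :> R by rewrite ler0n.
  exact: (addr_ge0 (addr_ge0 (addr_ge0 (mulr_ge0 l0 c0) (mulr_ge0 (mulr_ge0 l0 mm0) C1_ge0))
    (mulr_ge0 h4 C1_ge0)) (mulr_ge0 (mulr_ge0 h4 mm0) C1_ge0)).
(* Cr may vanish, hence the 1. *)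
exists (Cs * (Cr + 1)); first by rewrite mulr_gt0// ltr_wpDl.
move=> [//|n] M uh _ M0 [uh0 uhk] k kM.
have q0 : 0 <= hstep l n.+1 ^+ 2 + taumax T r M.
  by rewrite addr_ge0 ?sqr_ge0// taumax_ge0.
pose e := nodal_error l T r u M uh.
pose rho := residual l T alpha mu u f r M n.
have rhoB j : (1 <= j <= M)%N -> l1norm l (rho j : 'cV_n) <= (Cr + 1) * (hstep l n.+1 ^+ 2 + taumax T r M).
  move=> jM; apply: le_trans (_ : _ <= Cr * (hstep l n.+1 ^+ 2 + taumax T r M)) _.
    apply: (residual_bound l_gt0 T_gt0 alpha01 mu_bnd' rA rB tA tB K_le A_le B_le uA r_ge1 M0 u_bc) => //.
    by move=> i j' iN j'M; exact: u_eq_grid.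
  by rewrite ler_wpM2r// lerDl.
rewrite -mulrA; apply: (CsP r M n (fun j => mu (tnode T r M j)) e rho) => //.
- by rewrite mulr_ge0// addr_ge0.
- by rewrite /e /nodal_error uh0 tnode0// subrr.
- move=> j /andP[_ jM]; have := mu_bnd (tnode_itv T_gt0 r_ge1 M0 jM).
  by case/andP.
move=> j jM d G tauk.
have LB (a b : 'cV[R]_n.+1.-1) : Lh l (a - b) = Lh l a - Lh l b.
  by rewrite -[in RHS]LhN; exact: LhD.
have eE i : e i = exact_nodal l T u r M n i - uh i by [].
have SE : \sum_(1 <= i < j) (d j i.+1 - d j i) *: e i =
  \sum_(1 <= i < j) (d j i.+1 - d j i) *: exact_nodal l T u r M n i
  - \sum_(1 <= i < j) (d j i.+1 - d j i) *: uh i.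
  by rewrite -sumrB; apply: eq_bigr => i _; rewrite eE scalerBr.
have := uhk j jM; rewrite SE !eE !LB /rho /residual -/d -/G -/tauk.
move: (\sum_(1 <= i < j) _ *: exact_nodal _ _ _ _ _ _ i) (\sum_(1 <= i < j) _ *: uh i) => S1 S2.
move: (Lh l (exact_nodal _ _ _ _ _ _ j)) (Lh l (uh j)) (Lh l (exact_nodal _ _ _ _ _ _ j.-1)) (Lh l (uh j.-1)).
move: (nodal _ _ (f ^~ _)) => F L1 L2 L3 L4 eqn; apply/colP => i.
have := congr1 (fun v : 'cV[R]_n.+1.-1 => v i 0) eqn; rewrite !mxE.
move: G^-1 (d j j / G) (mu _ / _) (d j 1%N / G) (u _ _) (u _ _) => g p q s U1 U0 E.
by apply/eqP; rewrite -subr_eq0 -[X in _ == X]oppr0 -(subrr (p * uh j i 0 - (1 + q) * L2 i 0)) {2}E; apply/eqP; ring.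
Qed.

End ErrorBound.

Section ErrorNorms.
Context {R : realType}.
Variables (l T r mumax D : R) (mu : R -> R) (n M : nat) (e : nat -> 'cV[R]_n.+1.-1).
Hypotheses (l_gt0 : 0 < l) (T_gt0 : 0 < T) (r_ge1 : 1 <= r) (M_gt0 : (0 < M)%N) (D_ge0 : 0 <= D).
Hypothesis mu_le : forall t : R, 0 <= t <= T -> mu t <= mumax.
Hypothesis e_le : forall k, (k <= M)%N -> gradnorm l (e k) <= D.

Let bigmax_bound (F : nat -> R) c : 0 <= c -> (forall k, (k <= M)%N -> F k <= c) ->
  \big[Num.max/0]_(0 <= k < M.+1) F k <= c.
Proof.
move=> c0 Fc; rewrite big_seq; apply: bigmax_le => // k.
by rewrite mem_index_iota ltnS => /andP[_ kM]; exact: Fc.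
Qed.

Lemma max_gradnorm_le : max_gradnorm l M e <= D.
Proof. exact: bigmax_bound. Qed.

Lemma max_hnorm_le : max_hnorm l M e <= l * D.
Proof.
apply: bigmax_bound => [|k kM]; first by rewrite mulr_ge0// ltW.
apply: le_trans (hnorm_gradnorm l_gt0 (e k)) _.
by rewrite ler_pM2l// e_le.
Qed.

Lemma max_mu_gradnorm_le : max_mu_gradnorm l T r M e mu <= Num.sqrt mumax * D.
Proof.
apply: bigmax_bound => [|k kM]; first by rewrite mulr_ge0// sqrtr_ge0.
apply: ler_pM; rewrite ?sqrtr_ge0//; last exact: e_le.
by apply: ler_wsqrtr; apply: mu_le; exact: tnode_itv.
Qed.

Lemma l2_gradnorm_le : l2_gradnorm l T r M e <= Num.sqrt T * D.
Proof.
rewrite -[D]ger0_norm// -sqrtr_sqr -sqrtrM ?(ltW T_gt0)//; apply: ler_wsqrtr.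
have -> : T * D ^+ 2 = \sum_(1 <= k < M.+1) tau T r M k * D ^+ 2.
  by rewrite -mulr_suml sum_tau// tnodeM.
rewrite big_nat [leRHS]big_nat; apply: ler_sum => k /andP[k1 kM].
rewrite ler_pM2l ?(tau_gt0 T_gt0 r_ge1 M_gt0 k1)//.
by apply: lerXn2r; rewrite ?nnegrE ?sqrtr_ge0//; exact: e_le.
Qed.

End ErrorNorms.

Lemma taumax_bigO (R : realType) (T r : R) : 0 < T -> 1 <= r ->
  (taumax T r : nat -> R) =O_\oo (fun M : nat => M%:R^-1 : R).
Proof.
move=> T0 r1; apply/eqO_exP; exists (T * r).
  by rewrite mulr_gt0// (lt_le_trans ltr01).
near=> M; have M0 : (0 < M)%N by near: M; exact: nbhs_infty_gt.
rewrite ger0_norm ?taumax_ge0// ger0_norm ?invr_ge0//.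
exact: taumax_le.
Unshelve. all: by end_near. Qed.

Theorem theorem3p3 (R : realType) (l T alpha r mu0 mumax Cu : R)
    (mu : R -> R) (u ut utt f : R -> R -> R)
    (l_gt0 : 0 < l) (T_gt0 : 0 < T) (alpha01 : 0 < alpha < 1) (r_ge1 : 1 <= r)
    (mu_cont : {within `[0, T], continuous mu})
    (mu0_gt0 : 0 < mu0)
    (mu_bnd : forall t : R, 0 <= t <= T -> mu0 <= mu t <= mumax)
    (* u(., t) is the continuous representative of its class *)
    (u_repr : forall t : R, 0 <= t <= T -> {within `[0, l], continuous (u ^~ t)})
    (u_eq : forall x t : R, 0 < x < l -> 0 < t < T ->
       equation_at alpha T mu u f x t)
    (u_eq_grid : forall N M i k : nat, (1 <= i < N)%N -> (1 <= k <= M)%N ->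
       equation_at alpha T mu u f (xnode l N i) (tnode T r M k))
    (u_bc : forall t : R, 0 <= t <= T -> u 0 t = 0 /\ u l t = 0)
    (u_C1H4 : H_C1 l T 4 u ut)
    (u_C2H3 : H_C2 l T 3 u ut utt)
    (u_H01 : forall t : R, 0 <= t <= T -> inH01 l (u ^~ t))
    (u_bnd : forall t : R, 0 <= t <= T ->
       Hnorm l 4 (u ^~ t) + Hnorm l 4 (ut ^~ t) + Hnorm l 3 (utt ^~ t) <= Cu) :
  [/\ exists2 C : R, 0 < C &
        forall (N M : nat) (uh : nat -> 'cV[R]_N.-1), (0 < N)%N -> (0 < M)%N ->
          scheme l T alpha r mu f (u ^~ 0) M uh ->
          let e := nodal_error l T r u M uh in
          max_hnorm l M e + max_mu_gradnorm l T r M e mu + l2_gradnorm l T r M e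
          <= C * (hstep l N ^+ 2 + taumax T r M + taumax T r M `^ (2 - alpha)),
      exists2 C : R, 0 < C & exists2 delta : R, 0 < delta &
        forall (N M : nat) (uh : nat -> 'cV[R]_N.-1), (0 < N)%N -> (0 < M)%N ->
          taumax T r M <= delta ->
          scheme l T alpha r mu f (u ^~ 0) M uh ->
          let e := nodal_error l T r u M uh in
          max_hnorm l M e + max_gradnorm l M e + l2_gradnorm l T r M e
          <= C * (hstep l N ^+ 2 + taumax T r M),
      (taumax T r : nat -> R) =O_\oo (fun M : nat => M%:R^-1 : R)
    & exists2 C : R, 0 < C &
        forall (N M : nat) (uh : nat -> 'cV[R]_N.-1), (0 < N)%N -> (0 < M)%N ->
          scheme l T alpha r mu f (u ^~ 0) M uh ->
          let e := nodal_error l T r u M uh in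
          max_hnorm l M e + max_gradnorm l M e + l2_gradnorm l T r M e
          <= C * (hstep l N ^+ 2 + M%:R^-1)].
Proof.
have [C C0 CP] := gradnorm_error l_gt0 T_gt0 alpha01 r_ge1 mu0_gt0 mu_bnd u_repr u_eq_grid
  u_bc u_C1H4 u_C2H3 u_bnd.
have mu_le t : 0 <= t <= T -> mu t <= mumax by move=> /mu_bnd/andP[].
have q_ge0 N M : (0 < M)%N -> 0 <= hstep l N ^+ 2 + taumax T r M.
  by move=> M0; rewrite addr_ge0 ?sqr_ge0// taumax_ge0.
have part2 : forall (N M : nat) (uh : nat -> 'cV[R]_N.-1), (0 < N)%N -> (0 < M)%N ->
    scheme l T alpha r mu f (u ^~ 0) M uh ->
    let e := nodal_error l T r u M uh in
    is_true (max_hnorm l M e + max_gradnorm l M e + l2_gradnorm l T r M e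
    <= (l + 1 + Num.sqrt T) * C * (hstep l N ^+ 2 + taumax T r M)).
  move=> [//|n] M uh N0 M0 /(CP _ _ _ N0 M0) e_le e.
  have D0 := mulr_ge0 (ltW C0) (q_ge0 n.+1 M M0).
  rewrite -[X in _ <= X]mulrA !mulrDl mul1r.
  by rewrite !lerD ?max_hnorm_le ?max_gradnorm_le ?l2_gradnorm_le.
have c2_gt0 : 0 < (l + 1 + Num.sqrt T) * C.
  by rewrite mulr_gt0// addr_gt0 ?sqrtr_gt0// addr_gt0.
split.
- exists ((l + Num.sqrt mumax + Num.sqrt T) * C).
    by rewrite mulr_gt0// ltr_pwDr ?sqrtr_gt0// addr_ge0 ?sqrtr_ge0// ltW.
  move=> [//|n] M uh N0 M0 /(CP _ _ _ N0 M0) e_le; lazy zeta.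
  have D0 := mulr_ge0 (ltW C0) (q_ge0 n.+1 M M0).
  apply: (@le_trans _ _ ((l + Num.sqrt mumax + Num.sqrt T) * C * (hstep l n.+1 ^+ 2 + taumax T r M))).
    rewrite -[X in _ <= X]mulrA !mulrDl.
    by rewrite !lerD ?max_hnorm_le ?max_mu_gradnorm_le ?l2_gradnorm_le.
  rewrite ler_wpM2l ?lerDl ?powR_ge0//.
  by rewrite mulr_ge0 ?(ltW C0)// !addr_ge0 ?sqrtr_ge0 ?(ltW l_gt0).
- exists ((l + 1 + Num.sqrt T) * C) => //; exists 1 => // N M uh N0 M0 _.
  exact: part2.
- exact: taumax_bigO.
- have Tr0 : 0 <= T * r by rewrite mulr_ge0 ?(ltW T_gt0)// (le_trans ler01).
  exists ((l + 1 + Num.sqrt T) * C * (1 + T * r)); first by rewrite mulr_gt0// ltr_wpDr.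
  move=> N M uh N0 M0 sch; lazy zeta; apply: le_trans (part2 N M uh N0 M0 sch) _.
  rewrite -[leRHS]mulrA ler_pM2l//.
  have h2 := sqr_ge0 (hstep l N); have i0 : 0 <= M%:R^-1 :> R by rewrite invr_ge0.
  rewrite mulrDl mul1r -addrA lerD2l mulrDr addrA; apply: ler_wpDl (taumax_le T_gt0 r_ge1 M0).
  by rewrite addr_ge0// mulr_ge0.
Qed.
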